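(* Assume that for some $p_0\in[1,\infty)$, $T$ is an operator acting from $\bigcup_{w\in A_{p_0}}L^{p_0}(w)$ into the space of measurable functions on $\mathbb R^n$ and satisfying $$\|Tf\|_{L^{p_0}(w)}\le C\,\|f\|_{L^{p_0}(w)}\qquad(\ast)$$ for all $w\in A_{p_0}$ and all $f\in L^{p_0}(w)$, with a constant depending on $[w]_{A_{p_0}}$. (i) For every $1<p<\infty$ (and also $p=1$ if $p_0=1$), every $1<\sigma<\infty$, $w\in A_p\cap RH_\sigma$, $0\le\lambda<n/\sigma'$ and $0<\alpha<\lambda$, the operator $T$ is well defined on $\mathcal L^{p,\lambda}(|x|^\alpha w)$ by restriction (that is, $\mathcal L^{p,\lambda}(|x|^\alpha w)\subset\bigcup_{u\in A_{p_0}}L^{p_0}(u)$) and, moreover, there is $C$ such that for all $f\in\mathcal L^{p,\lambda}(|x|^\alpha w)$ $$\|Tf\|_{\mathcal L^{p,\lambda}(|x|^\alpha w)}\le C\,\|f\|_{\mathcal L^{p,\lambda}(|x|^\alpha w)}.$$ (ii) For power weights $|x|^\beta$, for the same $p$ and $0\le\lambda<n$, $T$ is well defined (by restriction) and bounded on $\mathcal L^{p,\lambda}(|x|^\beta)$ if $\lambda-n<\beta<\lambda+n(p-1)$. (iii) If, with $p_0=1$, $(\ast)$ is replaced by the weak estimate from $L^1(w)$ to $L^{1,\infty}(w)$ for all $w\in A_1$ (with a constant depending on $[w]_{A_1}$), then for $w\in A_1\cap RH_\sigma$, $0\le\lambda<n/\sigma'$ and $0<\alpha<\lambda$ the operator $T$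 is bounded from $\mathcal L^{1,\lambda}(|x|^\alpha w)$ to $W\mathcal L^{1,\lambda}(|x|^\alpha w)$, i.e. $\|Tf\|_{W\mathcal L^{1,\lambda}(|x|^\alpha w)}\le C\|f\|_{\mathcal L^{1,\lambda}(|x|^\alpha w)}$.
   Context: A weight is a locally integrable function $w$ on $\mathbb R^n$ with $w>0$ a.e.; $w(A)=\int_A w$, and $\sigma'$ denotes the conjugate exponent, $1/\sigma+1/\sigma'=1$. $\|f\|_{L^{q}(w)}=(\int|f|^q w)^{1/q}$ and $\|f\|_{L^{1,\infty}(w)}=\sup_{t>0}t\,w(\{|f|>t\})$. $T$ is not assumed linear. Morrey norm ($1\le p<\infty$, $0\le\lambda<n$, $u\ge0$ measurable): $\|f\|_{\mathcal L^{p,\lambda}(u)}=\sup_{x\in\mathbb R^n,\,r>0}\big(\frac1{r^\lambda}\int_{B(x,r)}|f|^p u\big)^{1/p}$, and $\mathcal L^{p,\lambda}(u)$ is the set of measurable $f$ with finite norm. Weak Morrey norm: $\|f\|_{W\mathcal L^{p,\lambda}(u)}=\sup_{x\in\mathbb R^n,\,r>0,\,t>0}\big(\frac{t^p\,u(\{y\in B(x,r):|f(y)|>t\})}{r^\lambda}\big)^{1/p}$. Muckenhoupt classes: for $1<p<\infty$, $w\in A_p$ iff $[w]_{A_p}=\sup_B\frac{w(B)}{|B|}\big(\frac{w^{1-p'}(B)}{|B|}\big)^{p-1}<\infty$ over all Euclidean balls; $w\in A_1$ iff there is $c$ with $\frac{w(B)}{|B|}\le c\,w(x)$ for every ball $B$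 and a.e. $x\in B$, and $[w]_{A_1}$ is the smallest such $c$. Reverse Hölder class: for $1<\sigma<\infty$, $w\in RH_\sigma$ iff there is $c$ with $\big(\frac1{|B|}\int_B w^\sigma\big)^{1/\sigma}\le\frac c{|B|}\int_B w$ for all balls $B$. ''A constant depending on $[w]_{A_{p_0}}$'' means $C=\varphi([w]_{A_{p_0}})$ for some nondecreasing $\varphi:[1,\infty)\to(0,\infty)$ independent of $w$ and $f$. The constants in the conclusions are independent of $f$. *)

(* Defs.v *)
From HB Require Import structures.
From mathcomp Require Import all_boot all_order all_algebra.
From mathcomp Require Import all_classical all_reals all_analysis.

Set Implicit Arguments.
Unset Strict Implicit.
Unset Printing Implicit Defensive.

Import Order.TTheory GRing.Theory Num.Theory.
Import numFieldNormedType.Exports.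

Local Open Scope classical_set_scope.
Local Open Scope ring_scope.

(* The tuple type carries the product sigma-algebra, which is the Borel
   sigma-algebra of R^n. *)
Definition Rn (R : realType) (n : nat) : measurableType _ :=
  n.-tuple (measurableTypeR R).

Section LebesgueMeasure.
Context {R : realType}.

Definition rn_cons n (x : measurableTypeR R * Rn R n) : Rn R n.+1 :=
  [tuple of x.1 :: x.2].

Definition rn_uncons n (t : Rn R n.+1) : measurableTypeR R * Rn R n :=
  (tnth t ord0, [tuple of behead t]).

Lemma measurable_rn_cons n : measurable_fun [set: _] (@rn_cons n).
Proof. exact: measurable_cons measurable_fst measurable_snd. Qed.

Lemma measurable_rn_uncons n : measurable_fun [set: _] (@rn_uncons n).
Proof.
apply: measurable_fun_pair; [exact: measurable_tnth|exact: measurable_behead].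
Qed.

Lemma rn_consK n : cancel (@rn_cons n) (@rn_uncons n).
Proof.
by case=> a t; rewrite /rn_uncons /rn_cons tnth0; congr pair; exact/val_inj.
Qed.

Section step.
Context n (m : {sigma_finite_measure set (Rn R n) -> \bar R}).

Definition leb_step : set (Rn R n.+1) -> \bar R :=
  pushforward (@lebesgue_measure R \x m)%E (@rn_cons n).

Let leb_step0 : (leb_step set0 = 0)%E.
Proof. by rewrite /leb_step /pushforward preimage_set0 measure0. Qed.

Let leb_step_ge0 A : (0 <= leb_step A)%E.
Proof. by rewrite /leb_step /pushforward measure_ge0. Qed.

Let measurable_preimage_cons (A : set (Rn R n.+1)) :
  measurable A -> measurable (@rn_cons n @^-1` A).
Proof.
by move=> mA; rewrite -[X in measurable X]setTI; exact: measurable_rn_cons.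
Qed.

Let leb_step_sigma_additive : semi_sigma_additive leb_step.
Proof.
move=> F mF tF mUF; rewrite /leb_step /pushforward preimage_bigcup.
apply: measure_semi_sigma_additive.
- by move=> k; exact: measurable_preimage_cons.
- apply/trivIsetP => /= i j _ _ ij; rewrite -preimage_setI.
  by move/trivIsetP : tF => /(_ _ _ _ _ ij) ->//; rewrite preimage_set0.
- by rewrite -preimage_bigcup; exact: measurable_preimage_cons.
Qed.

HB.instance Definition _ := isMeasure.Build _ _ _ leb_step
  leb_step0 leb_step_ge0 leb_step_sigma_additive.

Let leb_step_sigma_finite : sigma_finite setT leb_step.
Proof.
have /sigma_finiteP [F [FT Fnd Ffin]] := sigma_finiteT (@lebesgue_measure R).
have /sigma_finiteP [G [GT Gnd Gfin]] := sigma_finiteT m.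
exists (fun k => @rn_uncons n @^-1` (F k `*` G k)).
  rewrite -preimage_bigcup (_ : \bigcup_k _ = setT) ?preimage_setT//.
  apply/seteqP; split=> // -[x y] _.
  have [i _ Fx] : (\bigcup_i F i) x by rewrite -FT.
  have [j _ Gy] : (\bigcup_j G j) y by rewrite -GT.
  exists (maxn i j) => //; split.
    by move: Fx; exact/subsetPset/Fnd/leq_maxl.
  by move: Gy; exact/subsetPset/Gnd/leq_maxr.
move=> k; have [mF Foo] := Ffin k; have [mG Goo] := Gfin k; split.
  rewrite -[X in measurable X]setTI; apply: measurable_rn_uncons => //.
  exact: measurableX.
rewrite /leb_step /pushforward -comp_preimage.
rewrite (_ : @rn_uncons n \o @rn_cons n = id); last first.
  by apply/funext => x; exact: rn_consK.
by rewrite preimage_id product_measure1E// lte_mul_pinfty// ge0_fin_numE.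
Qed.

HB.instance Definition _ := Measure_isSigmaFinite.Build _ _ _ leb_step
  leb_step_sigma_finite.

End step.

(* n-dimensional Lebesgue measure: R^0 is a point of mass 1, and R^(n+1) carries
   the image of the product of the Lebesgue measures of R and of R^n *)
Fixpoint leb (n : nat) : {sigma_finite_measure set (Rn R n) -> \bar R} :=
  match n with
  | 0 => \d_([tuple] : Rn R 0)
  | n'.+1 => leb_step (leb n')
  end.

Lemma leb_box n (A : 'I_n -> set (measurableTypeR R)) :
  (forall i, measurable (A i)) ->
  leb n [set x : Rn R n | forall i, A i (tnth x i)] =
  (\prod_(i < n) @lebesgue_measure R (A i))%E.
Proof.
elim: n A => [|n IH] A mA.
  by rewrite big_ord0 /= diracE mem_set//= => -[].
rewrite big_ord_recl -IH//= /leb_step /pushforward.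
rewrite -product_measure1E//; last first.
  have -> : [set x : Rn R n | forall i, A (lift ord0 i) (tnth x i)] =
      \bigcap_(i in [set: 'I_n]) ((@tnth n _ ^~ i) @^-1` A (lift ord0 i)).
    apply/seteqP; split=> x /=; first by move=> h i _; exact: h.
    by move=> h i; exact: h.
  apply: fin_bigcap_measurable; first exact: finite_finset.
  move=> i _; rewrite -[X in measurable X]setTI; apply: measurable_tnth => //.
congr (_ _); apply/seteqP; split=> -[a t] /=.
  move=> h; split; first by have := h ord0; rewrite /rn_cons/= tnth0.
  by move=> i; have := h (lift ord0 i); rewrite /rn_cons/= tnthS.
move=> [ha ht] i; rewrite /rn_cons/=.
have [j ->|->] := unliftP ord0 i; last by rewrite tnth0.
by rewrite tnthS; exact: ht.
Qed.

End LebesgueMeasure.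

Section Weights.
Context {R : realType} {n : nat}.
Implicit Types (x : Rn R n) (A : set (Rn R n)) (f g u w : Rn R n -> R).
Implicit Types (c p r s t lam : R).

Definition enorm x : R := Num.sqrt (\sum_(i < n) tnth x i ^+ 2).

Definition eball x r : set (Rn R n) :=
  [set y | Num.sqrt (\sum_(i < n) (tnth x i - tnth y i) ^+ 2) < r].

(* the integral of g over A; for a weight w, this is w(A) *)
Definition mass g A : \bar R := (\int[leb n]_(y in A) (g y)%:E)%E.

Definition average g A : \bar R := (mass g A * ((fine (leb n A))^-1)%:E)%E.

Definition conj_exp (s : R) : R := s / (s - 1).

Lemma conj_expE s : 1 < s -> s^-1 + (conj_exp s)^-1 = 1.
Proof.
move=> s1; have s0 : s != 0 by rewrite gt_eqF// (lt_trans ltr01).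
by rewrite /conj_exp invf_div -[X in X + _]mul1r -mulrDl addrC subrK divff.
Qed.

(* Local integrability on R^n is integrability on every ball. *)
Definition weight w : Prop :=
  [/\ measurable_fun setT w,
      forall x r, 0 < r -> (mass (fun y => `|w y|%R) (eball x r) < +oo)%E &
      {ae leb n, forall y, 0 < w y}].

Definition A1_bound w (c : R) : Prop :=
  forall x r, 0 < r ->
    {ae leb n, forall y,
      eball x r y -> (average w (eball x r) <= (c * w y)%:E)%E}.

(* [w]_{A_p}; for p = 1 the infimum is the smallest admissible constant. *)
Definition Ap_const (p : R) w : \bar R :=
  if p == 1 then ereal_inf [set c%:E | c in A1_bound w]
  else ereal_sup [set z | exists x r, 0 < r /\
    z = (average w (eball x r) *
         average (fun y => (w y `^ (1 - conj_exp p))%R) (eball x r)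
           `^ (p - 1))%E].
Arguments Ap_const p%_R w.

Definition Muckenhoupt (p : R) w : Prop :=
  weight w /\ (if p == 1 then exists c, A1_bound w c
               else (Ap_const p w < +oo)%E).

Definition reverse_Hoelder (s : R) w : Prop :=
  weight w /\ exists c : R, forall x r, 0 < r ->
    (average (fun y => (w y `^ s)%R) (eball x r) `^ s^-1 <=
     c%:E * average w (eball x r))%E.

Definition Lp_norm (p : R) w f : \bar R :=
  (mass (fun y => (`|f y| `^ p * w y)%R) setT `^ p^-1)%E.
Arguments Lp_norm p%_R w f.

Definition in_Lp (p : R) w f : Prop :=
  measurable_fun setT f /\ (Lp_norm p w f < +oo)%E.

Definition weak_L1_norm w f : \bar R :=
  ereal_sup [set z | exists t : R, 0 < t /\
    z = (t%:E * mass w [set y | (t < `|f y|)%R]%classic)%E].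

Definition morrey_norm (p lam : R) u f : \bar R :=
  ereal_sup [set z | exists x r, 0 < r /\
    z = ((((r `^ lam)^-1)%:E *
          mass (fun y => (`|f y| `^ p * u y)%R) (eball x r)) `^ p^-1)%E].

Definition in_morrey (p lam : R) u f : Prop :=
  measurable_fun setT f /\ (morrey_norm p lam u f < +oo)%E.

Definition weak_morrey_norm (p lam : R) u f : \bar R :=
  ereal_sup [set z | exists x r t, [/\ 0 < r, 0 < t &
    z = (((t `^ p / r `^ lam)%:E *
          mass u (eball x r `&` [set y | (t < `|f y|)%R])%classic) `^ p^-1)%E]].

(* powR gives the value 0 at the origin when a < 0; this is a null set *)
Definition abs_power (a : R) : Rn R n -> R := fun x => enorm x `^ a.

Definition power_weight (a : R) w : Rn R n -> R := fun x => abs_power a x * w x.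

Definition union_Lp (p : R) f : Prop :=
  exists2 w, Muckenhoupt p w & in_Lp p w f.

(* T is a total function, but only its values on union_Lp p0 are constrained. *)
Definition acts_on (p0 : R) (T : (Rn R n -> R) -> Rn R n -> R) : Prop :=
  forall f, union_Lp p0 f -> measurable_fun setT (T f).

Definition admissible_const (phi : R -> R) : Prop :=
  (forall s, 1 <= s -> 0 < phi s) /\
  (forall s t, 1 <= s -> s <= t -> phi s <= phi t).

Definition strong_bound (p0 : R) (T : (Rn R n -> R) -> Rn R n -> R) : Prop :=
  exists2 phi : R -> R, admissible_const phi &
    forall w f, Muckenhoupt p0 w -> in_Lp p0 w f ->
      (Lp_norm p0 w (T f) <=
       (phi (fine (Ap_const p0 w)))%:E * Lp_norm p0 w f)%E.

Definition weak_bound (T : (Rn R n -> R) -> Rn R n -> R) : Prop :=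
  exists2 phi : R -> R, admissible_const phi &
    forall w f, Muckenhoupt 1 w -> in_Lp 1 w f ->
      (weak_L1_norm w (T f) <=
       (phi (fine (Ap_const 1 w)))%:E * Lp_norm 1 w f)%E.

End Weights.

Arguments morrey_norm {R n} p%_R lam%_R u f.
Arguments weak_morrey_norm {R n} p%_R lam%_R u f.

(* Main.v *)
Require Import Defs.
From mathcomp Require Import all_boot all_order all_algebra.
From mathcomp Require Import all_classical all_reals all_analysis.
From mathcomp Require Import measurable_realfun.
From mathcomp Require Import ring lra.

Set Implicit Arguments.
Unset Strict Implicit.
Unset Printing Implicit Defensive.

Import Order.TTheory GRing.Theory Num.Theory.
Import numFieldNormedType.Exports.

Local Open Scope classical_set_scope.
Local Open Scope ring_scope.

(** The point is that a Morrey norm is a supremum of norms in genuine weighted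
   [L^p] spaces, with weights that lie in [A_p] uniformly, so that any
   operator bounded on weighted [L^p] spaces with constants controlled by the
   [A_p] constant is bounded on the Morrey space as well.

   Fix a ball [B] of centre [x] and radius [r] and an exponent [a] with
   [lam < a < n / sigma'], and consider
   [W_B y = (|x| + r)^alpha * w y * (1 + |x - y| / r)^(-a)].
   On [B] the weight [|y|^alpha * w y] is at most a constant times [W_B].
   Since [a * sigma' < n], the power [sigma'] of the factor
   [(1 + |x - y| / r)^(-a)] has averages comparable to its infima on balls, and
   the reverse Hoelder inequality transfers this to averages with respect to
   [w]; hence [W_B] is in [A_p] with a constant independent of [B]. Finally
   the [L^p] norm of [f] for [W_B] is at most [r^(lam / p)] times the Morrey
   norm of [f]: dyadic shells around the origin (where [alpha < lam] is used)
   turn the Morrey bound into one for [w] alone, with the extra decay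
   [(|x| + s)^(-alpha)] on a ball of centre [x] and radius [s], and
   dyadic shells around [x] (where [a > lam] is used) sum these bounds. This is
   [localizing_weight], which rests on [mass_mul_bump_le],
   [mass_remove_power] and [mass_bump_weight_le]. For [p = p0 = 1], in the
   strong and in the weak case, it already yields the theorem.

   For other [p] the hypothesis at the exponent [p0] has to be extrapolated to
   [p] ([extrapolation]). The maximal operators [mx v], averages with
   the mass of [v] in the denominator, are of weak type (1,1) for doubling [v]
   by a finite Vitali selection, and of strong type by interpolation
   ([strong_type_mx]). Lerner's pointwise domination of the Hardy-Littlewood
   operator by a composition of two of them gives Muckenhoupt's theorem
   ([muckenhoupt]), and the Rubio de Francia series of iterates
   ([rubio_de_francia]) gives [A_1] majorants with control of norms. For [f] in
   [L^p(w)] and [h] in [L^p'(w)], with [A_1] majorants [v1] of [|f|] and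
   [v2] of [h w], the weight [v1^(1 - p0) * v2] is in [A_p0]; in it both
   [f] and [T f] are controlled by the integral of [v1 * v2], hence by the
   norms of [f] and [h], and duality concludes.

   For the pure powers, [beta] is split as [alpha + g] with [alpha = 0] or
   [0 <= alpha < lam], and with [|x|^g] in [A_p] and [g > lam - n]
   ([split_exponent]); then the argument above applies to [w = |x|^g]. The
   bound on [g] is what allows a [sigma] small enough that [|x|^g] is
   in [RH_sigma] and large enough that [lam < n / sigma']
   ([exists_Hoelder_exponent]). *)

(** * Euclidean balls *)

Section Geometry.
Context {R : realType} {n : nat}.
Implicit Types (x y z : Rn R n) (r s : R).

Definition edist x y : R := Num.sqrt (\sum_(i < n) (tnth x i - tnth y i) ^+ 2).

Lemma edist_ge0 x y : 0 <= edist x y.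
Proof. exact: sqrtr_ge0. Qed.

Lemma edistxx x : edist x x = 0.
Proof.
by rewrite /edist big1 ?sqrtr0// => i _; rewrite subrr expr0n.
Qed.

Lemma edistC x y : edist x y = edist y x.
Proof.
by rewrite /edist; congr Num.sqrt; apply: eq_bigr => i _; rewrite -sqrrN opprB.
Qed.

Lemma cauchy_schwarz (a b : 'I_n -> R) :
  \sum_(i < n) a i * b i <=
  Num.sqrt (\sum_(i < n) a i ^+ 2) * Num.sqrt (\sum_(i < n) b i ^+ 2).
Proof.
have A0 : 0 <= \sum_(i < n) a i ^+ 2 by apply: sumr_ge0 => i _; exact: sqr_ge0.
have B0 : 0 <= \sum_(i < n) b i ^+ 2 by apply: sumr_ge0 => i _; exact: sqr_ge0.
rewrite -sqrtrM//; apply: (le_trans (ler_norm _)); rewrite -sqrtr_sqr ler_sqrt; last first.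
  exact: mulr_ge0.
(* Lagrange's identity: this double sum of squares is twice the difference
   between the two sides of the squared inequality *)
have : 0 <= \sum_(i < n) \sum_(j < n) (a i * b j - a j * b i) ^+ 2.
  by apply: sumr_ge0 => i _; apply: sumr_ge0 => j _; exact: sqr_ge0.
have -> : \sum_(i < n) \sum_(j < n) (a i * b j - a j * b i) ^+ 2 =
   (\sum_(i < n) a i ^+ 2) * (\sum_(j < n) b j ^+ 2)
   + (\sum_(i < n) b i ^+ 2) * (\sum_(j < n) a j ^+ 2)
   - 2 * ((\sum_(i < n) a i * b i) * (\sum_(j < n) a j * b j)).
  rewrite !big_distrl/= mulr_sumr -big_split/= -sumrB; apply: eq_bigr => i _.
  rewrite !mulr_sumr -big_split/= -sumrB; apply: eq_bigr => j _.
  by ring.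
set A := \sum_(i < n) a i ^+ 2; set B := \sum_(i < n) b i ^+ 2.
set S := \sum_(i < n) a i * b i; rewrite expr2; lra.
Qed.

Lemma edist_triangle x y z : edist x z <= edist x y + edist y z.
Proof.
rewrite /edist.
set A := \sum_(i < n) (tnth x i - tnth y i) ^+ 2.
set B := \sum_(i < n) (tnth y i - tnth z i) ^+ 2.
have A0 : 0 <= A by apply: sumr_ge0 => i _; exact: sqr_ge0.
have B0 : 0 <= B by apply: sumr_ge0 => i _; exact: sqr_ge0.
rewrite -(@ler_pXn2r _ 2)// ?nnegrE ?addr_ge0 ?sqrtr_ge0//.
rewrite sqr_sqrtr; last by apply: sumr_ge0 => i _; exact: sqr_ge0.
rewrite sqrrD !sqr_sqrtr//.
have := cauchy_schwarz (fun i => tnth x i - tnth y i) (fun i => tnth y i - tnth z i).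
rewrite -/A -/B => cs.
have -> : \sum_(i < n) (tnth x i - tnth z i) ^+ 2 =
  A + (\sum_(i < n) (tnth x i - tnth y i) * (tnth y i - tnth z i)) *+ 2 + B.
  rewrite /A /B -sumrMnl -!big_split/=; apply: eq_bigr => i _.
  by rewrite -sqrrD; congr (_ ^+ 2); ring.
by rewrite lerD2r lerD2l lerMn2r/= cs.
Qed.

Definition origin : Rn R n := [tuple 0 | i < n].

Lemma enormE x : enorm x = edist x origin.
Proof.
by rewrite /enorm /edist; congr Num.sqrt; apply: eq_bigr => i _; rewrite tnth_mktuple subr0.
Qed.

Lemma eballE x r y : eball x r y = (edist x y < r).
Proof. by []. Qed.

Lemma eball_center x r : 0 < r -> eball x r x.
Proof. by rewrite eballE edistxx. Qed.

Lemma sub_eball x y r s : edist y x + r <= s -> eball x r `<=` eball y s.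
Proof.
move=> h z; rewrite !eballE => xz.
by apply: le_lt_trans (edist_triangle y x z) _; apply: lt_le_trans h; rewrite ltrD2l.
Qed.

Lemma measurable_edist x : measurable_fun setT (edist x).
Proof.
rewrite /edist; apply: (@measurableT_comp _ _ _ _ _ _ (@Num.sqrt R)).
  by apply: continuous_measurable_fun; exact: sqrt_continuous.
apply: measurable_sum => i; apply: measurable_funX.
by apply: measurable_funB => //; exact: measurable_tnth.
Qed.

Lemma measurable_eball x r : measurable (eball x r).
Proof.
rewrite (_ : eball x r = setT `&` edist x @^-1` `]-oo, r[%classic); last first.
  by apply/seteqP; split => y /=; rewrite in_itv/= => // -[].
exact: measurable_edist.
Qed.

Let box x r : set (Rn R n) :=
  [set y | forall i, `](tnth x i - r), (tnth x i + r)[%classic (tnth y i)].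

Let leb_cube x r : 0 < r -> leb n (box x r) = ((2 * r) ^+ n)%:E.
Proof.
move=> r0; rewrite (leb_box (A := fun i => `](tnth x i - r), (tnth x i + r)[%classic)); last first.
  by move=> i; exact: measurable_itv.
under eq_bigr do rewrite lebesgue_measure_itv/= lte_fin ltrD2l gtrN// -EFinB.
rewrite (eq_bigr (fun=> (2 * r)%:E)); last by move=> i _; congr EFin; ring.
by rewrite prodEFin prodr_const card_ord.
Qed.

Let measurable_box x r : measurable (box x r).
Proof.
have -> : box x r = \bigcap_(i in [set: 'I_n])
    ((@tnth n _ ^~ i) @^-1` `](tnth x i - r), (tnth x i + r)[%classic).
  apply/seteqP; split=> y /=; first by move=> h i _; exact: h.
  by move=> h i; exact: h.
apply: fin_bigcap_measurable; first exact: finite_finset.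
by move=> i _; rewrite -[X in measurable X]setTI; apply: measurable_tnth.
Qed.

Lemma coord_le_edist x y i : `|tnth x i - tnth y i| <= edist x y.
Proof.
rewrite -sqrtr_sqr /edist ler_sqrt; last by apply: sumr_ge0 => j _; exact: sqr_ge0.
by rewrite (bigD1 i)//= lerDl; apply: sumr_ge0 => j _; exact: sqr_ge0.
Qed.

Lemma edist_lt x y r : 0 < r -> (0 < n)%N ->
  (forall i, `|tnth x i - tnth y i| < r / n%:R) -> edist x y < r.
Proof.
move=> r0 n0 h; rewrite /edist -[ltRHS]gtr0_norm// -sqrtr_sqr ltr_sqrt ?exprn_gt0//.
have n0' : 0 < n%:R :> R by rewrite ltr0n.
apply: (@lt_le_trans _ _ (\sum_(i < n) (r / n%:R) ^+ 2)).
  apply: ltr_sum; first by apply/hasP; exists (Ordinal n0); rewrite ?mem_index_enum.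
  by move=> i _; rewrite -real_normK ?num_real// ltr_pXn2r ?nnegrE ?divr_ge0// ltW.
rewrite sumr_const card_ord -[leLHS]mulr_natl.
have -> : n%:R * (r / n%:R) ^+ 2 = r ^+ 2 / n%:R by field; rewrite gt_eqF.
by rewrite ler_piMr ?sqr_ge0// invf_le1// ler1n.
Qed.

Lemma leb_eball_le x r : 0 < r -> (leb n (eball x r) <= ((2 * r) ^+ n)%:E)%E.
Proof.
move=> r0; rewrite -(leb_cube x r0); apply: le_measure; rewrite ?inE.
- exact: measurable_eball.
- exact: measurable_box.
move=> y; rewrite eballE => yr i /=; rewrite in_itv/=.
have := le_lt_trans (coord_le_edist x y i) yr.
by rewrite ltr_norml => /andP[h1 h2]; apply/andP; split; lra.
Qed.

Lemma leb_eball_ge x r : (0 < n)%N -> 0 < r ->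
  (((2 * (r / n%:R)) ^+ n)%:E <= leb n (eball x r))%E.
Proof.
move=> n0 r0; have rn : 0 < r / n%:R by rewrite divr_gt0 ?ltr0n.
rewrite -(leb_cube x rn); apply: le_measure; rewrite ?inE.
- exact: measurable_box.
- exact: measurable_eball.
move=> y h; rewrite eballE; apply: edist_lt => // i.
have := h i; rewrite /= in_itv/= => /andP[h1 h2].
by rewrite ltr_norml; apply/andP; split; lra.
Qed.

Definition vol x r : R := fine (leb n (eball x r)).

Lemma vol_fin x r : 0 < r -> leb n (eball x r) = (vol x r)%:E.
Proof.
move=> r0; rewrite fineK// ge0_fin_numE ?measure_ge0//.
by apply: le_lt_trans (leb_eball_le x r0) _; rewrite ltry.
Qed.

Definition vol_lb : R := (2 / n%:R) ^+ n.
Definition vol_ub : R := 2 ^+ n.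

Lemma vol_lb_gt0 : (0 < n)%N -> 0 < vol_lb.
Proof. by move=> n0; rewrite exprn_gt0// divr_gt0// ltr0n. Qed.

Lemma vol_ub_gt0 : 0 < vol_ub.
Proof. by rewrite exprn_gt0. Qed.

Lemma vol_le x r : 0 < r -> vol x r <= vol_ub * r ^+ n.
Proof.
by move=> r0; rewrite -lee_fin -vol_fin// (le_trans (leb_eball_le x r0))// exprMn.
Qed.

Lemma vol_ge x r : (0 < n)%N -> 0 < r -> vol_lb * r ^+ n <= vol x r.
Proof.
move=> n0 r0; rewrite -lee_fin -vol_fin//; apply: le_trans (leb_eball_ge x n0 r0).
by rewrite lee_fin -exprMn mulrAC mulrA.
Qed.

Lemma vol_gt0 x r : (0 < n)%N -> 0 < r -> 0 < vol x r.
Proof.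
by move=> n0 r0; apply: lt_le_trans (vol_ge x n0 r0); rewrite mulr_gt0 ?vol_lb_gt0 ?exprn_gt0.
Qed.

Lemma vol_comparable x y r k : (0 < n)%N -> 0 < r -> 0 < k ->
  vol x (k * r) <= vol_ub / vol_lb * k ^+ n * vol y r.
Proof.
move=> n0 r0 k0; apply: (le_trans (vol_le x (mulr_gt0 k0 r0))).
rewrite exprMn -!mulrA ler_pM2l ?vol_ub_gt0// [leRHS]mulrCA ler_pM2l ?exprn_gt0//.
by rewrite ler_pdivlMl ?vol_lb_gt0// vol_ge.
Qed.

(** ** A countable family of balls *)

Definition rat_tuple (q : n.-tuple rat) : Rn R n := [tuple ratr (tnth q i) | i < n].

Definition qcenter (k : nat) : Rn R n :=
  if @unpickle (n.-tuple rat * rat)%type k is Some (q, _) then rat_tuple q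
  else origin.

Definition qradius (k : nat) : R :=
  if @unpickle (n.-tuple rat * rat)%type k is Some (_, d) then
    (if 0 < d then ratr d else 1)
  else 1.

Definition qball (k : nat) : set (Rn R n) := eball (qcenter k) (qradius k).

Lemma qradius_gt0 k : 0 < qradius k.
Proof.
by rewrite /qradius; case: unpickle => [[q d]|]//; case: ifPn => // d0; rewrite ltr0q.
Qed.

Lemma measurable_qball k : measurable (qball k).
Proof. exact: measurable_eball. Qed.

(** Averages over a countable family are enough for maximal functions, since
   every ball sits in one of its members of comparable size; countability makes
   the maximal functions measurable and reduces coverings to finite ones. The
   factor 3 leaves room for perturbing both the centre and the radius. *)
Lemma qball_cover x r : (0 < n)%N -> 0 < r ->
  exists k, eball x r `<=` qball k /\ qradius k <= 3 * r.
Proof.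
move=> n0 r0; have rn : 0 < r / n%:R by rewrite divr_gt0 ?ltr0n.
have /choice[q qE] : forall i : 'I_n, exists q : rat,
    `|tnth x i - ratr q| < r / n%:R.
  move=> i; have /rat_in_itvoo[q] : tnth x i - r / n%:R < tnth x i + r / n%:R.
    by rewrite ltrD2l gtrN.
  rewrite in_itv/= => /andP[h1 h2]; exists q.
  by rewrite ltr_norml; apply/andP; split; lra.
have /rat_in_itvoo[d] : 2 * r < 3 * r by rewrite ltr_pM2r// ltr_nat.
rewrite in_itv/= => /andP[d2 d3].
have d0 : 0 < d by rewrite -(@ltr0q R); apply: lt_trans d2; rewrite mulr_gt0.
exists (pickle (([tuple q i | i < n] : n.-tuple rat), d)).
rewrite /qball /qradius /qcenter pickleK d0; split; last exact: ltW.
apply: sub_eball; apply: le_trans (ltW d2); rewrite mulr_natl mulr2n lerD2r ltW//.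
by apply: edist_lt => // i; rewrite /rat_tuple !tnth_mktuple distrC.
Qed.

End Geometry.
Arguments origin {R n}.
Arguments vol_lb R n : clear implicits.
Arguments vol_ub R n : clear implicits.

(** * Weights and the maximal operators attached to them *)

Section Integrals.
Context d (T : measurableType d) (R : realType) (mu : {measure set T -> \bar R}).
Local Open Scope ereal_scope.

Lemma le_integral_setU (A B : set T) (f : T -> \bar R) :
  measurable A -> measurable B -> measurable_fun setT f -> (forall x, 0 <= f x) ->
  \int[mu]_(x in A `|` B) f x <= \int[mu]_(x in A) f x + \int[mu]_(x in B) f x.
Proof.
move=> mA mB mf f0; have mBA : measurable (B `\` A) by exact: measurableD.
have -> : A `|` B = A `|` (B `\` A).
  apply/seteqP; split=> x [Ax|Bx]; [by left| |by left|by right; case: Bx].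
  by have [Ax|nAx] := pselect (A x); [left|right; split].
rewrite ge0_integral_setU//.
- by apply: leeD2l; apply: ge0_subset_integral => //; exact: measurable_funTS.
- exact: measurable_funTS.
- by apply/disj_setPS => x [Ax []].
Qed.

Lemma integral_gt0 (A : set T) (f : T -> \bar R) :
  measurable A -> measurable_fun setT f -> (forall x, 0 < f x) -> 0 < mu A ->
  0 < \int[mu]_(x in A) f x.
Proof.
move=> mA mf f0 A0; rewrite lt0e integral_ge0 ?andbT; last by move=> x _; exact: ltW.
apply/eqP => I0; suff muA : mu A = 0 by rewrite muA ltxx in A0.
have I0' : \int[mu]_(x in A) `|f x| = 0.
  by rewrite -I0; apply: eq_integral => x _; rewrite gee0_abs// ltW.
have /(ae_eq_integral_abs mu mA (measurable_funTS mf))[N [mN N0 sub]] := I0'.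
apply: (subset_measure0 mA mN _ N0).
move=> x Ax; apply: sub => /= /(_ Ax) fx0; have := f0 x.
by rewrite fx0 ltxx.
Qed.

End Integrals.

Section Weights.
Context {R : realType} {n : nat}.
Implicit Types (x y z : Rn R n) (r s : R) (u v w : Rn R n -> R).

Definition pos_weight v :=
  [/\ measurable_fun setT v, (forall x, 0 < v x) &
      forall x r, 0 < r -> (mass v (eball x r) < +oo)%E].

Definition bmass v x r : R := fine (mass v (eball x r)).

Lemma mass_ge0 v A : (forall x, 0 <= v x) -> (0 <= mass v A)%E.
Proof. by move=> v0; apply: integral_ge0 => y _; rewrite lee_fin. Qed.

Lemma bmassE v x r : pos_weight v -> 0 < r -> mass v (eball x r) = (bmass v x r)%:E.
Proof.
move=> [mv v0 vfin] r0; rewrite fineK// ge0_fin_numE ?vfin//.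
by apply: mass_ge0 => y; exact: ltW.
Qed.

Lemma bmass_gt0 v x r : (0 < n)%N -> pos_weight v -> 0 < r -> 0 < bmass v x r.
Proof.
move=> n0 pv r0; rewrite -lte_fin -bmassE//; case: pv => mv v0 _.
apply: integral_gt0 => //; first exact: measurable_eball.
- exact/measurable_EFinP.
- have h : (0 < leb n (eball x r))%E by rewrite vol_fin// lte_fin vol_gt0.
  exact: h.
Qed.

Lemma mass1 x r : mass (fun=> 1) (eball x r) = leb n (eball x r).
Proof.
by rewrite /mass integral_cst; [rewrite mul1e|exact: measurable_eball].
Qed.

Lemma pos_weight1 : pos_weight (fun=> 1).
Proof. by split => // x r r0; rewrite mass1 vol_fin// ltry. Qed.

Lemma bmass1 x r : bmass (fun=> 1) x r = vol x r.
Proof. by rewrite /bmass mass1. Qed.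

Definition doubling v (D : R) := forall x r, 0 < r -> bmass v x (3 * r) <= D * bmass v x r.

Lemma exists_argmax (T : eqType) (s : seq T) (g : T -> R) : s != [::] ->
  exists2 b, b \in s & forall k, k \in s -> g k <= g b.
Proof.
elim: s => [//|a s IH] _; have [->|s0] := eqVneq s [::].
  by exists a; rewrite ?mem_head// => k; rewrite inE => /eqP ->.
have [b bs bmax] := IH s0; have [ab|ba] := leP (g a) (g b).
  exists b; first by rewrite inE bs orbT.
  by move=> k; rewrite inE => /predU1P[->//|]; exact: bmax.
exists a; first by rewrite mem_head.
by move=> k; rewrite inE => /predU1P[->//|/bmax kb]; apply: le_trans (ltW ba).
Qed.

Local Open Scope ereal_scope.

(** The Vitali selection run directly on the integrals: a ball of maximal
   radius absorbs, after dilation by 3, every ball that meets it, and the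
   remaining balls are disjoint from it, so that the induction hypothesis for
   them adds up. *)
Lemma vitali_bound v (D t : R) (f : Rn R n -> \bar R) (s : seq nat) :
  pos_weight v -> doubling v D -> (0 <= D)%R -> (0 < t)%R ->
  measurable_fun setT f -> (forall x, 0 <= f x) ->
  (forall k, k \in s -> t%:E * mass v (qball k) <= \int[leb n]_(y in qball k) f y) ->
  t%:E * mass v (\bigcup_(k in [set` s]) qball k) <=
  D%:E * \int[leb n]_(y in \bigcup_(k in [set` s]) qball k) f y.
Proof.
move=> pv dv D0 t0 mf f0; move sn : (size s) => m.
have [mv v0 vfin] := pv.
have mU (s' : seq nat) : measurable (\bigcup_(k in [set` s']) @qball R n k).
  by apply: bigcup_measurable => k _; exact: measurable_qball.
have mEv : measurable_fun setT (EFin \o v) by exact/measurable_EFinP.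
have v0' x : 0 <= (v x)%:E by rewrite lee_fin ltW.
elim: m {-2}m (leqnn m) s sn => [|m IH] m' m'm s sm sP.
  move: m'm sm; rewrite leqn0 => /eqP -> /size0nil ->.
  have -> : \bigcup_(k in [set` [::]]) @qball R n k = set0.
    by apply/seteqP; split => // x [].
  by rewrite /mass !integral_set0 !mule0.
have [s0|s0] := eqVneq s [::].
  apply: (IH 0%N) => //; first by rewrite s0.
have [b bs bmax] := exists_argmax (@qradius R n) s0.
pose s' := [seq k <- s | `[< @qball R n k `&` qball b = set0 >]].
have ss' : (size s' < size s)%N.
  rewrite size_filter -(count_predC (fun k => `[< @qball R n k `&` qball b = set0 >]) s).
  rewrite -[ltnLHS]addn0 ltn_add2l -has_count; apply/hasP; exists b => //=.
  apply/asboolPn => /seteqP[/(_ (qcenter b))+ _]; apply.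
  by split; apply: eball_center; exact: qradius_gt0.
have IH' : t%:E * mass v (\bigcup_(k in [set` s']) qball k) <=
    D%:E * \int[leb n]_(y in \bigcup_(k in [set` s']) qball k) f y.
  apply: (IH (size s')) => //; first by rewrite -ltnS (leq_trans ss')// sm.
  by move=> k; rewrite mem_filter => /andP[_]; exact: sP.
set U' := \bigcup_(k in [set` s']) qball k in IH' *.
set U := \bigcup_(k in [set` s]) qball k.
pose B3 := @eball R n (qcenter b) (3 * @qradius R n b).
have rb := @qradius_gt0 R n b.
have UU : U `<=` B3 `|` U'.
  move=> x [k /= ks kx].
  have [kb0|kb] := pselect (@qball R n k `&` qball b = set0).
    by right; exists k => //=; rewrite mem_filter ks andbT; exact/asboolP.
  left; have /set0P[z [kz bz]] : @qball R n k `&` qball b != set0 by exact/eqP.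
  have := bmax _ ks; move: kx kz bz; rewrite /B3 /qball !eballE => kx kz bz rkb.
  have := edist_triangle (qcenter b) z x.
  have := edist_triangle z (qcenter k) x.
  rewrite (edistC z (qcenter k)) => h1 h2; lra.
have dis : [disjoint qball b & U'].
  apply/disj_setPS => x [bx [k /=]]; rewrite mem_filter => /andP[/asboolP k0 _] kx.
  have : (@qball R n k `&` qball b) x by split.
  by rewrite k0.
have mB3 : measurable B3 by exact: measurable_eball.
have r3 : (0 < 3 * @qradius R n b)%R by rewrite mulr_gt0.
have B3le : t%:E * mass v B3 <= D%:E * \int[leb n]_(y in qball b) f y.
  apply: (@le_trans _ _ (D%:E * (t%:E * mass v (qball b)))).
    rewrite /B3 /qball !bmassE// -!EFinM lee_fin mulrCA ler_pM2l//; exact: dv.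
  by apply: lee_wpmul2l; [rewrite lee_fin|exact: sP].
apply: (@le_trans _ _ (t%:E * (mass v B3 + mass v U'))).
  apply: lee_wpmul2l; first by rewrite lee_fin ltW.
  apply: le_trans (le_integral_setU _ mB3 (mU s') mEv v0').
  apply: ge0_subset_integral => //; first exact: (mU s).
    by apply: measurableU => //; exact: (mU s').
  exact: measurable_funTS.
rewrite ge0_muleDr ?mass_ge0//; [|by move=> x; exact: ltW..].
apply: (@le_trans _ _ (D%:E * \int[leb n]_(y in qball b `|` U') f y)).
  rewrite ge0_integral_setU//; first last.
  - exact: measurable_funTS.
  - exact: mU.
  - exact: measurable_qball.
  by rewrite [leRHS]ge0_muleDr ?integral_ge0//; exact: leeD.
apply: lee_wpmul2l; first by rewrite lee_fin.
apply: ge0_subset_integral => //.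
- by apply: measurableU; [exact: measurable_qball|exact: (mU s')].
- exact: (mU s).
- exact: measurable_funTS.
by move=> x [bx|[k /=]]; [exists b|rewrite mem_filter => /andP[_ ks] kx; exists k].
Qed.

Definition qmass v k : R := bmass v (qcenter k) (@qradius R n k).

Lemma qmassE v k : pos_weight v -> mass v (qball k) = (qmass v k)%:E.
Proof. by move=> pv; apply: bmassE => //; exact: qradius_gt0. Qed.

Lemma qmass_gt0 v k : (0 < n)%N -> pos_weight v -> (0 < qmass v k)%R.
Proof. by move=> n0 pv; apply: bmass_gt0 => //; exact: qradius_gt0. Qed.

(** The numerators are plain integrals: for [f = g v] these are the averages
   of [g] with respect to [v], and for [v = 1] this is the Hardy-Littlewood
   operator. *)
Definition mx v (f : Rn R n -> \bar R) x : \bar R :=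
  ereal_sup (range (fun k =>
    ((qmass v k)^-1)%:E * \int[leb n]_(y in qball k) f y *
    (\1_(qball k) x)%:E)).

Lemma mx_ge v f k x : qball k x ->
  ((qmass v k)^-1)%:E * \int[leb n]_(y in qball k) f y <= mx v f x.
Proof.
move=> kx; apply: ereal_sup_ubound; exists k => //.
by rewrite indicE mem_set// mule1.
Qed.

Lemma mx_le v f x (a : \bar R) : 0 <= a ->
  (forall k, qball k x ->
    ((qmass v k)^-1)%:E * \int[leb n]_(y in qball k) f y <= a) ->
  mx v f x <= a.
Proof.
move=> a0 h; apply: ge_ereal_sup => _ [k _ <-].
have [kx|kx] := pselect (qball k x).
  by rewrite indicE mem_set// mule1; exact: h.
by rewrite indicE memNset// mule0.
Qed.

Lemma mx_ge0 v f x : (forall y, 0 <= v y)%R -> (forall y, 0 <= f y) -> 0 <= mx v f x.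
Proof.
move=> v0 f0; apply: le_trans (ereal_sup_ubound _) => /=; last by exists 0%N.
rewrite !mule_ge0// ?integral_ge0// lee_fin ?invr_ge0//.
by apply: fine_ge0; exact: mass_ge0.
Qed.

Lemma measurable_mx v f : measurable_fun setT (mx v f).
Proof.
rewrite (_ : mx v f = fun x => esups (fun k => ((qmass v k)^-1)%:E *
   \int[leb n]_(y in qball k) f y * (\1_(qball k) x)%:E) 0%N); last first.
  apply/funext => x; rewrite /mx /esups; congr ereal_sup.
  by apply/seteqP; split => _ [k _ <-]; exists k.
apply: measurable_fun_esups => k.
apply: measurable_funeM; apply/measurable_EFinP.
exact: measurable_indic (measurable_qball k).
Qed.

(** The superlevel set is the increasing limit of the unions of those among the
   first [N] balls whose averages exceed [t], to which [vitali_bound] applies. *)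
Lemma weak_type_mx v (D t : R) (f : Rn R n -> \bar R) : (0 < n)%N ->
  pos_weight v -> doubling v D -> (0 <= D)%R -> (0 < t)%R ->
  measurable_fun setT f -> (forall x, 0 <= f x) ->
  t%:E * mass v [set x | t%:E < mx v f x]%classic <= D%:E * \int[leb n]_y f y.
Proof.
move=> n0 pv dv D0 t0 mf f0; have [mv v0 _] := pv.
pose sel k := t%:E * mass v (qball k) <= \int[leb n]_(y in qball k) f y.
pose E N := \bigcup_(k in [set` [seq k <- iota 0 N | sel k]]) @qball R n k.
have mE N : measurable (E N).
  by apply: bigcup_measurable => k _; exact: measurable_qball.
have ndE : nondecreasing_seq E.
  move=> N M NM; apply/subsetPset => x [k /=]; rewrite mem_filter mem_iota/= add0n.
  move=> /andP[sk kN] kx; exists k => //=; rewrite mem_filter sk mem_iota/= add0n.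
  exact: leq_trans kN NM.
have sub : [set x | t%:E < mx v f x]%classic `<=` \bigcup_N E N.
  move=> x /= /ereal_sup_gt[_ [k _ <-]] h.
  have [kx|kx] := pselect (qball k x); last first.
    by move: h; rewrite indicE memNset// mule0 lte_fin ltNge (ltW t0).
  have ks : k \in [seq k <- iota 0 k.+1 | sel k].
    rewrite mem_filter mem_iota add0n ltnSn !andbT.
    move: h; rewrite indicE mem_set// mule1.
    rewrite /sel qmassE// => /ltW h.
    by rewrite muleC -lee_pdivlMl// qmass_gt0.
  by exists k.+1 => //; exists k.
have mEv : measurable_fun setT (EFin \o v) by exact/measurable_EFinP.
have v0' x : 0 <= (v x)%:E by rewrite lee_fin ltW.
have mset : measurable [set x | t%:E < mx v f x]%classic.
  by rewrite -[X in measurable X]setTI; apply: emeasurable_fun_o_infty => //; exact: measurable_mx.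
have mUE : measurable (\bigcup_N E N) by exact: bigcup_measurable.
apply: (@le_trans _ _ (t%:E * mass v (\bigcup_N E N))).
  apply: lee_wpmul2l; first by rewrite lee_fin ltW.
  by apply: ge0_subset_integral => //; exact: measurable_funTS.
have cv := @ge0_nondecreasing_set_cvg_integral _ _ _ E (EFin \o v) (leb n) ndE mE
  (fun i => measurable_funTS mEv) (fun i x _ => v0' x).
rewrite muleC -lee_pdivlMr//.
rewrite /mass -(cvg_lim _ cv)//; apply: lime_le; first exact: cvgP cv.
apply: nearW => N; rewrite lee_pdivlMr// muleC.
apply: (le_trans (@vitali_bound v D t f _ pv dv D0 t0 mf f0 _)).
  by move=> k; rewrite mem_filter => /andP[].
apply: lee_wpmul2l; first by rewrite lee_fin.
by apply: ge0_subset_integral => //; exact: (mE N).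
Qed.

End Weights.

(** * Strong-type bounds for the weighted maximal operators *)

Section LayerCake.
Context {R : realType}.
Implicit Types (a b q s M : R) (y : \bar R).

Lemma sum_dyadic_powers_below a s b m : 0 < a -> 0 < s -> 0 <= b ->
  \sum_(j < m) (s * 2 ^+ j) `^ a * (s * 2 ^+ j < b)%R%:R <=
  2 `^ a / (2 `^ a - 1) * b `^ a.
Proof.
move=> a0 s0 b0.
have th1 : 1 < 2 `^ a.
  have : 1 `^ a < 2 `^ a by apply: gt0_ltr_powR; rewrite ?nnegrE// ltr1n.
  by rewrite powR1.
have th10 : 0 < 2 `^ a - 1 by rewrite subr_gt0.
have pos j : 0 < s * 2 ^+ j by rewrite mulr_gt0// exprn_gt0.
have full k : \sum_(j < k) (s * 2 ^+ j) `^ a <= (s * 2 ^+ k) `^ a / (2 `^ a - 1).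
  elim: k => [|k IH]; first by rewrite big_ord0 divr_ge0 ?powR_ge0// ltW.
  rewrite big_ord_recr/=; apply: (le_trans (lerD IH (lexx _))).
  rewrite exprS mulrCA [X in _ <= X / _]powRM//; last exact: ltW.
  by rewrite le_eqVlt; apply/orP; left; apply/eqP; field; rewrite gt_eqF.
elim: m => [|m IH].
  by rewrite big_ord0 mulr_ge0 ?powR_ge0// divr_ge0 ?powR_ge0// ltW.
rewrite big_ord_recr/=; case: ltP => [mb|_]; last by rewrite mulr0 addr0.
apply: (@le_trans _ _ (\sum_(j < m.+1) (s * 2 ^+ j) `^ a)).
  rewrite big_ord_recr/= mulr1 lerD2r; apply: ler_sum => j _.
  by rewrite ler_piMr ?powR_ge0// lern1; case: (_ < _).
apply: (le_trans (full _)); rewrite exprS mulrCA [X in X / _ <= _]powRM//; last exact: ltW.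
rewrite mulrAC ler_wpM2l ?divr_ge0 ?powR_ge0 ?(ltW th10)//.
by apply: ge0_ler_powR; rewrite ?nnegrE ?(ltW a0) ?(ltW (pos m)) ?(ltW mb).
Qed.

Lemma dyadic_bracket s b m : s < b -> b <= s * 2 ^+ m ->
  exists2 j, (j < m)%N & s * 2 ^+ j < b <= s * 2 ^+ j.+1.
Proof.
move=> sb; elim: m => [|m IH] bm.
  by move: bm; rewrite expr0 mulr1 leNgt sb.
have [/IH[j jm jb]|mb] := leP b (s * 2 ^+ m).
  by exists j => //; exact: leqW.
by exists m => //; rewrite mb.
Qed.

Local Open Scope ereal_scope.

(** A discrete layer cake with [2 N] dyadic levels around 1: the factor 2 in the
   coefficients makes it at least [y^q] as soon as [2^-N < y <= 2^N], and it is
   a combination of indicators of superlevel sets of [y]. *)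
Definition dyadic_layers q (N : nat) y : \bar R :=
  \sum_(j < N + N) ((2 * ((2 ^+ N)^-1 * 2 ^+ j)) `^ q)%:E *
     (if ((2 ^+ N)^-1 * 2 ^+ j)%:E < y then 1 else 0).

Lemma dyadic_layers_ge0 q N y : 0 <= dyadic_layers q N y.
Proof.
apply: sume_ge0 => j _; rewrite mule_ge0 ?lee_fin ?powR_ge0//.
by case: ifP.
Qed.

Lemma le_dyadic_layers q N y y' : y <= y' -> dyadic_layers q N y <= dyadic_layers q N y'.
Proof.
move=> yy'; apply: lee_sum => j _; apply: lee_wpmul2l; first by rewrite lee_fin powR_ge0.
by case: ifPn => [/lt_le_trans->//|_]; case: ifP.
Qed.

Lemma powR_le_dyadic_layers q (b : R) : (0 < q)%R -> (0 <= b)%R ->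
  \forall N \near \oo, (b `^ q)%:E <= dyadic_layers q N b%:E.
Proof.
move=> q0; rewrite le_eqVlt => /predU1P[<-|b0].
  by apply: nearW => N; rewrite powR0 ?gt_eqF// dyadic_layers_ge0.
near=> N.
have bN (c : R) : (c <= N%:R -> c <= 2 ^+ N)%R.
  by move=> /le_trans; apply; rewrite -natrX ler_nat ltnW// ltn_expl.
have h1 : (b <= 2 ^+ N)%R.
  by apply: bN; near: N; exact: nbhs_infty_ger.
have h2 : (b^-1 + 1 <= 2 ^+ N)%R.
  by apply: bN; near: N; exact: nbhs_infty_ger.
have pN : (0 < 2 ^+ N :> R)%R by rewrite exprn_gt0.
have sb : ((2 ^+ N)^-1 < b)%R.
  by rewrite invf_plt ?posrE// (lt_le_trans _ h2)// ltrDl.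
have bs : (b <= (2 ^+ N)^-1 * 2 ^+ (N + N))%R.
  by rewrite exprD mulrA mulVf ?gt_eqF// mul1r.
have [j jN /andP[jb bj]] := dyadic_bracket sb bs.
rewrite /dyadic_layers (bigD1 (Ordinal jN))//= lte_fin jb mule1.
apply: (@le_trans _ _ ((2 * ((2 ^+ N)^-1 * 2 ^+ j)) `^ q)%:E).
  rewrite lee_fin; apply: ge0_ler_powR; rewrite ?nnegrE ?(ltW q0) ?(ltW b0)//.
  by rewrite mulrCA -exprS.
apply: leeDl; apply: sume_ge0 => i _; rewrite mule_ge0 ?lee_fin ?powR_ge0//.
by case: ifP.
Unshelve. all: by end_near. Qed.

Lemma near_le_limn_einf (u : nat -> \bar R) (l : \bar R) :
  (\forall N \near \oo, l <= u N) -> l <= limn_einf u.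
Proof.
move=> [N _ h]; rewrite limn_einf_lim.
rewrite (cvg_lim _ (@cvg_einfs_sup _ u))//.
apply: (@le_trans _ _ (einfs u N)); last by apply: ereal_sup_ubound; exists N.
apply: le_ereal_inf_tmp => _ [k /= Nk <-]; exact: h.
Qed.

Lemma poweR_le_limn_einf q y (c : R) : (1 < q)%R -> 0 <= y -> (0 < c)%R ->
  y `^ q * c%:E <= limn_einf (fun N => dyadic_layers q N y * c%:E).
Proof.
move=> q1 y0 c0; have q0 : (0 < q)%R by apply: lt_trans q1.
case: y y0 => [b|_|//].
  rewrite lee_fin => b0; apply: near_le_limn_einf.
  have := powR_le_dyadic_layers q0 b0; apply: filterS => N h.
  by apply: lee_wpmul2r; first by rewrite lee_fin ltW.
apply: (@le_trans _ _ +oo); first exact: leey.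
rewrite leye_eq; apply/eqP/eqyP => A A0; apply: near_le_limn_einf.
pose b := (1 + A / c)%R.
have b1 : (1 <= b)%R by rewrite lerDl divr_ge0// ltW.
have := powR_le_dyadic_layers q0 (le_trans ler01 b1); apply: filterS => N h.
apply: (@le_trans _ _ ((b `^ q)%:E * c%:E)).
  rewrite -EFinM lee_fin -ler_pdivrMr//.
  apply: (@le_trans _ _ b); first by rewrite lerDr.
  by apply: le1r_powR => //; exact: ltW.
apply: lee_wpmul2r; first by rewrite lee_fin ltW.
by apply: (le_trans h); apply: le_dyadic_layers; exact: leey.
Qed.

End LayerCake.

Section StrongType.
Context {R : realType} {n : nat}.
Implicit Types (x : Rn R n) (v : Rn R n -> R) (f g : Rn R n -> \bar R).
Local Open Scope ereal_scope.

Lemma mass_mkcond v (A : set (Rn R n)) :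
  mass v A = \int[leb n]_x ((v x)%:E * (\1_A x)%:E).
Proof.
rewrite /mass integral_mkcond; apply: eq_integral => x _.
rewrite patchE indicE; case: ifPn; rewrite ?mule1 ?mule0//.
Qed.

(** Truncating [f] at height [t v] changes each average, hence the maximal
   function, by at most [t]. *)
Lemma mx_truncation v f (t : R) x : (0 < n)%N -> pos_weight v -> (0 <= t)%R ->
  measurable_fun setT f -> (forall y, 0 <= f y) ->
  mx v f x <= t%:E + mx v (fun y => if (t * v y)%:E < f y then f y else 0) x.
Proof.
move=> n0 pv t0 mf f0; have [mv v0 _] := pv.
set g := fun y => _.
have g0 y : 0 <= g y by rewrite /g; case: ifP.
have mg : measurable_fun setT g.
  apply: measurable_fun_ifT => //; apply: measurable_fun_lte => //.
  by apply/measurable_EFinP; exact: measurable_funM.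
apply: mx_le => [|k kx].
  by rewrite adde_ge0 ?lee_fin// mx_ge0// => y; exact: ltW.
have qk := qmass_gt0 k n0 pv.
have mk := @measurable_qball R n k.
have mtv : measurable_fun setT (fun y => t%:E * (v y)%:E).
  by apply: measurable_funeM; exact/measurable_EFinP.
apply: (@le_trans _ _ (((qmass v k)^-1)%:E *
    \int[leb n]_(y in qball k) (t%:E * (v y)%:E + g y))).
  apply: lee_wpmul2l; first by rewrite lee_fin invr_ge0 ltW.
  apply: ge0_le_integral => //.
  - exact: measurable_funTS.
  - by apply: measurable_funTS; exact: emeasurable_funD.
  move=> y _; rewrite /g; case: ifPn => [_|].
    by rewrite leeDr// -EFinM lee_fin mulr_ge0// ltW.
  by rewrite -leNgt -EFinM adde0.
rewrite ge0_integralD//; first last.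
- exact: measurable_funTS.
- exact: measurable_funTS.
- by move=> y _; rewrite -EFinM lee_fin mulr_ge0// ltW.
rewrite ge0_integralZl_EFin//; first last.
- exact/measurable_funTS/measurable_EFinP.
- by move=> y _; rewrite lee_fin ltW.
rewrite -/(mass v (qball k)) qmassE// ge0_muleDr ?integral_ge0//; last first.
  by rewrite -EFinM lee_fin mulr_ge0// ltW.
apply: leeD; last exact: mx_ge.
by rewrite -!EFinM lee_fin mulrCA mulVf ?mulr1// gt_eqF.
Qed.

Definition strong_const (D q : R) : R :=
  D * (2 * 2 `^ q) * (2 `^ (q - 1) / (2 `^ (q - 1) - 1) * 2 `^ (q - 1)).

Lemma strong_const_gt0 (D q : R) : (0 < D)%R -> (1 < q)%R -> (0 < strong_const D q)%R.
Proof.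
move=> D0 q1; have q10 : (0 < q - 1)%R by rewrite subr_gt0.
have : (1 `^ (q - 1) < 2 `^ (q - 1) :> R)%R.
  by apply: gt0_ltr_powR; rewrite ?nnegrE// ltr1n.
by rewrite powR1 => h; rewrite !mulr_gt0 ?powR_gt0// invr_gt0 subr_gt0.
Qed.

(** Marcinkiewicz interpolation between the weak type (1,1) and the trivial
   bound at infinity. In terms of [g = f / v] the right-hand side is the
   integral of [g^q v]. *)
Lemma strong_type_mx v (D q : R) f : (0 < n)%N ->
  pos_weight v -> doubling v D -> (0 < D)%R -> (1 < q)%R ->
  measurable_fun setT f -> (forall x, 0 <= f x) ->
  \int[leb n]_x (mx v f x `^ q * (v x)%:E) <=
  (strong_const D q)%:E *
  \int[leb n]_x (f x `^ q * (v x `^ (1 - q))%:E).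
Proof.
move=> n0 pv dv Dgt0 q1 mf f0; have D0 := ltW Dgt0; have [mv v0 _] := pv.
have q0 : (0 < q)%R by apply: lt_trans q1.
have q10 : (0 < q - 1)%R by rewrite subr_gt0.
have mEv : measurable_fun setT (EFin \o v) by exact/measurable_EFinP.
have m0 x : 0 <= mx v f x by apply: mx_ge0 => // y; exact: ltW.
have mm : measurable_fun setT (mx v f) by exact: measurable_mx.
pose lev N j : R := ((2 ^+ N)^-1 * 2 ^+ j)%R.
have lev0 N j : (0 < lev N j)%R by rewrite mulr_gt0 ?invr_gt0 ?exprn_gt0.
pose ind N j x : \bar R := if (lev N j)%:E < mx v f x then 1 else 0.
have mind N j : measurable_fun setT (ind N j).
  by apply: measurable_fun_ifT => //; apply: measurable_fun_lte.
have ind0 N j x : 0 <= ind N j x by rewrite /ind; case: ifP.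
have mlay N : measurable_fun setT (fun x => dyadic_layers q N (mx v f x) * (v x)%:E).
  apply: emeasurable_funM => //; apply: emeasurable_sum => j.
  by apply: measurable_funeM; exact: mind.
apply: (@le_trans _ _ (\int[leb n]_x
    limn_einf (fun N => dyadic_layers q N (mx v f x) * (v x)%:E))).
  apply: ge0_le_integral => //.
  - by move=> x _; rewrite mule_ge0 ?poweR_ge0// lee_fin ltW.
  - apply: emeasurable_funM => //.
    exact: (measurableT_comp (measurable_poweR q)).
  - rewrite /limn_einf; apply: (measurableT_comp (@oppe_measurable _ _)).
    by apply: measurable_fun_limn_esup => N; exact: (measurableT_comp (@oppe_measurable _ _)).
  - by move=> x _; apply: poweR_le_limn_einf.
apply: (le_trans (fatou (leb n) measurableT mlay _)).
  by move=> N x _; rewrite mule_ge0 ?dyadic_layers_ge0// lee_fin ltW.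
rewrite limn_einf_lim; apply: lime_le; first exact: is_cvg_einfs.
apply: nearW => N; apply: (@le_trans _ _ (\int[leb n]_x (dyadic_layers q N (mx v f x) * (v x)%:E))).
  by apply: ereal_inf_lbound; exists N => /=.
pose g j := fun y => if (lev N j / 2 * v y)%:E < f y then f y else 0.
have g0 j y : 0 <= g j y by rewrite /g; case: ifP.
have mg j : measurable_fun setT (g j).
  apply: measurable_fun_ifT => //; apply: measurable_fun_lte => //.
  by apply/measurable_EFinP; exact: measurable_funM.
pose A := (D * (2 * 2 `^ q))%R.
have Agt0 : (0 < A)%R by rewrite !mulr_gt0 ?powR_gt0.
have A0 := ltW Agt0.
have level j : ((2 * lev N j) `^ q)%:E * \int[leb n]_x (ind N j x * (v x)%:E) <=
    \int[leb n]_x ((A * lev N j `^ (q - 1))%:E * g j x).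
  rewrite ge0_integralZl_EFin//; last by rewrite mulr_ge0 ?powR_ge0.
  have l0 := lev0 N j.
  have l20 : (0 < lev N j / 2)%R by rewrite divr_gt0.
  have -> : \int[leb n]_x (ind N j x * (v x)%:E) =
      mass v [set x | (lev N j)%:E < mx v f x]%classic.
    rewrite mass_mkcond; apply: eq_integral => x _; rewrite /ind indicE.
    case: ifPn => h; first by rewrite mem_set// mule1 mul1e.
    by rewrite memNset ?mule0 ?mul0e//; exact/negP.
  have -> : (A * lev N j `^ (q - 1))%:E =
      ((2 * lev N j) `^ q)%:E * ((lev N j / 2)^-1%:E * D%:E).
    rewrite -!EFinM; congr EFin; rewrite /A powRM//; last exact: ltW.
    rewrite -(mulr_powRB1 (ltW l0) q0) invf_div; field.
    by rewrite gt_eqF.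
  rewrite -muleA; apply: lee_wpmul2l; first by rewrite lee_fin powR_ge0.
  rewrite -muleA lee_pdivlMl//.
  apply: le_trans (weak_type_mx n0 pv dv D0 l20 (mg j) (g0 j)).
  apply: lee_wpmul2l; first by rewrite lee_fin ltW.
  apply: ge0_subset_integral => //.
  - by rewrite -[X in measurable X]setTI; apply: emeasurable_fun_o_infty.
  - rewrite -[X in measurable X]setTI; apply: emeasurable_fun_o_infty => //.
    exact: measurable_mx.
  - exact: measurable_funTS.
  - by move=> x _; rewrite lee_fin ltW.
  move=> x /= h; have := mx_truncation x n0 pv (ltW l20) mf f0.
  move=> /(lt_le_trans h); rewrite -/(g j).
  have {1}-> : lev N j = (lev N j / 2 + lev N j / 2)%R by field.
  by rewrite EFinD lteD2lE.
rewrite (eq_integral (fun x => \sum_(j < N + N)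
    (((2 * lev N j) `^ q)%:E * (ind N j x * (v x)%:E)))); last first.
  move=> x _; rewrite /dyadic_layers ge0_sume_distrl.
    by apply: eq_bigr => j _; rewrite muleA.
  move=> j _; rewrite mule_ge0 ?lee_fin ?powR_ge0//; exact: (ind0 N j x).
have mindv j : measurable_fun setT (fun x => ind N j x * (v x)%:E).
  exact: emeasurable_funM.
have indv0 j x : 0 <= ind N j x * (v x)%:E by rewrite mule_ge0// lee_fin ltW.
rewrite ge0_integral_sum//; first last.
- by move=> j x _; rewrite mule_ge0// lee_fin powR_ge0.
- by move=> j; exact: measurable_funeM.
apply: (@le_trans _ _ (\sum_(j < N + N)
    \int[leb n]_x ((A * lev N j `^ (q - 1))%:E * g j x))).
  apply: lee_sum => j _; rewrite ge0_integralZl_EFin ?powR_ge0//; exact: level.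
have Ag0 j x : 0 <= (A * lev N j `^ (q - 1))%:E * g j x.
  by rewrite mule_ge0// lee_fin mulr_ge0 ?powR_ge0.
have mAg j : measurable_fun setT (fun x => (A * lev N j `^ (q - 1))%:E * g j x).
  exact: measurable_funeM.
rewrite -(@ge0_integral_sum _ _ _ (leb n) setT measurableT _
  (fun j x => (A * lev N (nat_of_ord j) `^ (q - 1))%:E * g j x))//.
have mfv : measurable_fun setT (fun x => f x `^ q * (v x `^ (1 - q))%:E).
  apply: emeasurable_funM; first exact: (measurableT_comp (measurable_poweR q)).
  by apply/measurable_EFinP; exact: (measurableT_comp (measurable_powR _)).
have fv0 x : 0 <= f x `^ q * (v x `^ (1 - q))%:E.
  by rewrite mule_ge0 ?poweR_ge0// lee_fin powR_ge0.
pose K : R := (2 `^ (q - 1) / (2 `^ (q - 1) - 1))%R.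
have K0 : (0 < K)%R.
  have : (1 `^ (q - 1) < 2 `^ (q - 1) :> R)%R.
    by apply: gt0_ltr_powR; rewrite ?nnegrE// ltr1n.
  by rewrite powR1 => h; rewrite divr_gt0 ?powR_gt0// subr_gt0.
have C0 : (0 < K * 2 `^ (q - 1))%R by rewrite mulr_gt0 ?powR_gt0.
rewrite /strong_const -/K -/A.
rewrite -ge0_integralZl_EFin//; last by rewrite mulr_ge0// ltW.
apply: ge0_le_integral => //.
- by move=> x _; apply: sume_ge0 => j _; exact: Ag0.
- by apply: emeasurable_sum => j; exact: mAg.
- exact: measurable_funeM.
move=> x _.
have := f0 x; rewrite le_eqVlt => /predU1P[fx0|fx0].
  rewrite big1 => [|j _]; first by rewrite mule_ge0// lee_fin mulr_ge0// ltW.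
  by rewrite /g -fx0; case: ifP; rewrite mule0.
case fxE : (f x) fx0 => [a||//]; last first.
  move=> _; rewrite poweRyr ?gt_eqF// gt0_mulye ?lte_fin ?powR_gt0//.
  by rewrite gt0_muley ?leey// lte_fin mulr_gt0.
rewrite lte_fin => a0; have vx := v0 x.
pose b := (2 * a / v x)%R.
have b0 : (0 <= b)%R by rewrite divr_ge0 ?mulr_ge0// ltW.
rewrite (eq_bigr (fun j : 'I_(N + N) =>
    (A * a * (lev N j `^ (q - 1) * (lev N j < b)%R%:R))%:E)); last first.
  move=> j _; rewrite /g fxE lte_fin.
  have -> : (lev N j / 2 * v x < a)%R = (lev N j < b)%R.
    by rewrite /b ltr_pdivlMr// mulrAC ltr_pdivrMr// (mulrC a).
  case: ifP => _; last by rewrite mulr0 mulr0 mule0.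
  by rewrite -EFinM mulr1; congr EFin; ring.
rewrite sumEFin -mulr_sumr poweR_EFin -!EFinM lee_fin.
have pN : (0 < (2 ^+ N)^-1 :> R)%R by rewrite invr_gt0 exprn_gt0.
have := sum_dyadic_powers_below (N + N) q10 pN b0; rewrite -/K => h.
apply: (@le_trans _ _ (A * a * (K * b `^ (q - 1)))%R).
  by rewrite ler_pM2l// mulr_gt0.
rewrite le_eqVlt; apply/orP; left; apply/eqP.
have -> : (b `^ (q - 1) = 2 `^ (q - 1) * (a `^ (q - 1) * v x `^ (1 - q)))%R.
  have vi : (v x `^ (1 - q) = (v x)^-1 `^ (q - 1))%R.
    by rewrite -powR_inv1 ?(ltW vx)// -powRrM mulN1r opprB.
  rewrite vi -powRM ?invr_ge0 ?(ltW a0) ?(ltW vx)//.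
  by rewrite -powRM ?divr_ge0 ?(ltW a0) ?(ltW vx)// /b mulrA.
rewrite -(mulr_powRB1 (ltW a0) q0).
ring.
Qed.

End StrongType.

(** * Muckenhoupt weights and the maximal theorem *)

Section Hoelder.
Context d (T : measurableType d) (R : realType) (mu : {measure set T -> \bar R}).
Local Open Scope ereal_scope.

Lemma hoelder_on (A : set T) (f g : T -> R) (p q : R) :
  measurable A -> measurable_fun setT f -> measurable_fun setT g ->
  (forall x, 0 <= f x)%R -> (forall x, 0 <= g x)%R ->
  (0 < p)%R -> (0 < q)%R -> (p^-1 + q^-1 = 1)%R ->
  \int[mu]_(x in A) (f x * g x)%:E <=
  (\int[mu]_(x in A) (f x `^ p)%:E) `^ p^-1 *
  (\int[mu]_(x in A) (g x `^ q)%:E) `^ q^-1.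
Proof.
move=> mA mf mg f0 g0 p0 q0 pq.
have mrest (h : T -> R) : measurable_fun setT h -> measurable_fun setT (h \_ A).
  by move=> mh; apply/(measurable_restrictT _ mA); exact: measurable_funTS.
have := hoelder mu (mrest _ mf) (mrest _ mg) p0 q0 pq.
rewrite Lnorm1 unlock.
have key (h : T -> R) (s : R) : (0 < s)%R -> (forall x, 0 <= h x)%R ->
    \int[mu]_x (`|(EFin \o h \_ A) x| `^ s) = \int[mu]_(x in A) (h x `^ s)%:E.
  move=> s0 h0; rewrite [RHS]integral_mkcond; apply: eq_integral => x _.
  rewrite /= !patchE; case: ifPn => _; first by rewrite ger0_norm.
  by rewrite normr0 powR0 // gt_eqF.
rewrite !key//; apply: le_trans; rewrite integral_mkcond.
rewrite le_eqVlt; apply/orP; left; apply/eqP; apply: eq_integral => x _.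
rewrite /= !patchE; case: ifPn => _; last by rewrite mul0r normr0.
by rewrite ger0_norm// mulr_ge0.
Qed.

End Hoelder.

Lemma powR_invl {R : realType} (a b : R) : 0 <= a -> a^-1 `^ b = (a `^ b)^-1.
Proof. by move=> a0; rewrite -powRN -powR_inv1// -powRrM mulN1r. Qed.

Section ConjugateExponents.
Context {R : realType}.
Implicit Types p : R.

Lemma conj_exp_gt1 p : 1 < p -> 1 < conj_exp p.
Proof.
by move=> p1; rewrite /conj_exp ltr_pdivlMr ?subr_gt0// mul1r gtrBl.
Qed.

Lemma conj_expB1 p : 1 < p -> conj_exp p - 1 = (p - 1)^-1.
Proof.
by move=> p1; rewrite /conj_exp; field; rewrite subr_eq0 gt_eqF.
Qed.

Lemma conj_expK p : 1 < p -> conj_exp (conj_exp p) = p.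
Proof.
move=> p1; rewrite {1}/conj_exp conj_expB1// /conj_exp invrK mulfVK//.
by rewrite subr_eq0 gt_eqF.
Qed.

Lemma conj_expM p : 1 < p -> (p - 1) * conj_exp p = p.
Proof.
by move=> p1; rewrite /conj_exp mulrC mulfVK// subr_eq0 gt_eqF.
Qed.

End ConjugateExponents.

Section Muckenhoupt.
Context {R : realType} {n : nat} (n0 : (0 < n)%N).
Implicit Types (x y z : Rn R n) (r s : R) (p K : R) (u v w : Rn R n -> R).

(** Raising the dual weight to the power [1 - p] gives back [w]. *)
Definition dual_weight p w : Rn R n -> R := fun y => w y `^ (1 - conj_exp p).

(** The averages are cleared of their denominators, so that the condition lives
   in the reals. *)
Definition Ap_pos p K w :=
  [/\ pos_weight w, pos_weight (dual_weight p w) &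
    forall x r, 0 < r ->
      bmass w x r * bmass (dual_weight p w) x r `^ (p - 1) <= K * vol x r `^ p].

Definition A1_pos K w := pos_weight w /\
  forall x r, 0 < r ->
    {ae leb n, forall y, eball x r y -> bmass w x r <= K * vol x r * w y}.

Lemma le_bmass v x r y s : pos_weight v -> 0 < r -> 0 < s ->
  eball x r `<=` eball y s -> bmass v x r <= bmass v y s.
Proof.
move=> pv r0 s0 sub; rewrite -lee_fin -!bmassE//; have [mv v0 _] := pv.
apply: ge0_subset_integral => //; [exact: measurable_eball..| |].
- exact/measurable_funTS/measurable_EFinP.
- by move=> z _; rewrite lee_fin ltW.
Qed.

(** Hoelder's inequality for [1 = w^(1/p) w^(-1/p)]. *)
Lemma vol_le_Ap p w x r : 1 < p -> pos_weight w -> pos_weight (dual_weight p w) ->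
  0 < r -> vol x r `^ p <= bmass w x r * bmass (dual_weight p w) x r `^ (p - 1).
Proof.
move=> p1 pw ps r0; have [mw w0 _] := pw.
have p0 : 0 < p by apply: lt_trans p1.
have q0 : 0 < conj_exp p by apply: lt_trans (conj_exp_gt1 p1).
have mB := measurable_eball x r.
have := @hoelder_on _ _ _ (leb n) _ (fun y => w y `^ p^-1) (fun y => w y `^ (- p^-1))
  _ _ mB (measurableT_comp (measurable_powR _) mw) (measurableT_comp (measurable_powR _) mw)
  (fun y => powR_ge0 _ _) (fun y => powR_ge0 _ _) p0 q0 (conj_expE p1).
rewrite (eq_integral (fun=> 1%E)); last first.
  by move=> y _; rewrite powRN divff// gt_eqF// powR_gt0.
rewrite [X in (X `^ p^-1 * _)%E](_ : _ = mass w (eball x r)); last first.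
  by apply: eq_integral => y _; rewrite -powRrM mulVf ?powRr1 ?gt_eqF// ltW.
rewrite [X in (_ * X `^ (conj_exp p)^-1)%E]
    (_ : _ = mass (dual_weight p w) (eball x r)); last first.
  apply: eq_integral => y _; rewrite -powRrM /dual_weight; congr (_ `^ _)%:E.
  by rewrite /conj_exp; field; rewrite subr_eq0 !gt_eqF.
rewrite !bmassE// !poweR_EFin -EFinM => h.
have : vol x r <= bmass w x r `^ p^-1 * bmass (dual_weight p w) x r `^ (conj_exp p)^-1.
  by rewrite -lee_fin -vol_fin// -mass1.
have := bmass_gt0 x n0 ps r0; have := bmass_gt0 x n0 pw r0; have := vol_gt0 x n0 r0.
move: (vol x r) (bmass w x r) (bmass (dual_weight p w) x r) => V W S V0 W0 S0.
move=> /(ge0_ler_powR (ltW p0)); rewrite !nnegrE => /(_ (ltW V0)).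
move=> /(_ (mulr_ge0 (powR_ge0 _ _) (powR_ge0 _ _))) /le_trans; apply.
rewrite powRM ?powR_ge0// -!powRrM mulVf ?(gt_eqF p0)// powRr1 ?(ltW W0)//.
rewrite (_ : (conj_exp p)^-1 * p = p - 1)//.
by rewrite /conj_exp; field; rewrite subr_eq0 !gt_eqF.
Qed.

Lemma Ap_pos_const_ge1 p K w : 1 < p -> Ap_pos p K w -> 1 <= K.
Proof.
move=> p1 [pw ps h]; have r0 : 0 < 1 :> R by [].
have := le_trans (vol_le_Ap origin p1 pw ps r0) (h origin 1 r0).
by rewrite ler_pMl// powR_gt0// vol_gt0.
Qed.

Lemma Ap_pos_dual p K w : 1 < p -> Ap_pos p K w ->
  Ap_pos (conj_exp p) (K `^ (conj_exp p - 1)) (dual_weight p w).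
Proof.
move=> p1 Aw; have K1 := Ap_pos_const_ge1 p1 Aw; move: Aw => [pw ps h].
have q1 := conj_exp_gt1 p1.
have ww : dual_weight (conj_exp p) (dual_weight p w) = w.
  apply/funext => y; rewrite /dual_weight -powRrM conj_expK//.
  rewrite (_ : _ * _ = 1) ?powRr1 ?ltW//; first by case: pw.
  by rewrite /conj_exp; field; rewrite subr_eq0 gt_eqF.
split; rewrite ?ww// => x r r0.
have S0 := bmass_gt0 x n0 ps r0; have W0 := bmass_gt0 x n0 pw r0.
have V0 := vol_gt0 x n0 r0.
have := h x r r0; move=> /(@ge0_ler_powR _ (conj_exp p - 1)).
rewrite subr_ge0 !nnegrE => /(_ (ltW q1)).
have K0 : 0 <= K by apply: le_trans K1.
rewrite !mulr_ge0 ?powR_ge0 ?K0 ?(ltW W0)// => /(_ isT isT).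
rewrite !powRM ?powR_ge0 ?K0 ?(ltW W0)// -!powRrM.
rewrite (_ : p * _ = conj_exp p); last by rewrite /conj_exp; field; rewrite subr_eq0 gt_eqF.
rewrite (_ : (p - 1) * _ = 1); last by rewrite conj_expB1// divff// subr_eq0 gt_eqF.
by rewrite powRr1 ?(ltW S0)// mulrC.
Qed.

(** The [A_p] product on the large ball and its lower bound on the small one
   contain the masses of the dual weight, which are ordered. *)
Lemma Ap_pos_doubling p K w : 1 < p -> Ap_pos p K w ->
  doubling w (K * (vol_ub R n / vol_lb R n * 3 ^+ n) `^ p).
Proof.
move=> p1 Aw; have K1 := Ap_pos_const_ge1 p1 Aw; move: Aw => [pw ps h] x r r0.
have K0 : 0 < K by apply: lt_le_trans K1.
have p0 : 0 < p by apply: lt_trans p1.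
have r30 : 0 < 3 * r by rewrite mulr_gt0.
have S0 := bmass_gt0 x n0 ps r0; have W0 := bmass_gt0 x n0 pw r0.
have S30 := bmass_gt0 x n0 ps r30; have W30 := bmass_gt0 x n0 pw r30.
set c := vol_ub R n / vol_lb R n * 3 ^+ n.
have c0 : 0 <= c by rewrite mulr_ge0 ?exprn_ge0// divr_ge0 ?(ltW vol_ub_gt0) ?(ltW (vol_lb_gt0 n0)).
have V : vol x (3 * r) `^ p <= c `^ p * vol x r `^ p.
  rewrite -powRM ?c0 ?(ltW (vol_gt0 _ n0 r0))//; apply: ge0_ler_powR.
  - exact: ltW.
  - by rewrite nnegrE ltW ?vol_gt0.
  - by rewrite nnegrE mulr_ge0// ltW// vol_gt0.
  - exact: vol_comparable.
have S3p : 0 < bmass (dual_weight p w) x (3 * r) `^ (p - 1) by rewrite powR_gt0.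
rewrite -(ler_pM2r S3p); apply: (le_trans (h _ _ r30)).
rewrite -2!mulrA ler_pM2l//; apply: (le_trans V).
rewrite -mulrA; apply: ler_wpM2l; first exact: powR_ge0.
have hj := vol_le_Ap x p1 pw ps r0.
apply: le_trans hj _; rewrite (ler_pM2l W0).
apply: ge0_ler_powR; rewrite ?nnegrE ?subr_ge0 ?(ltW p1) ?(ltW S0) ?(ltW S30)//.
apply: le_bmass => //; apply: sub_eball.
by rewrite edistxx add0r; lra.
Qed.

Local Open Scope ereal_scope.
Notation M := (mx (fun=> 1%R)).

(** Lerner's pointwise domination of the maximal function: the average of [f]
   over a ball [Q] is the average with respect to the dual weight times the
   ratio of the masses, and the A_p condition turns that ratio into an average
   with respect to [w]. *)
Lemma lerner_pointwise p K w f x : (1 < p)%R -> Ap_pos p K w ->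
  measurable_fun setT f -> (forall y, 0 <= f y) ->
  M f x `^ (p - 1) <=
  K%:E * mx w (fun y => mx (dual_weight p w) f y `^ (p - 1)) x.
Proof.
move=> p1 Aw mf f0; have K1 := Ap_pos_const_ge1 p1 Aw; move: Aw => [pw ps h].
have K0 : (0 < K)%R by apply: lt_le_trans K1.
have p10 : (0 < p - 1)%R by rewrite subr_gt0.
have [mw w0 _] := pw; have [ms s0 _] := ps.
pose G y := mx (dual_weight p w) f y `^ (p - 1).
rewrite -/G; have G0 y : 0 <= G y by exact: poweR_ge0.
have mG : measurable_fun setT G.
  by apply: (measurableT_comp (measurable_poweR _)); exact: measurable_mx.
have H0 : 0 <= K%:E * mx w G x.
  by rewrite mule_ge0 ?lee_fin ?(ltW K0)// mx_ge0// => y; exact: ltW.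
suff : M f x <= (K%:E * mx w G x) `^ (p - 1)^-1.
  move=> /(@gt0_ler_poweR _ (p - 1)) /=; rewrite ?in_itv/= ?leey ?andbT => /(_ (ltW p10)).
  rewrite poweR_ge0 mx_ge0// => /(_ isT isT) /le_trans; apply.
  by rewrite -poweRrM mulVf ?gt_eqF// poweRe1.
apply: mx_le => [|k kx]; first exact: poweR_ge0.
have V0 : (0 < @qmass R n (fun=> 1%R) k)%R by apply: qmass_gt0 => //; exact: pos_weight1.
have W0 := qmass_gt0 k n0 pw; have S0 := qmass_gt0 k n0 ps.
set I := \int[leb n]_(y in qball k) f y.
have I0 : 0 <= I by apply: integral_ge0 => y _.
have mk := @measurable_qball R n k.
(* every point of the ball sees its average among those that define G *)
have G_ge : ((qmass (dual_weight p w) k)^-1%:E * I) `^ (p - 1) *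
    (@qmass R n (fun=> 1%R) k)%:E <= \int[leb n]_(y in qball k) G y.
  rewrite -qmassE; last exact: pos_weight1.
  rewrite /mass -ge0_integralZl//; last exact: poweR_ge0.
  apply: ge0_le_integral => //.
  - by move=> y _; rewrite mule1 poweR_ge0.
  - exact: measurable_funTS.
  move=> y ky; rewrite mule1 /G; apply: gt0_ler_poweR.
  - exact: ltW.
  - by rewrite in_itv/= leey mule_ge0// lee_fin invr_ge0 ltW.
  - by rewrite in_itv/= leey mx_ge0// => z; exact: ltW.
  - exact: mx_ge.
suff : ((@qmass R n (fun=> 1%R) k)^-1%:E * I) `^ (p - 1) <= K%:E * mx w G x.
  move=> /(@gt0_ler_poweR _ (p - 1)^-1) /=; rewrite ?in_itv/= ?leey ?andbT.
  rewrite invr_ge0 => /(_ (ltW p10) (poweR_ge0 _ _) H0); apply: le_trans.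
  rewrite -poweRrM divff ?gt_eqF// poweRe1// mule_ge0// lee_fin invr_ge0 ltW//.
apply: le_trans (lee_wpmul2l _ (mx_ge w G kx)); last by rewrite lee_fin ltW.
apply: le_trans (lee_wpmul2l _ (lee_wpmul2l _ G_ge)); first last.
- by rewrite lee_fin invr_ge0 ltW.
- by rewrite lee_fin ltW.
have Si0 : 0 <= ((qmass (dual_weight p w) k)^-1)%:E by rewrite lee_fin invr_ge0 ltW.
have Vi0 : 0 <= ((@qmass R n (fun=> 1%R) k)^-1)%:E by rewrite lee_fin invr_ge0 ltW.
rewrite !poweRM// !poweR_EFin.
rewrite [leRHS](_ : _ = (K * (qmass w k)^-1 * (qmass (dual_weight p w) k)^-1 `^ (p - 1)
  * @qmass R n (fun=> 1%R) k)%:E * I `^ (p - 1)); last first.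
  by rewrite !EFinM -!muleA; congr (_ * (_ * (_ * _))); exact: muleC.
apply: lee_wpmul2r; first exact: poweR_ge0.
rewrite lee_fin.
have := h (qcenter k) _ (@qradius_gt0 R n k).
rewrite -/(qmass w k) -/(qmass _ k) -bmass1 -/(qmass _ k).
set V := @qmass R n (fun=> 1%R) k in V0 *; set W := qmass w k in W0 *.
set S := qmass (dual_weight p w) k in S0 *.
clearbody V W S.
rewrite !powR_invl ?(ltW V0) ?(ltW S0)// -(mulr_powRB1 (ltW V0) (lt_trans ltr01 p1)) => hh.
have Sp : (0 < S `^ (p - 1))%R by rewrite powR_gt0.
have Vp : (0 < V `^ (p - 1))%R by rewrite powR_gt0.
rewrite -[leRHS](_ : (K * V / (W * S `^ (p - 1)) = _)%R); last first.
  by field; rewrite !gt_eqF.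
by rewrite ler_pdivlMr ?mulr_gt0// ler_pdivrMl// mulrCA (mulrC _ V).
Qed.

(** Muckenhoupt's theorem: Lerner's domination composes two maximal operators
   with doubling denominators, each bounded by [strong_type_mx]. *)
Theorem muckenhoupt p K : (1 < p)%R -> (0 < K)%R -> exists2 C : R, (0 < C)%R &
  forall w f, Ap_pos p K w -> measurable_fun setT f -> (forall y, 0 <= f y) ->
  \int[leb n]_x (M f x `^ p * (w x)%:E) <= C%:E * \int[leb n]_x (f x `^ p * (w x)%:E).
Proof.
move=> p1 K0; have p0 : (0 < p)%R by apply: lt_trans p1.
have q1 := conj_exp_gt1 p1; set q := conj_exp p in q1.
have q0 : (0 < q)%R by apply: lt_trans q1.
have p10 : (0 < p - 1)%R by rewrite subr_gt0.
set c := (vol_ub R n / vol_lb R n * 3 ^+ n)%R.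
have c0 : (0 < c)%R by rewrite mulr_gt0 ?exprn_gt0// divr_gt0 ?vol_ub_gt0 ?vol_lb_gt0.
pose Dw := (K * c `^ p)%R; pose Ds := (K `^ (q - 1) * c `^ q)%R.
have Dw0 : (0 < Dw)%R by rewrite mulr_gt0 ?powR_gt0.
have Ds0 : (0 < Ds)%R by rewrite mulr_gt0 ?powR_gt0.
have C1 := strong_const_gt0 Dw0 q1; have C2 := strong_const_gt0 Ds0 p1.
exists (K `^ q * (strong_const Dw q * strong_const Ds p))%R.
  by apply: mulr_gt0; [exact: powR_gt0|exact: mulr_gt0].
move=> w f Aw mf f0; have Adual := Ap_pos_dual p1 Aw.
have [pw ps h] := Aw; have [mw w0 _] := pw; have [ms s0 _] := ps.
have dw : doubling w Dw := Ap_pos_doubling p1 Aw.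
have ds : doubling (dual_weight p w) Ds := Ap_pos_doubling q1 Adual.
pose G y := mx (dual_weight p w) f y `^ (p - 1).
have G0 y : 0 <= G y by exact: poweR_ge0.
have mG : measurable_fun setT G.
  by apply: (measurableT_comp (measurable_poweR _)); exact: measurable_mx.
have mp (a : R) (g : Rn R n -> \bar R) (v : Rn R n -> R) : measurable_fun setT g ->
    measurable_fun setT v -> measurable_fun setT (fun x => g x `^ a * (v x)%:E).
  move=> mg mv; apply: emeasurable_funM; last exact/measurable_EFinP.
  exact: (measurableT_comp (measurable_poweR _)).
have pos (a : R) (g : Rn R n -> \bar R) (v : Rn R n -> R) x : (forall y, 0 < v y)%R ->
    0 <= g x `^ a * (v x)%:E.
  by move=> v0; rewrite mule_ge0 ?poweR_ge0// lee_fin ltW.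
have mxw0 x : 0 <= mx w G x by apply: mx_ge0 => // y; exact: ltW.
apply: (@le_trans _ _ (\int[leb n]_x ((K `^ q)%:E * (mx w G x `^ q * (w x)%:E)))).
  apply: ge0_le_integral => //.
  - by move=> x _; exact: pos.
  - by apply: mp => //; exact: measurable_mx.
  - by apply: measurable_funeM; apply: mp => //; exact: measurable_mx.
  move=> x _; rewrite muleA; apply: lee_wpmul2r; first by rewrite lee_fin ltW.
  rewrite -poweR_EFin -poweRM ?lee_fin ?(ltW K0)//.
  have {1}-> : p = ((p - 1) * q)%R by rewrite conj_expM.
  rewrite poweRrM; apply: gt0_ler_poweR.
  - exact: ltW.
  - by rewrite in_itv/= leey poweR_ge0.
  - by rewrite in_itv/= leey mule_ge0// lee_fin ltW.
  - exact: lerner_pointwise.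
rewrite ge0_integralZl_EFin ?powR_ge0//; first last.
- by apply: mp => //; exact: measurable_mx.
- by move=> x _; exact: pos.
rewrite EFinM -muleA; apply: lee_wpmul2l; first by rewrite lee_fin powR_ge0.
apply: (le_trans (strong_type_mx n0 pw dw Dw0 q1 mG G0)).
rewrite [in leRHS]EFinM -muleA; apply: lee_wpmul2l; first by rewrite lee_fin ltW.
have := strong_type_mx n0 ps ds Ds0 p1 mf f0.
have e1 : \int[leb n]_x (mx (dual_weight p w) f x `^ p * (dual_weight p w x)%:E) =
    \int[leb n]_x (G x `^ q * (w x `^ (1 - q))%:E).
  by apply: eq_integral => x _; rewrite /G -poweRrM conj_expM.
have e2 : \int[leb n]_x (f x `^ p * (dual_weight p w x `^ (1 - p))%:E) =
    \int[leb n]_x (f x `^ p * (w x)%:E).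
  apply: eq_integral => x _; congr (_ * _%:E); rewrite /dual_weight -powRrM.
  rewrite (_ : _ * _ = 1)%R ?powRr1 ?ltW//.
  by rewrite /conj_exp; field; rewrite subr_eq0 gt_eqF.
by rewrite e1 e2.
Qed.

End Muckenhoupt.

(** * The Rubio de Francia algorithm *)

Lemma sum_geometric_le {R : realType} (t : R) N : 0 <= t < 1 ->
  \sum_(0 <= k < N) t ^+ k <= (1 - t)^-1.
Proof.
move=> /andP[t0 t1]; have t10 : 0 < 1 - t by rewrite subr_gt0.
have := subrX1 t N; rewrite big_mkord => e.
rewrite -[leRHS]mul1r ler_pdivlMr//.
have := exprn_ge0 N t0; nra.
Qed.

Section Series.
Context {R : realType}.
Local Open Scope ereal_scope.

Lemma nneseries_le (u : nat -> \bar R) (X : \bar R) : (forall k, 0 <= u k) ->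
  (forall N, \sum_(0 <= k < N) u k <= X) -> \sum_(k <oo) u k <= X.
Proof.
move=> u0 h; apply: lime_le; first by apply: is_cvg_nneseries => k _ _.
exact: nearW.
Qed.

Lemma le_nneseries_term (u : nat -> \bar R) k : (forall i, 0 <= u i) ->
  u k <= \sum_(i <oo) u i.
Proof.
move=> u0; apply: le_trans (nneseries_lim_ge k.+1 _) => //.
by rewrite big_nat_recr//= leeDr// sume_ge0.
Qed.

Lemma nneseries_geometric_le (t : R) (u : nat -> \bar R) (X : \bar R) :
  (0 <= t < 1)%R -> (forall k, 0 <= u k) -> (forall k, u k <= X) ->
  \sum_(k <oo) (t ^+ k)%:E * u k <= ((1 - t)^-1)%:E * X.
Proof.
move=> /andP[t0 t1] u0 uX; have X0 : 0 <= X by apply: le_trans (uX 0%N).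
have t10 : (0 < 1 - t)%R by rewrite subr_gt0.
apply: nneseries_le => [k|N]; first by rewrite mule_ge0// lee_fin exprn_ge0.
apply: (@le_trans _ _ (\sum_(0 <= k < N) (t ^+ k)%:E * X)).
  by apply: lee_sum => k _; apply: lee_wpmul2l; rewrite ?lee_fin ?exprn_ge0.
rewrite -ge0_sume_distrl; last by move=> k _; rewrite lee_fin exprn_ge0.
apply: lee_wpmul2r => //; rewrite sumEFin lee_fin.
by apply: sum_geometric_le; rewrite t0.
Qed.

Lemma poweR_midpoint (p : R) (x y : \bar R) : (1 <= p)%R -> 0 <= x -> 0 <= y ->
  (2^-1%:E * (x + y)) `^ p <= 2^-1%:E * (x `^ p + y `^ p).
Proof.
move=> p1; have p0 : p != 0%R by rewrite gt_eqF// (lt_le_trans _ p1).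
have h20 : 0 < 2^-1%:E :> \bar R by rewrite lte_fin invr_gt0.
case: x => [x||//]; case: y => [y||//] => x0 y0; last 3 first.
- by rewrite [leRHS](_ : _ = +oo) ?leey// poweRyr// addey// gt0_muley.
- by rewrite [leRHS](_ : _ = +oo) ?leey// poweRyr// addye// gt0_muley.
- by rewrite [leRHS](_ : _ = +oo) ?leey// poweRyr// addye// gt0_muley.
rewrite -EFinD -EFinM !poweR_EFin -EFinD -EFinM lee_fin !mulrDr.
rewrite {2 4}(_ : 2^-1 = 1 - 2^-1)%R; last by rewrite {2}(splitr 1) div1r addrK.
by apply: (convex_powR p1 (Itv01 _ _)) => //=;
  rewrite ?inE/= ?in_itv/= ?andbT// ?invr_ge0// invf_le1 ?ler1n.
Qed.

(** Jensen's inequality for the probability weights [2^-(k+1)]. *)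
Lemma poweR_dyadic_average (p : R) (b : nat -> \bar R) : (1 <= p)%R ->
  (forall k, 0 <= b k) ->
  (\sum_(k <oo) ((2^-1) ^+ k.+1)%:E * b k) `^ p <=
  \sum_(k <oo) ((2^-1) ^+ k.+1)%:E * b k `^ p.
Proof.
move=> p1 b0; have p0 : (0 < p)%R by rewrite (lt_le_trans _ p1).
have h2 k : 0 <= ((2^-1) ^+ k)%:E :> \bar R by rewrite lee_fin exprn_ge0.
have fin N : forall c : nat -> \bar R, (forall k, 0 <= c k) ->
    (\sum_(0 <= k < N) ((2^-1) ^+ k.+1)%:E * c k) `^ p <=
    \sum_(0 <= k < N) ((2^-1) ^+ k.+1)%:E * c k `^ p.
  elim: N => [|N IH] c c0; first by rewrite !big_geq// poweR0r// gt_eqF.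
  have half (u : nat -> \bar R) : (forall k, 0 <= u k) ->
      \sum_(0 <= k < N.+1) ((2^-1) ^+ k.+1)%:E * u k =
      2^-1%:E * (u 0%N + \sum_(0 <= k < N) ((2^-1) ^+ k.+1)%:E * u k.+1).
    move=> u0; rewrite big_nat_recl//= expr1 ge0_muleDr//; last first.
      by apply: sume_ge0 => k _; rewrite mule_ge0.
    rewrite ge0_sume_distrr; last by move=> k _; rewrite mule_ge0.
    by congr (_ + _); apply: eq_bigr => k _; rewrite exprS EFinM muleA.
  rewrite (half _ c0) (half (fun k => c k `^ p)); last by move=> k; exact: poweR_ge0.
  apply: (le_trans (poweR_midpoint p1 (c0 0%N) _)).
    by apply: sume_ge0 => k _; rewrite mule_ge0.
  apply: lee_wpmul2l; first by rewrite lee_fin invr_ge0.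
  by apply: leeD2l; apply: (IH (fun k => c k.+1)) => k.
set T := leRHS.
have T0 : 0 <= T by apply: nneseries_ge0 => k _ _; rewrite mule_ge0 ?poweR_ge0.
have pinv : (p^-1 * p = 1)%R by rewrite mulVf// gt_eqF.
suff : \sum_(k <oo) ((2^-1) ^+ k.+1)%:E * b k <= T `^ p^-1.
  move=> /(@gt0_ler_poweR _ p (ltW p0)); rewrite !in_itv/= !leey !andbT.
  rewrite poweR_ge0 -poweRrM pinv poweRe1//; apply => //.
  by apply: nneseries_ge0 => k _ _; rewrite mule_ge0.
apply: nneseries_le => [k|N]; first by rewrite mule_ge0.
have : (\sum_(0 <= k < N) ((2^-1) ^+ k.+1)%:E * b k) `^ p <= T.
  apply: (le_trans (fin N b b0)); apply: nneseries_lim_ge => k _ _.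
  by rewrite mule_ge0 ?poweR_ge0.
have S0 : 0 <= \sum_(0 <= k < N) ((2^-1) ^+ k.+1)%:E * b k.
  by apply: sume_ge0 => k _; rewrite mule_ge0.
move=> /(@gt0_ler_poweR _ p^-1); rewrite invr_ge0 (ltW p0) !in_itv/= !leey !andbT.
rewrite -poweRrM mulrC pinv poweRe1// => -> //.
exact: poweR_ge0.
Qed.

End Series.

Section RubioDeFrancia.
Context {R : realType} {n : nat} (n0 : (0 < n)%N).
Implicit Types (x y z : Rn R n) (r s : R) (p K : R) (w : Rn R n -> R).
Implicit Types (f : Rn R n -> \bar R).
Local Open Scope ereal_scope.
Notation M := (mx (fun=> 1%R)).

(** The maximal operator over the countable family controls averages over all
   balls. *)
Lemma integral_le_mx f x r y : (0 < r)%R -> measurable_fun setT f ->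
  (forall z, 0 <= f z) -> eball x r y ->
  \int[leb n]_(z in eball x r) f z <=
  (vol_ub R n / vol_lb R n * 3 ^+ n * vol x r)%:E * M f y.
Proof.
move=> r0 mf f0 ry; have [k [sub rk]] := qball_cover x n0 r0.
have V0 : (0 < @qmass R n (fun=> 1%R) k)%R by apply: qmass_gt0 => //; exact: pos_weight1.
apply: (@le_trans _ _ (\int[leb n]_(z in qball k) f z)).
  apply: ge0_subset_integral => //; [exact: measurable_eball|exact: measurable_qball|].
  exact: measurable_funTS.
apply: (@le_trans _ _ ((@qmass R n (fun=> 1%R) k)%:E * M f y)).
  by rewrite -lee_pdivrMl//; apply: mx_ge; exact: sub.
apply: lee_wpmul2r; first exact: mx_ge0.
have rk0 := @qradius_gt0 R n k.
have r30 : (0 < 3 * r)%R by rewrite mulr_gt0.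
rewrite lee_fin /qmass bmass1; apply: (le_trans _ (vol_comparable (qcenter k) x n0 r0 _)) => //.
rewrite -!bmass1; apply: le_bmass => //; first exact: pos_weight1.
by apply: sub_eball; rewrite edistxx add0r.
Qed.

Definition rdf_series (t : R) f x : \bar R := \sum_(k <oo) (t ^+ k)%:E * iter k M f x.

Lemma iter_mx_ge0 f k x : (forall z, 0 <= f z) -> 0 <= iter k M f x.
Proof.
by move=> f0; elim: k x => [|k IH] x; [exact: f0|exact: mx_ge0].
Qed.

Lemma measurable_iter_mx f k : measurable_fun setT f -> measurable_fun setT (iter k M f).
Proof. by case: k => [//|k] _; exact: measurable_mx. Qed.

Lemma measurable_rdf_series t f : (0 <= t)%R -> measurable_fun setT f ->
  (forall z, 0 <= f z) -> measurable_fun setT (rdf_series t f).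
Proof.
move=> t0 mf f0; apply: ge0_emeasurable_sum.
- by move=> k x _ _; rewrite mule_ge0 ?lee_fin ?exprn_ge0// iter_mx_ge0.
- by move=> k _; apply: measurable_funeM; exact: measurable_iter_mx.
Qed.

(** By countable sublinearity, applying the operator shifts the series by one
   index; this is what makes its sum an [A_1] weight. *)
Lemma mx_rdf_series t f x : (0 < t)%R -> measurable_fun setT f ->
  (forall z, 0 <= f z) -> M (rdf_series t f) x <= t^-1%:E * rdf_series t f x.
Proof.
move=> t0 mf f0; have i0 k y : 0 <= iter k M f y by exact: iter_mx_ge0.
have c0 k : 0 <= (t ^+ k)%:E by rewrite lee_fin exprn_ge0// ltW.
have s0 : 0 <= rdf_series t f x by apply: nneseries_ge0 => k _ _; rewrite mule_ge0.
apply: mx_le => [|k kx]; first by rewrite mule_ge0// lee_fin invr_ge0 ltW.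
have V0 : (0 < @qmass R n (fun=> 1%R) k)%R by apply: qmass_gt0 => //; exact: pos_weight1.
rewrite /rdf_series integral_nneseries//; last 3 first.
- exact: measurable_qball.
- by move=> j; apply: measurable_funTS; apply: measurable_funeM; exact: measurable_iter_mx.
- by move=> j y _; rewrite mule_ge0.
rewrite lee_pdivrMl//; apply: nneseries_le => [j|N].
  by apply: integral_ge0 => y _; rewrite mule_ge0.
apply: (@le_trans _ _ (\sum_(0 <= j < N) ((@qmass R n (fun=> 1%R) k)%:E *
    (t^-1%:E * ((t ^+ j.+1)%:E * iter j.+1 M f x))))).
  apply: lee_sum => j _; rewrite ge0_integralZl_EFin//; first last.
  - by rewrite exprn_ge0// ltW.
  - by apply: measurable_funTS; exact: measurable_iter_mx.
  - exact: measurable_qball.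
  rewrite [in leRHS]exprS EFinM -muleA (muleA t^-1%:E) -EFinM mulVf ?gt_eqF// mul1e.
  rewrite muleCA; apply: lee_wpmul2l => //.
  by rewrite -lee_pdivrMl//; exact: mx_ge.
have tj j : 0 <= (t ^+ j.+1)%:E * iter j.+1 M f x by rewrite mule_ge0.
rewrite -ge0_sume_distrr; last first.
  by move=> j _; apply: mule_ge0 => //; rewrite lee_fin invr_ge0 ltW.
apply: lee_wpmul2l; first by rewrite lee_fin ltW.
rewrite -ge0_sume_distrr//; apply: lee_wpmul2l; first by rewrite lee_fin invr_ge0 ltW.
apply: le_trans (nneseries_lim_ge N.+1 _); last by move=> j _ _; rewrite mule_ge0.
by rewrite big_nat_recl//= leeDr// mule_ge0.
Qed.

Lemma integral_iter_mx p w (C : R) f k : (1 < p)%R -> (0 < C)%R -> pos_weight w ->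
  (forall g, measurable_fun setT g -> (forall y, 0 <= g y) ->
    \int[leb n]_x (M g x `^ p * (w x)%:E) <= C%:E * \int[leb n]_x (g x `^ p * (w x)%:E)) ->
  measurable_fun setT f -> (forall y, 0 <= f y) ->
  \int[leb n]_x (iter k M f x `^ p * (w x)%:E) <=
  (C ^+ k)%:E * \int[leb n]_x (f x `^ p * (w x)%:E).
Proof.
move=> p1 C0 [mw w0 _] hM mf f0; elim: k => [|k IH]; first by rewrite expr0 mul1e.
apply: (le_trans (hM _ (measurable_iter_mx k mf) (fun y => iter_mx_ge0 k y f0))).
by rewrite exprS EFinM -muleA; apply: lee_wpmul2l => //; rewrite lee_fin ltW.
Qed.

(** With this [t] the terms [t^k M^k f] have norms decaying like [2^-k], and
   Jensen's inequality replaces the triangle inequality of [L^p]. *)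
Lemma integral_rdf_series p w (C : R) f : (1 < p)%R -> (0 < C)%R -> pos_weight w ->
  (forall g, measurable_fun setT g -> (forall y, 0 <= g y) ->
    \int[leb n]_x (M g x `^ p * (w x)%:E) <= C%:E * \int[leb n]_x (g x `^ p * (w x)%:E)) ->
  measurable_fun setT f -> (forall y, 0 <= f y) ->
  \int[leb n]_x (rdf_series (2 * C `^ p^-1)^-1 f x `^ p * (w x)%:E) <=
  (2 `^ p)%:E * \int[leb n]_x (f x `^ p * (w x)%:E).
Proof.
move=> p1 C0 pw hM mf f0; have [mw w0 _] := pw.
have p0 : (0 < p)%R by apply: lt_trans p1.
set A := (C `^ p^-1)%R; have A0 : (0 < A)%R by rewrite powR_gt0.
have Ap : (A `^ p = C)%R by rewrite /A -powRrM mulVf ?gt_eqF// powRr1// ltW.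
pose b k x := (A^-1 ^+ k)%:E * iter k M f x.
have Ak0 k : (0 <= A^-1 ^+ k)%R by rewrite exprn_ge0// invr_ge0 ltW.
have h2 k : 0 <= ((2^-1) ^+ k)%:E :> \bar R by rewrite lee_fin exprn_ge0.
have b0 k x : 0 <= b k x by rewrite mule_ge0 ?lee_fin// iter_mx_ge0.
have mb k : measurable_fun setT (b k).
  by apply: measurable_funeM; exact: measurable_iter_mx.
pose term k x := ((2^-1) ^+ k.+1)%:E * (b k x `^ p * (w x)%:E).
have mbw k : measurable_fun setT (fun x => b k x `^ p * (w x)%:E).
  apply: emeasurable_funM; last exact/measurable_EFinP.
  exact: (measurableT_comp (measurable_poweR _)).
have bw0 k x : 0 <= b k x `^ p * (w x)%:E.
  by rewrite mule_ge0 ?poweR_ge0// lee_fin ltW.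
have mterm k : measurable_fun setT (term k) by exact: measurable_funeM.
have term0 k x : 0 <= term k x by rewrite mule_ge0.
set I := \int[leb n]_x (f x `^ p * (w x)%:E).
have I0 : 0 <= I by apply: integral_ge0 => x _; rewrite mule_ge0 ?poweR_ge0// lee_fin ltW.
have intb k : \int[leb n]_x (b k x `^ p * (w x)%:E) <= I.
  rewrite (eq_integral (fun x => ((A^-1 ^+ k) `^ p)%:E *
      (iter k M f x `^ p * (w x)%:E))); last first.
    by move=> x _; rewrite /b poweRM ?lee_fin ?iter_mx_ge0// poweR_EFin muleA.
  have mi : measurable_fun setT (fun x => iter k M f x `^ p * (w x)%:E).
    apply: emeasurable_funM; last exact/measurable_EFinP.
    by apply: (measurableT_comp (measurable_poweR _)); exact: measurable_iter_mx.
  rewrite ge0_integralZl_EFin ?powR_ge0//; last first.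
    by move=> x _; rewrite mule_ge0 ?poweR_ge0// lee_fin ltW.
  apply: (@le_trans _ _ (((A^-1 ^+ k) `^ p)%:E * ((C ^+ k)%:E * I))).
    apply: lee_wpmul2l; first by rewrite lee_fin powR_ge0.
    exact: integral_iter_mx.
  rewrite muleA -EFinM.
  have -> : (C ^+ k = (A ^+ k) `^ p)%R.
    by rewrite -Ap -(powR_mulrn _ (powR_ge0 _ _)) -(powR_mulrn _ (ltW A0)) powRAC.
  rewrite -powRM ?Ak0 ?exprn_ge0 ?(ltW A0)// -exprMn mulVf ?(gt_eqF A0)//.
  by rewrite expr1n powR1 mul1e.
have rdfE x : rdf_series (2 * A)^-1 f x = 2%:E * \sum_(k <oo) ((2^-1) ^+ k.+1)%:E * b k x.
  rewrite -nneseriesZl//; last by move=> k _; rewrite mule_ge0.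
  apply: eq_eseriesr => k _; rewrite /b !muleA -!EFinM; congr (_%:E * _).
  by rewrite invfM exprMn exprS mulrA divff// mul1r.
apply: (@le_trans _ _ (\int[leb n]_x ((2 `^ p)%:E * \sum_(k <oo) term k x))).
  apply: ge0_le_integral => //.
  - by move=> x _; rewrite mule_ge0 ?poweR_ge0// lee_fin ltW.
  - apply: emeasurable_funM; last exact/measurable_EFinP.
    apply: (measurableT_comp (measurable_poweR _)); apply: measurable_rdf_series => //.
    by rewrite invr_ge0 mulr_ge0// ltW.
  - by apply: measurable_funeM; apply: ge0_emeasurable_sum => [k x _ _|k _].
  move=> x _; have S0 : 0 <= \sum_(k <oo) ((2^-1) ^+ k.+1)%:E * b k x.
    by apply: nneseries_ge0 => k _ _; rewrite mule_ge0.
  rewrite rdfE poweRM// poweR_EFin -muleA; apply: lee_wpmul2l.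
    by rewrite lee_fin powR_ge0.
  rewrite [leRHS](_ : _ = (\sum_(k <oo) ((2^-1) ^+ k.+1)%:E * b k x `^ p) * (w x)%:E).
    apply: lee_wpmul2r; first by rewrite lee_fin ltW.
    exact: (poweR_dyadic_average (ltW p1)).
  rewrite muleC -nneseriesZl//; last by move=> k _; rewrite mule_ge0 ?poweR_ge0.
  by apply: eq_eseriesr => k _; rewrite /term muleA muleC.
rewrite ge0_integralZl_EFin ?powR_ge0//; first last.
- by apply: ge0_emeasurable_sum => [k x _ _|k _].
- by move=> x _; apply: nneseries_ge0.
apply: lee_wpmul2l; first by rewrite lee_fin powR_ge0.
rewrite integral_nneseries//.
under eq_eseriesr do rewrite ge0_integralZl_EFin ?exprn_ge0//.
apply: (@le_trans _ _ (\sum_(k <oo) (2^-1 ^+ k)%:E * (2^-1%:E * I))).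
  apply: lee_nneseries => [k _ _|k _].
    by rewrite mule_ge0// integral_ge0.
  rewrite exprSr EFinM -muleA; apply: lee_wpmul2l => //.
  by apply: lee_wpmul2l => //; rewrite lee_fin invr_ge0.
have hI0 : 0 <= 2^-1%:E * I by rewrite mule_ge0// lee_fin invr_ge0.
apply: le_trans (nneseries_geometric_le _ _ (fun=> lexx (2^-1%:E * I))) _ => //.
  by rewrite invr_ge0 ler0n invf_lt1// ltr1n.
by rewrite muleA -EFinM (_ : _ * _ = 1)%R ?mul1e//; field.
Qed.

(** Iterating the maximal operator turns any function of the weighted space
   into an [A_1] majorant of comparable norm, with an [A_1] constant that
   depends on the weight only through its [A_p] bound. *)
Theorem rubio_de_francia p K : (1 < p)%R -> (0 < K)%R -> exists2 c : R, (0 < c)%R &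
  forall w (F : Rn R n -> R), Ap_pos p K w -> measurable_fun setT F ->
    (forall x, 0 <= F x)%R -> mass (fun x => (F x `^ p * w x)%R) setT < +oo ->
    0 < mass F (eball origin 1) ->
  exists v : Rn R n -> R, [/\ A1_pos c v, (forall x, F x <= v x)%R &
    mass (fun x => (v x `^ p * w x)%R) setT <=
    (2 `^ p)%:E * mass (fun x => (F x `^ p * w x)%R) setT].
Proof.
move=> p1 K0; have [C C0 hC] := muckenhoupt n0 p1 K0.
have p0 : (0 < p)%R by apply: lt_trans p1.
set t := ((2 * C `^ p^-1)^-1)%R.
have t0 : (0 < t)%R by rewrite invr_gt0 mulr_gt0// powR_gt0.
set c := (vol_ub R n / vol_lb R n * 3 ^+ n / t)%R.
have c0 : (0 < c)%R.
  by rewrite divr_gt0// mulr_gt0 ?exprn_gt0// divr_gt0 ?vol_ub_gt0 ?vol_lb_gt0.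
exists c => // w F Aw mF F0 Ffin F1.
have [pw _ _] := Aw; have [mw w0 _] := pw.
pose f x := (F x)%:E.
have mf : measurable_fun setT f by exact/measurable_EFinP.
have f0 x : 0 <= f x by rewrite lee_fin.
pose V := rdf_series t f.
have mV : measurable_fun setT V by apply: measurable_rdf_series => //; exact: ltW.
have V0 x : 0 <= V x.
  by apply: nneseries_ge0 => k _ _; rewrite mule_ge0 ?iter_mx_ge0// lee_fin exprn_ge0// ltW.
have FV x : f x <= V x.
  have := @le_nneseries_term R (fun k => (t ^+ k)%:E * iter k M f x) 0%N.
  rewrite expr0 mul1e; apply => k.
  by rewrite mule_ge0 ?iter_mx_ge0// lee_fin exprn_ge0// ltW.
have VA1 x r y : (0 < r)%R -> eball x r y ->
    \int[leb n]_(z in eball x r) V z <= (c * vol x r)%:E * V y.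
  move=> r0 ry; apply: (le_trans (integral_le_mx r0 mV V0 ry)).
  apply: (@le_trans _ _ ((vol_ub R n / vol_lb R n * 3 ^+ n * vol x r)%:E *
      (t^-1%:E * V y))).
    apply: lee_wpmul2l; last exact: mx_rdf_series.
    rewrite lee_fin; apply: mulr_ge0; last exact: ltW (vol_gt0 x n0 r0).
    rewrite mulr_ge0 ?exprn_ge0// divr_ge0 ?(ltW vol_ub_gt0) ?(ltW (vol_lb_gt0 n0))//.
  by rewrite muleA -EFinM mulrAC.
have I_fin : \int[leb n]_x (V x `^ p * (w x)%:E) <=
    (2 `^ p)%:E * mass (fun x => (F x `^ p * w x)%R) setT.
  apply: (le_trans (integral_rdf_series p1 C0 pw _ mf f0)) => //.
  by move=> g mg g0; exact: hC.
have V_ae : {ae leb n, forall x, V x < +oo}.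
  have mI : measurable_fun setT (fun x => V x `^ p * (w x)%:E).
    apply: emeasurable_funM; last exact/measurable_EFinP.
    exact: (measurableT_comp (measurable_poweR _)).
  have Vw0 x : 0 <= V x `^ p * (w x)%:E by rewrite mule_ge0 ?poweR_ge0// lee_fin ltW.
  have : (leb n).-integrable setT (fun x => V x `^ p * (w x)%:E).
    apply/integrableP; split => //; under eq_integral do rewrite gee0_abs//.
    by apply: (le_lt_trans I_fin); rewrite lte_mul_pinfty// lee_fin powR_ge0.
  move=> /(integrable_ae measurableT); apply: filterS => x /(_ Logic.I) h.
  rewrite ltey; apply/eqP => Vx; move: h.
  by rewrite Vx poweRyr ?gt_eqF// gt0_mulye// lte_fin.
pose v x : R := if V x < +oo then fine (V x) else (F x + 1)%R.
have vV x : V x < +oo -> (v x)%:E = V x.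
  by move=> h; rewrite /v h fineK// ge0_fin_numE.
have mv : measurable_fun setT v.
  apply: measurable_fun_ifT => //.
  - by apply: measurable_fun_lte => //; exact: measurable_cst.
  - by apply: (measurableT_comp (fine_measurable _)).
  - exact: measurable_funD.
have Vpos y : 0 < V y.
  set rho := (1 + edist origin y)%R.
  have rho0 : (0 < rho)%R by rewrite ltr_pwDl// edist_ge0.
  have yB : eball origin rho y by rewrite eballE ltrDr.
  have := VA1 _ _ _ rho0 yB; apply: contraTT; rewrite -leNgt => Vy.
  have -> : V y = 0 by apply/eqP; rewrite eq_le Vy V0.
  rewrite mule0 -ltNge; apply: (lt_le_trans F1).
  apply: (@le_trans _ _ (\int[leb n]_(z in eball origin 1) V z)).
    apply: ge0_le_integral => //; first exact: measurable_eball.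
    - by move=> z _; exact: f0.
    - exact: (measurable_funTS mf).
    - exact: (measurable_funTS mV).
    - by move=> z _; exact: FV.
  apply: ge0_subset_integral => //; [exact: measurable_eball..| |].
    exact: measurable_funTS.
  by apply: sub_eball; rewrite edistxx add0r lerDl edist_ge0.
have vpos x : (0 < v x)%R.
  rewrite /v; case: ifPn => h; first by rewrite fine_gt0// Vpos.
  by rewrite ltr_wpDl.
have massv x r : mass v (eball x r) = \int[leb n]_(z in eball x r) V z.
  apply: ge0_ae_eq_integral => //; first exact: measurable_eball.
  - exact/measurable_funTS/measurable_EFinP.
  - exact: measurable_funTS.
  - by move=> z _; rewrite lee_fin ltW.
  - by move: V_ae; apply: filterS => z /vV.
have vfin x r : (0 < r)%R -> mass v (eball x r) < +oo.
  move=> r0; have [N [mN N0 sub]] := V_ae.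
  have [y By Vy] : exists2 y, eball x r y & V y < +oo.
    apply: contrapT => h; have : leb n (eball x r) = 0.
      apply: (subset_measure0 (measurable_eball x r) mN _ N0) => y By.
      by apply: sub => /= Vy; apply: h; exists y.
    by rewrite vol_fin// => -[/eqP]; rewrite gt_eqF// vol_gt0.
  rewrite massv; apply: (le_lt_trans (VA1 _ _ _ r0 By)).
  by rewrite lte_mul_pinfty// lee_fin mulr_ge0 ?(ltW c0)// ltW// vol_gt0.
have pv : pos_weight v by split.
exists v; split.
- split=> // x r r0; move: V_ae; apply: filterS => y Vy By.
  by rewrite -lee_fin -bmassE// massv EFinM vV//; exact: VA1.
- move=> x; rewrite /v; case: ifPn => h; last by rewrite lerDl.
  by rewrite -lee_fin fineK ?ge0_fin_numE//; exact: FV.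
- apply: le_trans I_fin; rewrite le_eqVlt; apply/orP; left; apply/eqP.
  apply: ge0_ae_eq_integral => //.
  + apply/measurable_EFinP; apply: measurable_funM => //.
    exact: (measurableT_comp (measurable_powR _)).
  + apply: emeasurable_funM; last exact/measurable_EFinP.
    exact: (measurableT_comp (measurable_poweR _)).
  + by move=> z _; rewrite lee_fin mulr_ge0 ?powR_ge0// ltW.
  + by move=> z _; rewrite mule_ge0 ?poweR_ge0// lee_fin ltW.
  + by move: V_ae; apply: filterS => z /vV <- _; rewrite EFinM poweR_EFin.
Qed.

End RubioDeFrancia.

(** * Constants of the Muckenhoupt classes and factored weights *)

Section Classes.
Context {R : realType} {n : nat} (n0 : (0 < n)%N).
Implicit Types (x y z : Rn R n) (r s : R) (p K c : R) (g h v w : Rn R n -> R).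

Definition Apos_class p K w := if p == 1 then A1_pos K w else Ap_pos p K w.

Lemma Apos_classP p K w : 1 < p -> Apos_class p K w = Ap_pos p K w.
Proof. by move=> p1; rewrite /Apos_class gt_eqF. Qed.

Lemma Apos_class_pos_weight p K w : Apos_class p K w -> pos_weight w.
Proof. by rewrite /Apos_class; case: ifP => _ []. Qed.

Lemma ae_eball_exists x r (P : Rn R n -> Prop) : 0 < r ->
  {ae leb n, forall y, eball x r y -> P y} -> exists2 y, eball x r y & P y.
Proof.
move=> r0 [N [mN N0 sub]]; apply: contrapT => h.
have : leb n (eball x r) = 0%E.
  apply: (subset_measure0 (measurable_eball x r) mN _ N0) => y By.
  by apply: sub => /= Py; apply: h; exists y => //; exact: Py.
by rewrite vol_fin// => -[/eqP]; rewrite gt_eqF// vol_gt0.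
Qed.

Lemma average_pos v x r : pos_weight v -> 0 < r ->
  average v (eball x r) = (bmass v x r / vol x r)%:E.
Proof. by move=> pv r0; rewrite /average bmassE. Qed.

Lemma integral_cst_eball (a : R) x r : 0 < r ->
  (\int[leb n]_(y in eball x r) a%:E)%E = (a * vol x r)%:E.
Proof.
move=> r0; have := integral_cst (leb n) (measurable_eball x r) a%:E; rewrite /cst => ->.
by rewrite EFinM -(vol_fin x r0).
Qed.

Lemma pos_weight_weight w : pos_weight w -> weight w.
Proof.
move=> [mw w0 wfin]; split => //.
- move=> x r r0; rewrite (_ : (fun y => _) = w) ?wfin//.
  by apply/funext => y; rewrite ger0_norm// ltW.
- exact: aeW.
Qed.

Lemma A1_bound_ge1 w c : pos_weight w -> A1_bound w c -> 1 <= c.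
Proof.
move=> pw h; have r0 : 0 < 1 :> R by [].
have := h origin 1 r0; rewrite average_pos// => hB.
have [mw w0 _] := pw.
have W0 := bmass_gt0 origin n0 pw r0; have V0 := vol_gt0 (origin : Rn R n) n0 r0.
have c0 : 0 < c.
  have [y By] := ae_eball_exists r0 hB; rewrite lee_fin => hy.
  rewrite -(pmulr_lgt0 _ (w0 y)); apply: lt_le_trans hy.
  exact: divr_gt0.
have mB := measurable_eball (origin : Rn R n) 1.
have mEw : measurable_fun setT (EFin \o w) by exact/measurable_EFinP.
have : ((bmass w origin 1)%:E <= c%:E * (bmass w origin 1)%:E)%E.
  pose a := bmass w origin 1 / vol (origin : Rn R n) 1.
  apply: (@le_trans _ _ (\int[leb n]_(y in eball origin 1) a%:E)%E).
    by rewrite integral_cst_eball// divfK// gt_eqF.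
  rewrite -bmassE// /mass -ge0_integralZl_EFin//; last 3 first.
  - by move=> y _; rewrite lee_fin ltW.
  - exact: measurable_funTS.
  - exact: ltW.
  apply: ae_ge0_le_integral => //.
  - by move=> y _; rewrite lee_fin divr_ge0// ltW.
  - by move=> y _; rewrite mule_ge0// lee_fin ltW.
  - by apply: measurable_funTS; exact: measurable_funeM.
by rewrite -EFinM lee_fin ler_pMl.
Qed.

(** The constant of the class as defined by a supremum or an infimum lies
   between 1, where a monotone dependence on it is usable, and [K]. *)
Lemma Apos_class_Muckenhoupt p K w : 1 <= p -> Apos_class p K w ->
  Muckenhoupt p w /\ 1 <= fine (Ap_const p w) <= K.
Proof.
rewrite le_eqVlt => /predU1P[<-|p1].
  rewrite /Apos_class eqxx => -[pw h].
  have hK : A1_bound w K.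
    move=> x r r0; move: (h x r r0); apply: filterS => y hy /hy {}hy.
    by rewrite average_pos// lee_fin ler_pdivrMr ?vol_gt0// mulrAC.
  rewrite /Muckenhoupt /Ap_const !eqxx; split.
    by split; [exact: pos_weight_weight|exists K].
  have le1 : (1%:E <= ereal_inf [set c%:E | c in A1_bound w])%E.
    by apply: le_ereal_inf_tmp => _ [c hc <-]; rewrite lee_fin; exact: A1_bound_ge1 hc.
  have leK : (ereal_inf [set c%:E | c in A1_bound w] <= K%:E)%E.
    by apply: ereal_inf_lbound; exists K.
  by move: le1 leK; case: ereal_inf => [c||]//=; rewrite !lee_fin => -> ->.
rewrite Apos_classP// => -[pw ps h].
rewrite /Muckenhoupt /Ap_const (gt_eqF p1); set S := ereal_sup _.
have term x r : 0 < r -> (average w (eball x r) * average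
   (fun y => (w y `^ (1 - conj_exp p))%R) (eball x r) `^ (p - 1))%E =
   (bmass w x r * bmass (dual_weight p w) x r `^ (p - 1) / vol x r `^ p)%:E.
  move=> r0; rewrite average_pos// -/(dual_weight p w) average_pos// poweR_EFin -EFinM.
  have := bmass_gt0 x n0 ps r0; have := vol_gt0 x n0 r0.
  move: (vol x r) (bmass w x r) (bmass _ x r) => V W s V0 s0.
  congr EFin; rewrite powRM ?invr_ge0 ?(ltW s0) ?(ltW V0)// powR_invl ?(ltW V0)//.
  rewrite -(mulr_powRB1 (ltW V0) (lt_trans ltr01 p1)).
  have Vp : 0 < V `^ (p - 1) by rewrite powR_gt0.
  by field; rewrite !gt_eqF.
have V0 x r : 0 < r -> 0 < vol x r `^ p by move=> r0; rewrite powR_gt0// vol_gt0.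
have S1 : (1%:E <= S)%E.
  apply: le_trans (ereal_sup_ubound _); last by exists origin, 1.
  rewrite term// lee_fin ler_pdivlMr ?V0// mul1r.
  exact: vol_le_Ap.
have SK : (S <= K%:E)%E.
  apply: ge_ereal_sup => _ [x [r [r0 ->]]].
  by rewrite term// lee_fin ler_pdivrMr ?V0//; exact: h.
split; last by move: S1 SK; case: S => [c||]//=; rewrite !lee_fin => -> ->.
split; first exact: pos_weight_weight.
exact: le_lt_trans SK (ltry _).
Qed.

(** Finiteness of the supremum makes the dual weight locally integrable: an
   infinite average of it would make the [A_p] product infinite. *)
Lemma Muckenhoupt_Apos_class p w : 1 <= p -> (forall x, 0 < w x) -> Muckenhoupt p w ->
  exists2 K, 0 < K & Apos_class p K w.
Proof.
move=> p1 w0 [[mw wfin _] wp].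
have pw : pos_weight w.
  split => // x r r0; have := wfin x r r0.
  by rewrite (_ : (fun y => _) = w)//; apply/funext => y; rewrite ger0_norm// ltW.
move: p1 wp; rewrite le_eqVlt => /predU1P[<-|p1].
  rewrite eqxx => -[c hc]; have c1 := A1_bound_ge1 pw hc.
  exists c; first exact: lt_le_trans c1.
  rewrite /Apos_class eqxx; split => // x r r0.
  move: (hc x r r0); apply: filterS => y hy /hy.
  by rewrite average_pos// lee_fin ler_pdivrMr ?vol_gt0// mulrAC.
rewrite /Ap_const (gt_eqF p1); set S := ereal_sup _ => Sfin.
pose s := dual_weight p w.
have s0 x : 0 < s x by rewrite powR_gt0.
have ms : measurable_fun setT s by exact: (measurableT_comp (measurable_powR _)).
have term x r : 0 < r ->
    (average w (eball x r) * average s (eball x r) `^ (p - 1) <= S)%E.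
  by move=> r0; apply: ereal_sup_ubound; exists x, r.
have ps : pos_weight s.
  split => // x r r0; have W0 := bmass_gt0 x n0 pw r0.
  rewrite ltey; apply/eqP => sy; have := term x r r0.
  rewrite average_pos// {1}/average sy gt0_mulye; last first.
    by rewrite lte_fin invr_gt0 -/(vol x r) vol_gt0.
  rewrite poweRyr ?subr_eq0 ?gt_eqF// gt0_muley ?leye_eq; last first.
    by rewrite lte_fin divr_gt0// vol_gt0.
  by move/eqP => S_y; rewrite S_y in Sfin.
have S0 : (0 <= S)%E.
  apply: le_trans (term origin 1 ltr01).
  by rewrite mule_ge0 ?poweR_ge0// average_pos// lee_fin divr_ge0// ltW ?vol_gt0 ?bmass_gt0.
have [K SE] : exists K, S = K%:E.
  by exists (fine S); rewrite fineK// ge0_fin_numE.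
have Aw : Ap_pos p K w.
  split => // x r r0; have := term x r r0.
  rewrite SE !average_pos// poweR_EFin -EFinM lee_fin -/s.
  have := bmass_gt0 x n0 ps r0; have := vol_gt0 x n0 r0.
  move: (vol x r) (bmass w x r) (bmass s x r) => V W t V0 t0.
  have Vp : 0 < V `^ p by rewrite powR_gt0.
  rewrite -ler_pdivrMr//; apply: le_trans; rewrite le_eqVlt; apply/orP; left; apply/eqP.
  rewrite powRM ?invr_ge0 ?(ltW t0) ?(ltW V0)// powR_invl ?(ltW V0)//.
  rewrite -(mulr_powRB1 (ltW V0) (lt_trans ltr01 p1)).
  have Vp1 : 0 < V `^ (p - 1) by rewrite powR_gt0.
  by field; rewrite !gt_eqF.
exists K; last by rewrite Apos_classP.
by apply: lt_le_trans (Ap_pos_const_ge1 n0 p1 Aw).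
Qed.

Lemma mass_mul_le g h (a : R) x r : 0 < r -> pos_weight g -> measurable_fun setT h ->
  (forall y, 0 <= h y) -> 0 <= a ->
  {ae leb n, forall y, eball x r y -> h y <= a} ->
  (mass (fun y => h y * g y)%R (eball x r) <= (a * bmass g x r)%:E)%E.
Proof.
move=> r0 pg mh h0 a0 hae; have [mg g0 _] := pg.
have mB := measurable_eball x r.
have mEg : measurable_fun setT (EFin \o g) by exact/measurable_EFinP.
rewrite EFinM -bmassE// /mass -ge0_integralZl_EFin//; last 2 first.
- by move=> y _; rewrite lee_fin ltW.
- exact: measurable_funTS.
apply: ae_ge0_le_integral => //.
- by move=> y _; rewrite lee_fin mulr_ge0// ltW.
- by apply/measurable_funTS/measurable_EFinP; exact: measurable_funM.
- by move=> y _; rewrite mule_ge0 ?lee_fin// ltW.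
- by apply: measurable_funTS; exact: measurable_funeM.
move: hae; apply: filterS => y hy /hy hya.
by rewrite -EFinM lee_fin ler_wpM2r// ltW.
Qed.

(** Factored weights: on a ball the [A_1] bounds replace [v1] and [v2], raised
   to negative powers, by their averages, and these averages cancel. *)
Lemma factored_weight p c1 c2 v1 v2 : 1 <= p -> 0 < c1 -> 0 < c2 ->
  A1_pos c1 v1 -> A1_pos c2 v2 ->
  Apos_class p (c1 `^ (p - 1) * c2) (fun x => v1 x `^ (1 - p) * v2 x).
Proof.
move=> + c10 c20 [pv1 h1] [pv2 h2].
rewrite le_eqVlt => /predU1P[<-|p1].
  rewrite /Apos_class eqxx !subrr powRr0 mul1r.
  by rewrite (_ : (fun x => _) = v2)//; apply/funext => x; rewrite powRr0 mul1r.
have p10 : 0 < p - 1 by rewrite subr_gt0.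
have [mv1 v10 _] := pv1; have [mv2 v20 _] := pv2.
rewrite Apos_classP//; set W := fun x => _.
have W0 x : 0 < W x by rewrite mulr_gt0// powR_gt0.
have mW : measurable_fun setT W.
  by apply: measurable_funM => //; exact: (measurableT_comp (measurable_powR _)).
set s := dual_weight p W.
have sE : s = fun x => v2 x `^ (1 - conj_exp p) * v1 x.
  apply/funext => x; rewrite /s /dual_weight /W powRM ?powR_ge0 ?(ltW (v20 x))//.
  rewrite -powRrM mulrC (_ : (1 - p) * _ = 1) ?powRr1 ?(ltW (v10 x))//.
  by rewrite /conj_exp; field; rewrite subr_eq0 gt_eqF.
have s0 x : 0 < s x by rewrite powR_gt0.
have ms : measurable_fun setT s by exact: (measurableT_comp (measurable_powR _)).
pose a1 x r := bmass v1 x r / (c1 * vol x r).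
pose a2 x r := bmass v2 x r / (c2 * vol x r).
have a1_gt0 x r : 0 < r -> 0 < a1 x r.
  by move=> r0; rewrite divr_gt0 ?bmass_gt0// mulr_gt0// vol_gt0.
have a2_gt0 x r : 0 < r -> 0 < a2 x r.
  by move=> r0; rewrite divr_gt0 ?bmass_gt0// mulr_gt0// vol_gt0.
have npow (a b e : R) : 0 < a -> a <= b -> e <= 0 -> b `^ e <= a `^ e.
  move=> a_0 ab e0; have b0 : 0 < b by apply: lt_le_trans ab.
  rewrite -(opprK e) !(powRN _ (- e)) lef_pV2 ?posrE ?powR_gt0//.
  by apply: ge0_ler_powR; rewrite ?nnegrE ?oppr_ge0 ?(ltW a_0) ?(ltW b0).
have q1 := conj_exp_gt1 p1.
have boundW x r : 0 < r ->
    (mass W (eball x r) <= (a1 x r `^ (1 - p) * bmass v2 x r)%:E)%E.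
  move=> r0; apply: mass_mul_le => //; rewrite ?powR_ge0//.
  - exact: (measurableT_comp (measurable_powR _)).
  - by move=> y; rewrite powR_ge0.
  move: (h1 x r r0); apply: filterS => y hy /hy {}hy.
  apply: npow; rewrite ?a1_gt0 ?subr_le0 ?(ltW p1)//.
  by rewrite ler_pdivrMr ?mulr_gt0 ?vol_gt0// mulrC.
have bounds x r : 0 < r ->
    (mass s (eball x r) <= (a2 x r `^ (1 - conj_exp p) * bmass v1 x r)%:E)%E.
  move=> r0; rewrite sE; apply: mass_mul_le => //; rewrite ?powR_ge0//.
  - exact: (measurableT_comp (measurable_powR _)).
  - by move=> y; rewrite powR_ge0.
  move: (h2 x r r0); apply: filterS => y hy /hy {}hy.
  apply: npow; rewrite ?a2_gt0 ?subr_le0 ?(ltW q1)//.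
  by rewrite ler_pdivrMr ?mulr_gt0 ?vol_gt0// mulrC.
have pW : pos_weight W by split=> // x r r0; exact: le_lt_trans (boundW x r r0) (ltry _).
have ps : pos_weight s by split=> // x r r0; exact: le_lt_trans (bounds x r r0) (ltry _).
split => // x r r0; rewrite -/s.
have := boundW x r r0; have := bounds x r r0; rewrite !bmassE// !lee_fin /a1 /a2.
have := bmass_gt0 x n0 ps r0; have := bmass_gt0 x n0 pW r0; have := vol_gt0 x n0 r0.
have := bmass_gt0 x n0 pv1 r0; have := bmass_gt0 x n0 pv2 r0.
move: (vol x r) (bmass W x r) (bmass s x r) (bmass v1 x r) (bmass v2 x r).
move=> V m t m1 m2 m20 m10 V0 m0 t0 ht hm.
have cV1 : 0 < c1 * V by rewrite mulr_gt0.
have cV2 : 0 < c2 * V by rewrite mulr_gt0.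
have ht' : t `^ (p - 1) <= (m2 / (c2 * V))^-1 * m1 `^ (p - 1).
  move: ht => /(@ge0_ler_powR _ (p - 1) (ltW p10)); rewrite !nnegrE (ltW t0).
  rewrite mulr_ge0 ?powR_ge0 ?(ltW m10)// => /(_ isT isT).
  rewrite powRM ?powR_ge0 ?(ltW m10)// -powRrM.
  rewrite (_ : (1 - conj_exp p) * _ = -1); last first.
    by rewrite /conj_exp; field; rewrite subr_eq0 gt_eqF.
  by rewrite powR_inv1// divr_ge0// ltW.
apply: (le_trans (ler_pM (ltW m0) (powR_ge0 _ _) hm ht')).
rewrite -[1 - p]opprB powRN -(mulr_powRB1 (ltW V0) (lt_trans ltr01 p1)).
rewrite powRM ?invr_ge0 ?(ltW m10) ?(ltW cV1)// powR_invl ?(ltW cV1)//.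
rewrite powRM ?(ltW c10) ?(ltW V0)//.
have e1 : 0 < c1 `^ (p - 1) by rewrite powR_gt0.
have e2 : 0 < V `^ (p - 1) by rewrite powR_gt0.
have e3 : 0 < m1 `^ (p - 1) by rewrite powR_gt0.
rewrite le_eqVlt; apply/orP; left; apply/eqP; field.
by rewrite !gt_eqF.
Qed.

End Classes.

(** * Extrapolation *)

Section PointwiseBounds.
Context {R : realType}.
Implicit Types (a b g s p : R).

Lemma powR_add_le a b p : 0 <= a -> 0 <= b -> 0 < p ->
  (a + b) `^ p <= 2 `^ p * (a `^ p + b `^ p).
Proof.
move=> a0 b0 p0; wlog ab : a b a0 b0 / a <= b.
  by move=> h; have [/h|/ltW/h] := leP a b; [exact|rewrite addrC (addrC (a `^ p)); exact].
apply: (@le_trans _ _ (2 `^ p * b `^ p)).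
  rewrite -powRM//; apply: ge0_ler_powR; rewrite ?nnegrE ?(ltW p0) ?addr_ge0 ?mulr_ge0//.
  by rewrite mulr_natl mulr2n lerD2r.
by rewrite ler_pM2l ?powR_gt0// lerDr powR_ge0.
Qed.

(** The first term dominates where [g <= v1], the second where [g > v1]. *)
Lemma mul_le_factored (v1 v2 : R) g p : 1 <= p -> 0 < v1 -> 0 <= v2 -> 0 <= g ->
  g * v2 <= v1 * v2 + g `^ p * (v1 `^ (1 - p) * v2).
Proof.
move=> p1 v10 v20 g0; have [gv|vg] := leP g v1.
  apply: (@le_trans _ _ (v1 * v2)); first by rewrite ler_wpM2r.
  by rewrite lerDl !mulr_ge0 ?powR_ge0.
have gg : 0 < g by apply: lt_trans vg.
apply: (@le_trans _ _ (g `^ p * (v1 `^ (1 - p) * v2))); last first.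
  by rewrite lerDr mulr_ge0// ltW.
rewrite mulrA ler_wpM2r// -(mulr_powRB1 g0 (lt_le_trans ltr01 p1)) -mulrA.
rewrite ler_peMr// -(opprB p) powRN ler_pdivlMr ?powR_gt0// mul1r.
by apply: ge0_ler_powR; rewrite ?nnegrE ?subr_ge0 ?(ltW v10) ?(ltW vg).
Qed.

(** A form of Young's inequality that needs no optimisation: the product is
   bounded by whichever of the two terms dominates. *)
Lemma mul_le_young (v1 v2 w s p : R) : 1 < p -> 0 < v1 -> 0 < v2 -> 0 < w -> 0 < s ->
  v1 * v2 <= s * (v1 `^ p * w) +
    s `^ (1 - conj_exp p) * (v2 `^ conj_exp p * w `^ (1 - conj_exp p)).
Proof.
move=> p1 v10 v20 w0 s0; have q1 := conj_exp_gt1 p1.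
have p0 : 0 < p by apply: lt_trans p1.
have p10 : 0 < p - 1 by rewrite subr_gt0.
set q := conj_exp p in q1 *; have q0 : 0 < q by apply: lt_trans q1.
have q10 : 0 < q - 1 by rewrite subr_gt0.
have [h|h] := leP v2 (s * v1 `^ (p - 1) * w).
  apply: (@le_trans _ _ (s * (v1 `^ p * w))).
    rewrite -(mulr_powRB1 (ltW v10) p0).
    by apply: (le_trans (ler_wpM2l (ltW v10) h)); rewrite le_eqVlt; apply/orP; left; apply/eqP; ring.
  by rewrite lerDl !mulr_ge0 ?powR_ge0.
apply: (@le_trans _ _ (s `^ (1 - q) * (v2 `^ q * w `^ (1 - q)))); last first.
  by rewrite lerDr !mulr_ge0 ?powR_ge0// ltW.
have sw0 : 0 < s * w by rewrite mulr_gt0.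
have : v1 <= (v2 / (s * w)) `^ (q - 1).
  have v1E : v1 = (v1 `^ (p - 1)) `^ (q - 1).
    by rewrite -powRrM conj_expB1// divff ?gt_eqF// powRr1// ltW.
  rewrite {1}v1E; apply: ge0_ler_powR; rewrite ?nnegrE ?powR_ge0 ?(ltW q10)//.
    by rewrite divr_ge0 ?(ltW v20) ?(ltW sw0).
  rewrite ler_pdivlMr//; apply: le_trans (ltW h).
  by rewrite le_eqVlt; apply/orP; left; apply/eqP; ring.
move=> /(ler_wpM2r (ltW v20)) /le_trans; apply.
rewrite powRM ?invr_ge0 ?(ltW v20) ?(ltW sw0)// powR_invl ?(ltW sw0)//.
rewrite powRM ?(ltW s0) ?(ltW w0)// -(opprB q 1) !powRN -(mulr_powRB1 (ltW v20) q0).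
rewrite le_eqVlt; apply/orP; left; apply/eqP; field.
by rewrite !gt_eqF ?powR_gt0.
Qed.

Lemma combine_mass_bounds (a b s e : R) (M1 M2 G1 G2 Y Z : \bar R) :
  0 <= a -> 0 <= b -> 0 <= s -> 0 <= e -> (0 <= Y)%E -> (0 <= Z)%E ->
  (M1 <= a%:E * G1)%E -> (G1 <= a%:E * Y)%E ->
  (M2 <= b%:E * G2)%E -> (G2 <= b%:E * Z)%E ->
  (s%:E * M1 + e%:E * M2 <= (a * a + b * b)%:E * (s%:E * Y + e%:E * Z))%E.
Proof.
move=> a0 b0 s0 e0 Y0 Z0 h1 g1 h2 g2.
have A1 : (M1 <= (a * a + b * b)%:E * Y)%E.
  apply: (le_trans h1); apply: (@le_trans _ _ (a%:E * (a%:E * Y))%E).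
    by apply: lee_wpmul2l; rewrite ?lee_fin.
  by rewrite muleA -EFinM; apply: lee_wpmul2r; rewrite // lee_fin lerDl mulr_ge0.
have A2 : (M2 <= (a * a + b * b)%:E * Z)%E.
  apply: (le_trans h2); apply: (@le_trans _ _ (b%:E * (b%:E * Z))%E).
    by apply: lee_wpmul2l; rewrite ?lee_fin.
  by rewrite muleA -EFinM; apply: lee_wpmul2r; rewrite // lee_fin lerDr mulr_ge0.
rewrite ge0_muleDr; [|by rewrite mule_ge0// lee_fin..].
rewrite (muleCA _ s%:E) (muleCA _ e%:E).
by apply: leeD; apply: lee_wpmul2l; rewrite ?lee_fin.
Qed.

End PointwiseBounds.

Section Extrapolation.
Context {R : realType} {n : nat} (n0 : (0 < n)%N).
Implicit Types (x y z : Rn R n) (r s : R) (p K : R) (f g h v w : Rn R n -> R).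
Implicit Types (T : (Rn R n -> R) -> Rn R n -> R).

Definition power_mass p w f : \bar R := mass (fun y => `|f y| `^ p * w y) setT.

Lemma power_mass_ge0 p w f : (forall x, 0 < w x) -> (0 <= power_mass p w f)%E.
Proof. by move=> w0; apply: mass_ge0 => x; rewrite mulr_ge0 ?powR_ge0// ltW. Qed.

Lemma in_LpP p w f : 0 < p -> measurable_fun setT f -> (power_mass p w f < +oo)%E ->
  in_Lp p w f.
Proof. by move=> p0 mf h; split => //; exact: poweR_lty. Qed.

Lemma Apos_class_union p K w f : 1 <= p -> Apos_class p K w ->
  measurable_fun setT f -> (power_mass p w f < +oo)%E -> union_Lp p f.
Proof.
move=> p1 Aw mf h; exists w; first by have [] := Apos_class_Muckenhoupt n0 p1 Aw.
by apply: in_LpP => //; exact: lt_le_trans p1.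
Qed.

(** One constant for all weights with the same bound [K] replaces the monotone
   dependence on the constant of the weight. *)
Definition class_bound p T := forall K, exists2 C : R, 0 <= C &
  forall w f, Apos_class p K w -> measurable_fun setT f -> (power_mass p w f < +oo)%E ->
    (power_mass p w (T f) <= C%:E * power_mass p w f)%E.

Lemma strong_bound_class_bound p T : 1 <= p -> strong_bound p T -> class_bound p T.
Proof.
move=> p1 [phi [phi0 phi_mono] hT] K; have p0 : 0 < p by apply: lt_le_trans p1.
exists (`|phi K| `^ p); first exact: powR_ge0.
move=> w f Aw mf hf; have [Mw /andP[c1 cK]] := Apos_class_Muckenhoupt n0 p1 Aw.
have K1 : 1 <= K by apply: le_trans cK.
have [_ w0 _] := Apos_class_pos_weight Aw.
have := hT w f Mw (in_LpP p0 mf hf); rewrite /Lp_norm -!/(power_mass _ _ _).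
have := power_mass_ge0 p (T f) w0; have := power_mass_ge0 p f w0.
move: (power_mass p w (T f)) (power_mass p w f) => Y X X0 Y0 h.
have hphi : (Y `^ p^-1 <= `|phi K|%:E * X `^ p^-1)%E.
  apply: (le_trans h); apply: lee_wpmul2r; first exact: poweR_ge0.
  by rewrite lee_fin (le_trans (phi_mono _ _ c1 cK))// ler_norm.
have := gt0_ler_poweR (ltW p0) _ _ hphi; rewrite !in_itv/= !leey !andbT.
rewrite poweR_ge0 mule_ge0 ?poweR_ge0 ?lee_fin// => /(_ isT isT).
rewrite poweRM ?poweR_ge0 ?lee_fin// -!poweRrM mulVf ?(gt_eqF p0)//.
by rewrite !poweRe1// poweR_EFin.
Qed.

(** Adding a small multiple of the indicator of a ball makes a function
   non-trivial, so that its maximal function is positive. *)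
Lemma exists_bump p w g (d : R) : 0 < p -> pos_weight w -> measurable_fun setT g ->
  (forall x, 0 <= g x) -> 0 < d ->
  exists G : Rn R n -> R, [/\ measurable_fun setT G, (forall x, g x <= G x),
    (0 < mass G (eball origin 1))%E &
    (mass (fun x => (G x `^ p * w x)%R) setT <=
     (2 `^ p)%:E * (mass (fun x => (g x `^ p * w x)%R) setT + d%:E))%E].
Proof.
move=> p0 pw mg g0 d0; have [mw w0 _] := pw.
pose B : set (Rn R n) := eball origin 1.
have mB : measurable B by exact: measurable_eball.
have W0 := bmass_gt0 (origin : Rn R n) n0 pw ltr01.
set e := (d / bmass w origin 1) `^ p^-1.
have e0 : 0 < e by rewrite powR_gt0// divr_gt0.
have ep : e `^ p = d / bmass w origin 1.
  by rewrite /e -powRrM mulVf ?gt_eqF// powRr1// ltW// divr_gt0.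
pose G x : R := g x + e * \1_B x.
have i0 x : 0 <= \1_B x :> R by rewrite indicE.
have mind : measurable_fun setT (\1_B : Rn R n -> R) by exact: measurable_indic.
have mG : measurable_fun setT G.
  by apply: measurable_funD => //; apply: measurable_funM.
have mpow (k : Rn R n -> R) : measurable_fun setT k ->
    measurable_fun setT (fun x => (k x `^ p * w x)%:E).
  move=> mk; apply/measurable_EFinP; apply: measurable_funM => //.
  exact: (measurableT_comp (measurable_powR _)).
have pow0 (k : Rn R n -> R) x : (0 <= (k x `^ p * w x)%:E)%E.
  by rewrite lee_fin mulr_ge0 ?powR_ge0// ltW.
exists G; split => //.
- by move=> x; rewrite lerDl mulr_ge0// ltW.
- apply: (@lt_le_trans _ _ (\int[leb n]_(y in B) e%:E)%E).
    by rewrite integral_cst_eball// lte_fin mulr_gt0// vol_gt0.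
  apply: ge0_le_integral => //.
  + by move=> x _; rewrite lee_fin ltW.
  + exact/measurable_funTS/measurable_EFinP.
  + by move=> x Bx; rewrite /G indicE mem_set// mulr1 lee_fin lerDr.
apply: (@le_trans _ _ (\int[leb n]_x ((2 `^ p)%:E *
    ((g x `^ p * w x)%:E + ((e * \1_B x) `^ p * w x)%:E)))%E).
  apply: ge0_le_integral => //.
  - exact: mpow.
  - apply: measurable_funeM; apply: emeasurable_funD; first exact: mpow.
    by apply: mpow; exact: measurable_funM.
  move=> x _; rewrite -EFinD -EFinM lee_fin -mulrDl mulrA ler_wpM2r ?(ltW (w0 x))//.
  by apply: powR_add_le => //; rewrite mulr_ge0// ltW.
have mgw := mpow g mg; have meB : measurable_fun setT (fun x => ((e * \1_B x) `^ p * w x)%:E).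
  by apply: mpow; exact: measurable_funM.
rewrite ge0_integralZl_EFin ?powR_ge0//; last 2 first.
- by move=> x _; exact: adde_ge0 (pow0 g x) (pow0 (fun z => e * \1_B z) x).
- exact: emeasurable_funD.
apply: lee_wpmul2l; first by rewrite lee_fin powR_ge0.
rewrite ge0_integralD//; last by move=> x _; exact: (pow0 (fun x => e * \1_B x)).
apply: leeD2l.
rewrite (eq_integral (fun x => (d / bmass w origin 1)%:E * ((w x)%:E * (\1_B x)%:E))%E); last first.
  move=> x _; rewrite -ep -!EFinM indicE; case: (x \in B); first by rewrite !mulr1.
  by rewrite !mulr0 powR0 ?gt_eqF// mul0r.
rewrite ge0_integralZl_EFin//; last 3 first.
- by move=> x _; rewrite -EFinM lee_fin mulr_ge0// ltW.
- by apply/measurable_EFinP; exact: measurable_funM.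
- by rewrite divr_ge0 ?(ltW d0) ?(ltW W0).
by rewrite -mass_mkcond bmassE// -EFinM lee_fin divfK// gt_eqF.
Qed.

Lemma measurable_power_weight p f w : measurable_fun setT f -> measurable_fun setT w ->
  measurable_fun setT (fun x => (f x `^ p * w x)%:E).
Proof.
move=> mf mw; apply/measurable_EFinP; apply: measurable_funM => //.
exact: (measurableT_comp (measurable_powR _)).
Qed.

(** Rubio de Francia extrapolation in bilinear form. The majorants [v1] of
   [|f|] and [v2] of [h w] given by the algorithm in the two dual spaces
   produce one weight [v1^(1-p0) v2] of the class [A_p0] in which both [f] and
   [T f] are controlled by the integral of [v1 v2]. *)
Lemma extrapolation_bilinear p0 p K T : 1 <= p0 -> acts_on p0 T -> class_bound p0 T ->
  1 < p -> 0 < K -> exists2 C : R, 0 < C &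
  forall w f h (s d : R), Ap_pos p K w -> measurable_fun setT f ->
    measurable_fun setT h -> (forall x, 0 <= h x) ->
    (power_mass p w f < +oo)%E ->
    (mass (fun x => h x `^ conj_exp p * w x)%R setT < +oo)%E -> 0 < s -> 0 < d ->
  union_Lp p0 f /\
  (mass (fun x => `|T f x| * (h x * w x))%R setT <=
   C%:E * (s%:E * (power_mass p w f + d%:E) +
     (s `^ (1 - conj_exp p))%:E *
       (mass (fun x => (h x `^ conj_exp p * w x)%R) setT + d%:E)))%E.
Proof.
move=> p01 hact hcl p1 K0; set q := conj_exp p.
have q1 : 1 < q := conj_exp_gt1 p1.
have p_gt0 : 0 < p by apply: lt_trans p1.
have q_gt0 : 0 < q by apply: lt_trans q1.
have [c1 c10 rdf1] := rubio_de_francia n0 p1 K0.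
have [c2 c20 rdf2] := rubio_de_francia n0 q1 (powR_gt0 (q - 1) K0).
have [C0 C00 hC] := hcl (c1 `^ (p0 - 1) * c2).
pose D := (2 `^ p * 2 `^ p) + (2 `^ q * 2 `^ q) : R.
have D0 : 0 < D by rewrite addr_gt0// mulr_gt0 ?powR_gt0.
exists ((1 + C0) * D); first by rewrite mulr_gt0// ltr_wpDr.
move=> w f h s d Aw mf mh h0 ffin hfin s0 d0.
have [pw psg _] := Aw; have [mw w0 _] := pw; have [msg sg0 _] := psg.
have Asg := Ap_pos_dual n0 p1 Aw.
have mabs : measurable_fun setT (fun x => `|f x|).
  exact: (measurableT_comp (@normr_measurable _ _)).
have mhw : measurable_fun setT (fun x => h x * w x) by exact: measurable_funM.
have hw0 x : 0 <= h x * w x by rewrite mulr_ge0// ltW.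
have dualE : mass (fun x => (h x * w x) `^ q * dual_weight p w x) setT =
    mass (fun x => h x `^ q * w x) setT.
  apply: eq_integral => x _; congr EFin; rewrite powRM ?(ltW (w0 x))// -mulrA; congr (_ * _).
  rewrite /dual_weight -powRD; last by rewrite (gt_eqF (w0 x)) implybT.
  by rewrite addrC subrK powRr1// ltW.
have [F1 [mF1 fF1 F1pos F1le]] := exists_bump p_gt0 pw mabs (fun x => normr_ge0 _) d0.
have [F2 [mF2 hF2 F2pos F2le]] := exists_bump q_gt0 psg mhw hw0 d0.
rewrite dualE in F2le.
set X := mass (fun x => h x `^ q * w x) setT in hfin F2le *.
have X0 : (0 <= X)%E by apply: mass_ge0 => x; rewrite mulr_ge0 ?powR_ge0// ltW.
clearbody X.
rewrite -/(power_mass p w f) in F1le.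
have fin2 (a : R) (Y Z : \bar R) : (0 <= a)%R ->
    (Z < +oo -> Y <= a%:E * (Z + d%:E) -> Y < +oo)%E.
  move=> a0 Zfin /le_lt_trans; apply.
  apply: lte_mul_pinfty; rewrite ?lee_fin//.
  by apply: lte_add_pinfty; rewrite ?ltry.
have [v1 [A1v1 Fv1 v1le]] := rdf1 w F1 Aw mF1
  (fun x => le_trans (normr_ge0 _) (fF1 x)) (fin2 _ _ _ (powR_ge0 2 p) ffin F1le) F1pos.
have [v2 [A1v2 Fv2 v2le]] := rdf2 (dual_weight p w) F2 Asg mF2
  (fun x => le_trans (hw0 x) (hF2 x)) (fin2 _ _ _ (powR_ge0 2 q) hfin F2le) F2pos.
have [[mv1 v1_gt0 _] _] := A1v1; have [[mv2 v2_gt0 _] _] := A1v2.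
pose W x := v1 x `^ (1 - p0) * v2 x.
have AW : Apos_class p0 (c1 `^ (p0 - 1) * c2) W by exact: factored_weight.
have [mW W0 _] := Apos_class_pos_weight AW.
have mv12 : measurable_fun setT (fun x => (v1 x * v2 x)%:E).
  by apply/measurable_EFinP; exact: measurable_funM.
have v12_ge0 x : (0 <= (v1 x * v2 x)%:E)%E by rewrite lee_fin mulr_ge0// ltW.
have powf0 (a : R) (k u : Rn R n -> R) x : (forall y, 0 < u y) ->
    (0 <= (k x `^ a * u x)%:E)%E.
  by move=> u0; rewrite lee_fin mulr_ge0 ?powR_ge0// ltW.
pose J := mass (fun x => v1 x * v2 x) setT.
have J0 : (0 <= J)%E by apply: integral_ge0.
pose E := (s%:E * (power_mass p w f + d%:E) + (s `^ (1 - q))%:E * (X + d%:E))%E.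
have P0 : (0 <= power_mass p w f)%E by exact: power_mass_ge0.
have d0' : (0 <= d%:E)%E by rewrite lee_fin ltW.
have Pd0 : (0 <= power_mass p w f + d%:E)%E by exact: adde_ge0.
have Xd0 : (0 <= X + d%:E)%E by exact: adde_ge0.
have hJ : (J <= D%:E * E)%E.
  apply: (@le_trans _ _ (s%:E * mass (fun x => v1 x `^ p * w x)%R setT +
     (s `^ (1 - q))%:E * mass (fun x => v2 x `^ q * dual_weight p w x)%R setT)%E).
    have m1 := measurable_power_weight p mv1 mw.
    have m2 := measurable_power_weight q mv2 msg.
    rewrite /mass -!ge0_integralZl_EFin ?powR_ge0 ?(ltW s0)//; last 2 first.
    - by move=> x _; exact: powf0.
    - by move=> x _; exact: powf0.
    rewrite -ge0_integralD//; last 4 first.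
    - by move=> x _; rewrite mule_ge0 ?powf0// lee_fin ltW.
    - exact: measurable_funeM.
    - by move=> x _; rewrite mule_ge0 ?powf0// lee_fin powR_ge0.
    - exact: measurable_funeM.
    apply: ge0_le_integral => //.
    - by apply: emeasurable_funD; exact: measurable_funeM.
    by move=> x _; rewrite -!EFinM -EFinD lee_fin; exact: mul_le_young.
  apply: (combine_mass_bounds _ _ _ _ Pd0 Xd0 v1le F1le v2le F2le).
  - exact: powR_ge0.
  - exact: powR_ge0.
  - exact: ltW.
  - exact: powR_ge0.
have Jfin : (J < +oo)%E.
  apply: (le_lt_trans hJ); apply: lte_mul_pinfty; rewrite ?lee_fin ?(ltW D0)//.
  apply: lte_add_pinfty; apply: lte_mul_pinfty; rewrite ?lee_fin ?powR_ge0 ?(ltW s0)//;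
  by apply: lte_add_pinfty; rewrite ?ltry.
have mTf0 := hact f.
have fW : (power_mass p0 W f <= J)%E.
  apply: ge0_le_integral => //.
  - by move=> x _; exact: (powf0 p0 (fun y => `|f y|)).
  - exact: measurable_power_weight.
  move=> x _; rewrite lee_fin /W mulrA ler_wpM2r ?(ltW (v2_gt0 x))//.
  apply: (@le_trans _ _ (v1 x `^ p0 * v1 x `^ (1 - p0))).
    rewrite ler_wpM2r ?powR_ge0//; apply: ge0_ler_powR.
    - exact: le_trans p01.
    - by rewrite nnegrE.
    - by rewrite nnegrE ltW.
    - exact: le_trans (fF1 x) (Fv1 x).
  rewrite -powRD; last by rewrite (gt_eqF (v1_gt0 x)) implybT.
  by rewrite addrC subrK powRr1// ltW.
have fWfin : (power_mass p0 W f < +oo)%E by exact: le_lt_trans fW Jfin.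
have hU : union_Lp p0 f by exact: Apos_class_union AW mf fWfin.
split => //; have mTf : measurable_fun setT (T f) by exact: hact.
have mabsT : measurable_fun setT (fun x => `|T f x|).
  exact: (measurableT_comp (@normr_measurable _ _)).
apply: (@le_trans _ _ (J + power_mass p0 W (T f))%E).
  rewrite /J /power_mass /mass -ge0_integralD//; last 2 first.
  - by move=> x _; exact: (powf0 p0 (fun y => `|T f y|)).
  - exact: measurable_power_weight.
  apply: ge0_le_integral => //.
  - by move=> x _; rewrite lee_fin mulr_ge0.
  - by apply/measurable_EFinP; exact: measurable_funM.
  - by apply: emeasurable_funD => //; exact: measurable_power_weight.
  move=> x _; rewrite -EFinD lee_fin.
  apply: (@le_trans _ _ (`|T f x| * v2 x)).
    by rewrite ler_wpM2l//; exact: le_trans (hF2 x) (Fv2 x).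
  by apply: mul_le_factored => //; exact: ltW.
apply: (@le_trans _ _ (J + C0%:E * J)%E).
  apply: leeD2l; apply: (le_trans (hC W f AW mf fWfin)).
  by apply: lee_wpmul2l; rewrite ?lee_fin.
have -> : (J + C0%:E * J = (1 + C0)%:E * J)%E.
  by rewrite EFinD ge0_muleDl ?lee_fin// mul1e.
rewrite EFinM -muleA; apply: lee_wpmul2l => //.
by rewrite lee_fin addr_ge0.
Qed.

(** Rubio de Francia extrapolation. Testing the bilinear form with
   [h = g_N^(p-1)], where [g_N] is [|T f|] truncated in size and in space,
   bounds the integral of [g_N^p w], which is finite, by a multiple of itself
   that the free parameter [s] makes equal to one half. *)
Theorem extrapolation p0 p K T : 1 <= p0 -> acts_on p0 T -> class_bound p0 T ->
  1 < p -> 0 < K -> exists2 C : R, 0 <= C &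
  forall w f, Ap_pos p K w -> measurable_fun setT f -> (power_mass p w f < +oo)%E ->
  union_Lp p0 f /\ (power_mass p w (T f) <= C%:E * power_mass p w f)%E.
Proof.
move=> p01 hact hcl p1 K0.
have [C C0 hC] := extrapolation_bilinear p01 hact hcl p1 K0.
have q1 := conj_exp_gt1 p1; set q := conj_exp p in hC q1.
have p_gt0 : 0 < p by apply: lt_trans p1.
have p10 : 0 < p - 1 by rewrite subr_gt0.
have C20 : 0 < 2 * C by rewrite mulr_gt0.
pose s := (2 * C) `^ (p - 1); have s0 : 0 < s by rewrite powR_gt0.
have sq : s `^ (1 - q) = (2 * C)^-1.
  rewrite /s -powRrM (_ : (p - 1) * (1 - q) = -1) ?powR_inv1 ?(ltW C20)//.
  by rewrite /q /conj_exp; field; rewrite subr_eq0 gt_eqF.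
clearbody s.
exists (2 * C * s); first exact: ltW (mulr_gt0 C20 s0).
move=> w f Aw mf ffin; have [pw _ _] := Aw; have [mw w0 wfin] := pw.
have hU : union_Lp p0 f.
  pose z0 : Rn R n -> R := fun=> 0.
  have mz : measurable_fun setT z0 by exact: measurable_cst.
  have zfin : (mass (fun x => z0 x `^ q * w x)%R setT < +oo)%E.
    rewrite /mass integral0_eq ?ltry// => x _.
    by rewrite powR0 ?mul0r// gt_eqF// (lt_trans ltr01 q1).
  by have [] := hC w f z0 1 1 Aw mf mz (fun=> lexx 0) ffin zfin ltr01 ltr01.
split => //; have mTf : measurable_fun setT (T f) by exact: hact.
have mabsT : measurable_fun setT (fun x => `|T f x|).
  exact: (measurableT_comp (@normr_measurable _ _)).
pose B N : set (Rn R n) := eball origin N.+1%:R.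
pose g N x : R := Num.min `|T f x| N%:R * \1_(B N) x.
have mB N : measurable (B N) by exact: measurable_eball.
have i01 N x : 0 <= (\1_(B N) x : R) <= 1.
  by rewrite indicE; case: (_ \in _); rewrite lexx ler01.
have g0 N x : 0 <= g N x.
  by rewrite mulr_ge0 ?le_min ?normr_ge0 ?ler0n//; case/andP: (i01 N x).
have gT N x : g N x <= `|T f x|.
  rewrite /g; apply: (@le_trans _ _ (Num.min `|T f x| N%:R)).
    by rewrite ler_piMr ?le_min ?normr_ge0 ?ler0n//; case/andP: (i01 N x).
  by rewrite ge_min lexx.
have mg N : measurable_fun setT (g N).
  apply: measurable_funM; last exact: measurable_indic.
  exact: measurable_minr.
have mgp N := measurable_power_weight p (mg N) mw.
have gp0 N x : (0 <= (g N x `^ p * w x)%:E)%E.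
  by rewrite lee_fin mulr_ge0 ?powR_ge0// ltW.
have gfin N : (mass (fun x => g N x `^ p * w x)%R setT < +oo)%E.
  apply: (@le_lt_trans _ _ (\int[leb n]_x ((N%:R `^ p)%:E * ((w x)%:E * (\1_(B N) x)%:E)))%E).
    have mwB : measurable_fun setT (fun x => ((w x)%:E * (\1_(B N) x)%:E)%E).
      by apply: emeasurable_funM; apply/measurable_EFinP => //; exact: measurable_indic.
    apply: ge0_le_integral => //; first exact: measurable_funeM.
    move=> x _; rewrite -!EFinM lee_fin /g indicE; case: (x \in B N).
      rewrite !mulr1 ler_wpM2r ?(ltW (w0 x))//; apply: ge0_ler_powR.
      - exact: ltW.
      - by rewrite nnegrE le_min normr_ge0 ler0n.
      - by rewrite nnegrE.
      - by rewrite ge_min lexx orbT.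
    by rewrite !mulr0 powR0 ?mul0r// gt_eqF.
  rewrite ge0_integralZl_EFin ?powR_ge0//; last 2 first.
  - by move=> x _; rewrite -EFinM lee_fin mulr_ge0 ?(ltW (w0 x)).
  - by apply: emeasurable_funM; apply/measurable_EFinP => //; exact: measurable_indic.
  rewrite -mass_mkcond bmassE//.
  by rewrite -EFinM ltry.
have bound N : (mass (fun x => g N x `^ p * w x)%R setT <=
    (2 * C * s)%:E * power_mass p w f)%E.
  have hX : mass (fun x => (g N x `^ (p - 1)) `^ q * w x)%R setT =
      mass (fun x => g N x `^ p * w x)%R setT.
    by apply: eq_integral => x _; rewrite -powRrM conj_expM.
  have key d : 0 < d -> (mass (fun x => g N x `^ p * w x)%R setT <=
      C%:E * (s%:E * (power_mass p w f + d%:E) +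
      ((2 * C)^-1)%:E * (mass (fun x => g N x `^ p * w x)%R setT + d%:E)))%E.
    move=> d0; have mh : measurable_fun setT (fun x => g N x `^ (p - 1)).
      exact: (measurableT_comp (measurable_powR _)).
    have := hC w f (fun x => g N x `^ (p - 1)) s d Aw mf mh (fun x => powR_ge0 _ _) ffin.
    rewrite sq hX => /(_ (gfin N) s0 d0)[_]; apply: le_trans.
    have mTw : measurable_fun setT (fun x => (`|T f x| * (g N x `^ (p - 1) * w x))%:E).
      by apply/measurable_EFinP; exact: measurable_funM mabsT (measurable_funM mh mw).
    have le x : g N x `^ p * w x <= `|T f x| * (g N x `^ (p - 1) * w x).
      rewrite -(mulr_powRB1 (g0 N x) p_gt0) -mulrA; apply: ler_wpM2r; last exact: gT.
      by apply: mulr_ge0; [exact: powR_ge0|exact: ltW].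
    apply: ge0_le_integral.
    - exact: measurableT.
    - by move=> x _; exact: gp0.
    - exact: mgp.
    - exact: mTw.
    - by move=> x _; rewrite lee_fin; exact: le.
  have X0 : (0 <= mass (fun x => g N x `^ p * w x)%R setT)%E.
    by apply: integral_ge0 => x _; exact: gp0.
  move: (gfin N) X0 key (power_mass_ge0 p f w0) ffin.
  move: (mass _ setT) (power_mass p w f) => [b||] [a||]// _ _ key _ _.
  rewrite -EFinM lee_fin.
  apply/ler_addgt0Pr => e e0.
  have c0 : 0 < 2 * C * s + 1 := addr_gt0 (mulr_gt0 C20 s0) ltr01.
  have [d d0 ->] : exists2 d : R, 0 < d & e = d * (2 * C * s + 1).
    exists (e / (2 * C * s + 1)); first exact: divr_gt0.
    by rewrite divfK ?(lt0r_neq0 c0).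
  have h : b <= C * (s * (a + d) + (2 * C)^-1 * (b + d)).
    by rewrite -lee_fin; exact: key.
  have : b <= C * (s * (a + d)) + (b + d) / 2.
    apply: (le_trans h); rewrite le_eqVlt; apply/orP; left; apply/eqP.
    by field; rewrite gt_eqF.
  lra.
have ndg x : nondecreasing_seq (fun N => (g N x `^ p * w x)%:E).
  move=> N M NM; rewrite lee_fin ler_wpM2r ?(ltW (w0 x))//; apply: ge0_ler_powR.
  - exact: ltW.
  - by rewrite nnegrE.
  - by rewrite nnegrE.
  rewrite /g; apply: ler_pM.
  - by rewrite le_min normr_ge0 ler0n.
  - by case/andP: (i01 N x).
  - by rewrite le_min !ge_min lexx/= ler_nat NM orbT.
  rewrite !indicE; have [xN|//] := boolP (x \in B N).
  rewrite (_ : x \in B M)//; apply/mem_set; move/set_mem: xN; rewrite /B !eballE.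
  by move=> /lt_le_trans; apply; rewrite ler_nat.
have lim x : (g N x `^ p * w x)%:E @[N --> \oo] --> (`|T f x| `^ p * w x)%:E.
  apply: cvg_near_cst; near=> N; congr EFin; congr (_ `^ p * w x).
  rewrite /g indicE mem_set; last first.
    rewrite /B eballE; apply: (@lt_trans _ _ N%:R); last by rewrite ltr_nat.
    by near: N; exact: nbhs_infty_gtr.
  by rewrite mulr1; apply/min_idPl; near: N; exact: nbhs_infty_ger.
rewrite /power_mass {1}/mass.
rewrite (eq_integral (fun x => limn (fun N => (g N x `^ p * w x)%:E))); last first.
  by move=> x _; apply/esym/cvg_lim => //; exact: lim.
rewrite monotone_convergence//; apply: lime_le.
  by apply: ereal_nondecreasing_is_cvgn => N M NM; apply: ge0_le_integral => // x _; exact: ndg.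
by apply: nearW => N; exact: bound.
Unshelve. all: by end_near. Qed.

End Extrapolation.

(** * Dyadic shells and power weights *)

Section Shells.
Context {R : realType} {n : nat} (n0 : (0 < n)%N).
Implicit Types (x y z : Rn R n) (r s t a N : R) (F G w u : Rn R n -> R).

(** The common part of all shell decompositions: on its shell, [G] is at most
   [c k * F], and the contributions of the shells decay geometrically. *)
Lemma mass_le_geometric F G (c : nat -> R) (B : nat -> set (Rn R n)) (A t : R) :
  measurable_fun setT F -> measurable_fun setT G ->
  (forall y, 0 <= F y) -> (forall y, 0 <= G y) -> (forall k, 0 <= c k) ->
  (forall k, measurable (B k)) -> 0 <= t < 1 ->
  {ae leb n, forall y, G y = 0 \/ exists2 k, B k y & G y <= c k * F y} ->
  (forall k, ((c k)%:E * mass F (B k) <= (A * t ^+ k)%:E)%E) ->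
  (mass G setT <= (A / (1 - t))%:E)%E.
Proof.
move=> mF mG F0 G0 c0 mB t01 hG hA.
have mEF : measurable_fun setT (EFin \o F) by exact/measurable_EFinP.
pose h k y : \bar R := ((c k)%:E * ((F y)%:E * (\1_(B k) y)%:E))%E.
have h0 k y : (0 <= h k y)%E.
  by rewrite /h !mule_ge0 ?lee_fin// indicE.
have mh k : measurable_fun setT (h k).
  apply: measurable_funeM; apply: emeasurable_funM => //.
  by apply/measurable_EFinP; exact: measurable_indic.
apply: (@le_trans _ _ (\int[leb n]_y \sum_(k <oo) h k y)%E).
  apply: ae_ge0_le_integral => //.
  - by move=> y _; rewrite lee_fin.
  - exact/measurable_EFinP.
  - by move=> y _; apply: nneseries_ge0 => k _ _.
  - by apply: ge0_emeasurable_sum.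
  move: hG; apply: filterS => y [-> _|[k Bk hk] _].
    by apply: nneseries_ge0 => k _ _.
  apply: le_trans (le_nneseries_term k (h0 ^~ y)).
  by rewrite /h indicE mem_set// mule1 -EFinM lee_fin.
rewrite integral_nneseries//.
have hE k : (\int[leb n]_y h k y = (c k)%:E * mass F (B k))%E.
  rewrite ge0_integralZl_EFin//.
  - by rewrite -mass_mkcond.
  - by move=> y _; rewrite mule_ge0 ?lee_fin// indicE.
  - apply: emeasurable_funM => //.
    by apply/measurable_EFinP; exact: measurable_indic.
apply: (@le_trans _ _ (\sum_(k <oo) (t ^+ k)%:E * A%:E)%E).
  apply: lee_nneseries => [k _ _|k _]; first exact: integral_ge0.
  by rewrite hE; apply: (le_trans (hA k)); rewrite -EFinM mulrC.
have A0 : 0 <= A.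
  have := hA 0%N; rewrite expr0 mulr1 -lee_fin; apply: le_trans.
  by rewrite mule_ge0 ?lee_fin ?mass_ge0.
apply: (le_trans (nneseries_geometric_le t01 (fun=> _) (fun=> lexx A%:E))).
  by rewrite lee_fin.
by rewrite -EFinM mulrC.
Qed.

Lemma edist_gt0 z y : y <> z -> 0 < edist z y.
Proof.
move=> yz; rewrite lt0r edist_ge0 andbT; apply/eqP => e0; apply: yz.
apply/eq_from_tnth => i; apply/eqP; rewrite -subr_eq0 -normr_eq0 eq_le normr_ge0 andbT.
by rewrite distrC -e0 coord_le_edist.
Qed.

Lemma measurable_point z : measurable [set z].
Proof.
rewrite (_ : [set z] = \bigcap_k eball z (k.+1%:R^-1)).
  by apply: bigcapT_measurable => k; exact: measurable_eball.
apply/seteqP; split=> [y -> k _|y h]; first by apply: eball_center; rewrite invr_gt0.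
apply: contrapT => /edist_gt0 d0.
have := h (Num.truncn (edist z y)^-1) Logic.I; rewrite eballE; apply/negP; rewrite -leNgt.
by rewrite invf_ple ?posrE// ltW// truncnS_gt.
Qed.

Lemma leb_point z : leb n [set z] = 0%E.
Proof.
apply/eqP; rewrite eq_le measure_ge0 andbT; apply/lee_addgt0Pr => e e0; rewrite add0e.
pose r := Num.min 1 (e / vol_ub R n).
have r0 : 0 < r by rewrite lt_min ltr01 divr_gt0// vol_ub_gt0.
apply: (@le_trans _ _ (leb n (eball z r))).
  apply: le_measure; rewrite ?inE; [exact: measurable_point|exact: measurable_eball|].
  by move=> y ->; exact: eball_center.
rewrite vol_fin// lee_fin; apply: (le_trans (vol_le z r0)).
rewrite mulrC -ler_pdivlMr ?vol_ub_gt0//.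
have r1 : r <= 1 by rewrite ge_min lexx.
apply: (@le_trans _ _ r); last by rewrite ge_min lexx orbT.
by case: (n) n0 => // m _; rewrite exprS ler_piMr ?(ltW r0)// exprn_ile1// ltW.
Qed.

Lemma powR_expr (b e : R) k : 0 <= b -> (b ^+ k) `^ e = (b `^ e) ^+ k.
Proof. by move=> b0; rewrite -(powR_mulrn _ (powR_ge0 _ _)) -(powR_mulrn _ b0) powRAC. Qed.

Lemma half_powR_lt1 (e : R) : 0 < e -> 0 <= 2^-1 `^ e < 1.
Proof.
move=> e0; rewrite powR_ge0/=.
have : 2^-1 `^ e < 1 `^ e :> R.
  by apply: gt0_ltr_powR => //; rewrite ?nnegrE ?invr_ge0// invf_lt1// ltr1n.
by rewrite powR1.
Qed.

Lemma dyadic_shell (e b : R) : 0 < e -> e < b ->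
  exists2 k, 2^-1 * (2^-1 ^+ k * b) <= e & e < 2^-1 ^+ k * b.
Proof.
move=> e0 eb; have b0 : 0 < b by apply: lt_trans eb.
have half k : 0 < 2^-1 ^+ k :> R by rewrite exprn_gt0// invr_gt0.
have [m bm] : exists m, b <= e * 2 ^+ m.
  exists (Num.truncn (b / e)).+1; rewrite mulrC -ler_pdivrMr//.
  apply: (le_trans (ltW (truncnS_gt _))).
  by rewrite -natrX ler_nat ltnW// ltn_expl.
have [j _ /andP[j1 j2]] := dyadic_bracket eb bm.
exists j.
  by rewrite mulrA -exprS exprVn ler_pdivrMl ?exprn_gt0// mulrC.
by rewrite exprVn ltr_pdivlMl ?exprn_gt0// mulrC.
Qed.

(** Smallness of the integrals of [|y - z|^a F] forces decay of those of [F]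
   away from [z]: on a ball far from [z] the factor is comparable to a
   constant, and a ball near [z] is cut into dyadic shells around [z]. *)
Lemma mass_remove_power (a lam : R) : 0 <= a -> a = 0 \/ a < lam ->
  exists2 C : R, 0 < C & forall N z F, 0 <= N -> measurable_fun setT F ->
  (forall y, 0 <= F y) ->
  (forall x r, 0 < r ->
    (mass (fun y => edist z y `^ a * F y)%R (eball x r) <= (N * r `^ lam)%:E)%E) ->
  forall x s, 0 < s ->
    (mass F (eball x s) <= (C * N * s `^ lam * (edist z x + s) `^ (- a))%:E)%E.
Proof.
move=> + [->|al].
  move=> _; exists 1 => // N z F _ mF F0 h x s s0.
  rewrite oppr0 powRr0 mul1r mulr1; have := h x s s0.
  rewrite (_ : (fun y => _) = F)//; apply/funext => y; by rewrite powRr0 mul1r.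
rewrite le_eqVlt => /predU1P[a0|a0].
  exists 1 => // N z F _ mF F0 h x s s0.
  rewrite -a0 oppr0 powRr0 mul1r mulr1; have := h x s s0.
  rewrite (_ : (fun y => _) = F)//; apply/funext => y; by rewrite -a0 powRr0 mul1r.
have la0 : 0 < lam - a by rewrite subr_gt0.
set t := 2^-1 `^ (lam - a); have t01 : 0 <= t < 1 by exact: half_powR_lt1.
have t1 : 0 < 1 - t by rewrite subr_gt0; case/andP: t01.
set C2 := 3 `^ lam * 2 `^ a / (1 - t).
have C20 : 0 < C2 by rewrite divr_gt0// mulr_gt0 ?powR_gt0.
exists (3 `^ a + C2); first by rewrite addr_gt0// powR_gt0.
move=> N z F N0 mF F0 h x s s0.
have mda : measurable_fun setT (fun y => edist z y `^ a * F y).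
  apply: measurable_funM => //.
  exact: (measurableT_comp (measurable_powR _) (measurable_edist z)).
have mB y r := measurable_eball (y : Rn R n) r.
set d := edist z x; have d0 : 0 <= d by exact: edist_ge0.
have ds0 : 0 < d + s by rewrite ltr_wpDl.
have sl0 : 0 <= s `^ lam by exact: powR_ge0.
have [far|near] := leP (2 * s) d.
  apply: (@le_trans _ _ (3 `^ a * N * s `^ lam * (d + s) `^ (- a))%:E); last first.
    rewrite lee_fin; apply: ler_wpM2r; first exact: powR_ge0.
    by do 2 (apply: ler_wpM2r => //); rewrite lerDl ltW.
  pose c := 3 `^ a * (d + s) `^ (- a).
  have c0 : 0 <= c by rewrite mulr_ge0 ?powR_ge0.
  apply: (@le_trans _ _ (c%:E * mass (fun y => edist z y `^ a * F y)%R (eball x s))%E).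
    rewrite /mass -ge0_integralZl_EFin//; last 2 first.
    - by move=> y _; rewrite lee_fin mulr_ge0 ?powR_ge0.
    - exact/measurable_funTS/measurable_EFinP.
    apply: ge0_le_integral => //.
    - by move=> y _; rewrite lee_fin.
    - exact/measurable_funTS/measurable_EFinP.
    - by apply: measurable_funeM; exact/measurable_funTS/measurable_EFinP.
    move=> y xy; rewrite -EFinM lee_fin mulrA ler_peMl//.
    have dy : (d + s) / 3 <= edist z y.
      have := edist_triangle z y x; rewrite -/d (edistC y x).
      by move: xy; rewrite eballE; lra.
    rewrite /c mulrAC -powRM ?edist_ge0// powRN ler_pdivlMr ?powR_gt0// mul1r.
    apply: ge0_ler_powR; rewrite ?nnegrE ?(ltW a0) ?(ltW ds0) ?mulr_ge0 ?edist_ge0//.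
    by rewrite mulrC -ler_pdivrMr.
  apply: (le_trans (lee_wpmul2l _ (h x s s0))); first by rewrite lee_fin.
  by rewrite -EFinM lee_fin /c le_eqVlt; apply/orP; left; apply/eqP; ring.
apply: (@le_trans _ _ (C2 * N * s `^ lam * (d + s) `^ (- a))%:E); last first.
  rewrite lee_fin; apply: ler_wpM2r; first exact: powR_ge0.
  by do 2 (apply: ler_wpM2r => //); rewrite lerDr powR_ge0.
have s30 : 0 < 3 * s by rewrite mulr_gt0.
pose S : set (Rn R n) := eball z (3 * s).
pose rad k := 2^-1 ^+ k * (3 * s).
have rad0 k : 0 < rad k by rewrite mulr_gt0// exprn_gt0// invr_gt0.
pose c k := (2^-1 * rad k) `^ (- a).
have mi : measurable_fun setT (\1_S : Rn R n -> R) by exact: measurable_indic (mB _ _).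
apply: (@le_trans _ _ (mass (fun y => F y * \1_S y)%R setT)).
  have -> : mass (fun y => F y * \1_S y)%R setT = mass F S.
    by rewrite [RHS]mass_mkcond; apply: eq_integral => y _; rewrite EFinM.
  apply: ge0_subset_integral => //; first exact: mB.
  - exact/measurable_funTS/measurable_EFinP.
  - by move=> y _; rewrite lee_fin.
  - by apply: sub_eball; rewrite -/d; lra.
pose A := N * (3 * s) `^ (lam - a) * 2 `^ a.
apply: (@le_trans _ _ (A / (1 - t))%:E); last first.
  have -> : A / (1 - t) = C2 * N * s `^ lam * (3 * s) `^ (- a).
    rewrite /A /C2 powRD; last by rewrite (gt_eqF s30) implybT.
    by rewrite powRM// ?(ltW s0)//; ring.
  rewrite lee_fin; apply: ler_wpM2l; first exact: mulr_ge0 (mulr_ge0 (ltW C20) N0) sl0.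
  rewrite !powRN lef_pV2 ?posrE ?powR_gt0//; apply: ge0_ler_powR.
  - exact: ltW.
  - by rewrite nnegrE ltW.
  - by rewrite nnegrE ltW.
  - by lra.
apply: (@mass_le_geometric (fun y => edist z y `^ a * F y) _ c (fun k => eball z (rad k))) => //.
- exact: measurable_funM.
- by move=> y; rewrite mulr_ge0 ?powR_ge0.
- by move=> y; rewrite mulr_ge0// indicE.
- by move=> k; exact: powR_ge0.
- exists [set z]; split; [exact: measurable_point|exact: leb_point|].
  move=> y /=; apply: contra_notP => yz.
  have [ys|ys] := pselect (S y); last by left; rewrite indicE memNset// mulr0.
  right; have y0 : 0 < edist z y by exact: edist_gt0.
  have [k kS ky] := dyadic_shell y0 ys.
  exists k; first exact: ky.
  rewrite indicE mem_set// mulr1 mulrA ler_peMl//.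
  have i0 : 0 < 2^-1 * rad k by rewrite mulr_gt0// invr_gt0.
  rewrite /c powRN -powR_invl ?(ltW i0)//.
  rewrite -powRM ?invr_ge0 ?(ltW i0) ?edist_ge0//.
  apply: (@le_trans _ _ (1 `^ a)); first by rewrite powR1.
  apply: ge0_ler_powR.
  - exact: ltW.
  - by rewrite nnegrE.
  - by rewrite nnegrE; apply: mulr_ge0; [rewrite invr_ge0; exact: ltW|exact: edist_ge0].
  - by rewrite ler_pdivlMl// mulr1.
move=> k; apply: (le_trans (lee_wpmul2l _ (h z (rad k) (rad0 k)))).
  by rewrite lee_fin powR_ge0.
rewrite -EFinM lee_fin le_eqVlt; apply/orP; left; apply/eqP.
have rk := rad0 k.
have -> : c k = 2 `^ a * rad k `^ (- a).
  rewrite /c powRM ?invr_ge0 ?(ltW rk)//; congr (_ * _).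
  by rewrite powRN powR_invl// invrK.
have e : rad k `^ lam * rad k `^ (- a) = t ^+ k * (3 * s) `^ (lam - a).
  rewrite -powRD; last by rewrite (gt_eqF rk) implybT.
  by rewrite /rad [LHS]powRM ?exprn_ge0 ?invr_ge0 ?(ltW s30)// powR_expr ?invr_ge0.
transitivity (N * 2 `^ a * (t ^+ k * (3 * s) `^ (lam - a))); last by rewrite /A; ring.
by rewrite -e; ring.
Qed.

(** A profile adapted to [eball z r]: comparable to 1 on that ball and
   decreasing like the power [-a] of the distance. *)
Definition bump_weight a z r : Rn R n -> R := fun y => (1 + edist z y / r) `^ (- a).

Lemma measurable_bump_weight a z r : measurable_fun setT (bump_weight a z r).
Proof.
apply: (measurableT_comp (measurable_powR _)); apply: measurable_funD => //.
by apply: measurable_funM => //; exact: measurable_edist.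
Qed.

Lemma bump_weight_gt0 a z r y : 0 < r -> 0 < bump_weight a z r y.
Proof. by move=> r0; rewrite powR_gt0// ltr_wpDr// divr_ge0 ?edist_ge0// ltW. Qed.

Lemma powRN_anti (a b e : R) : 0 < a -> a <= b -> 0 <= e -> b `^ (- e) <= a `^ (- e).
Proof.
move=> a0 ab e0; have b0 : 0 < b by apply: lt_le_trans ab.
rewrite !powRN lef_pV2 ?posrE ?powR_gt0//.
by apply: ge0_ler_powR; rewrite ?nnegrE ?(ltW a0) ?(ltW b0).
Qed.

(** On the shell of radius [2^k r] the bump weight is of order [2^(-k a)] while
   [F] has mass of order [2^(k lam)]. *)
Lemma mass_bump_weight_le (a lam : R) : 0 <= a -> lam < a ->
  exists2 C : R, 0 < C & forall N z r F, 0 <= N -> 0 < r -> measurable_fun setT F ->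
  (forall y, 0 <= F y) ->
  (forall s, r <= s -> (mass F (eball z s) <= (N * s `^ lam)%:E)%E) ->
  (mass (fun y => F y * bump_weight a z r y)%R setT <= (C * N * r `^ lam)%:E)%E.
Proof.
move=> a0 la; have la0 : 0 < a - lam by rewrite subr_gt0.
set t := 2^-1 `^ (a - lam); have t01 : 0 <= t < 1 by exact: half_powR_lt1.
have t1 : 0 < 1 - t by rewrite subr_gt0; case/andP: t01.
exists (4 `^ a / (1 - t)); first by rewrite divr_gt0// powR_gt0.
move=> N z r F N0 r0 mF F0 h.
have rk0 k : 0 < 2 ^+ k * r by rewrite mulr_gt0// exprn_gt0.
have -> : 4 `^ a / (1 - t) * N * r `^ lam = 4 `^ a * N * r `^ lam / (1 - t) by ring.
pose c k := 4 `^ a * (2 ^+ k) `^ (- a).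
have c0 k : 0 <= c k by rewrite mulr_ge0 ?powR_ge0.
have mu := measurable_bump_weight a z r.
apply: (@mass_le_geometric F _ c (fun k => eball z (2 ^+ k * r))) => //.
- exact: measurable_funM.
- by move=> y; rewrite mulr_ge0// ltW// bump_weight_gt0.
- by move=> k; exact: measurable_eball.
- apply: aeW => y; right.
  have [yr|ry] := ltP (edist z y) r.
    exists 0%N; first by rewrite eballE expr0 mul1r.
    rewrite mulrC ler_wpM2r// /c expr0 powR1 mulr1.
    apply: (@le_trans _ _ 1).
      apply: (@le_trans _ _ (1 `^ (- a))); last by rewrite powR1.
      apply: powRN_anti => //.
      by rewrite lerDl divr_ge0 ?edist_ge0// ltW.
    by rewrite -[leLHS](powRr0 4) ler_powR// ler1n.
  have [m ym] : exists m, edist z y < 2^-1 * r * 2 ^+ m.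
    exists (Num.truncn (edist z y / (2^-1 * r))).+1.
    rewrite mulrC -ltr_pdivrMr ?mulr_gt0 ?invr_gt0//.
    apply: (lt_le_trans (truncnS_gt _)).
    by rewrite -natrX ler_nat ltnW// ltn_expl.
  have sr : 2^-1 * r < edist z y by apply: lt_le_trans ry; rewrite gtr_pMl// invf_lt1// ltr1n.
  have [j _ /andP[j1 j2]] := dyadic_bracket sr (ltW ym).
  have e2 : 2^-1 * r * 2 ^+ j.+1 = 2 ^+ j * r by rewrite exprS; field.
  exists j.+1; first by rewrite eballE exprS; rewrite e2 in j2; have := rk0 j; lra.
  rewrite mulrC ler_wpM2r// /c.
  have p2 : 0 < 4^-1 * 2 ^+ j.+1 :> R by rewrite mulr_gt0 ?invr_gt0 ?exprn_gt0.
  have -> : 4 `^ a * (2 ^+ j.+1) `^ (- a) = (4^-1 * 2 ^+ j.+1) `^ (- a) :> R.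
    rewrite [RHS]powRM ?invr_ge0 ?exprn_ge0//; congr (_ * _).
    by rewrite powR_invl// powRN invrK.
  apply: powRN_anti => //.
  apply: (@le_trans _ _ (edist z y / r)); last by rewrite lerDr.
  by rewrite ler_pdivlMr// exprS; apply: ltW; move: j1; lra.
move=> k.
have hk : (mass F (eball z (2 ^+ k * r)) <= (N * (2 ^+ k * r) `^ lam)%:E)%E.
  by apply: h; rewrite ler_peMl ?(ltW r0)// exprn_ege1// ler1n.
apply: (le_trans (lee_wpmul2l _ hk)); first by rewrite lee_fin.
rewrite -EFinM lee_fin /c le_eqVlt; apply/orP; left; apply/eqP.
have p2 : 0 < 2 ^+ k :> R by rewrite exprn_gt0.
have e : (2 ^+ k) `^ (- a) * (2 ^+ k) `^ lam = t ^+ k.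
  rewrite -powRD; last by rewrite (gt_eqF p2) implybT.
  rewrite powR_expr// /t powR_invl// -powRN; congr (_ `^ _ ^+ _); ring.
rewrite powRM ?(ltW p2) ?(ltW r0)// -e; ring.
Qed.

(** For negative [g] this is [mass_remove_power] for the powers [-g] and [n],
   because [|y - z|^(-g) |y - z|^g = 1]. *)
Lemma mass_power_le (g : R) : - n%:R < g -> exists2 C : R, 0 < C &
  forall z x s, 0 < s ->
  (mass (fun y => edist z y `^ g)%R (eball x s) <=
   (C * vol x s * (edist z x + s) `^ g)%:E)%E.
Proof.
move=> gn; have mB x s := measurable_eball (x : Rn R n) s.
have mpow e z : measurable_fun setT (fun y => edist z y `^ e).
  exact: (measurableT_comp (measurable_powR _) (measurable_edist z)).
have [g0|g0] := leP 0 g.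
  exists 1 => // z x s s0; rewrite mul1r mulrC.
  have h := integral_cst_eball ((edist z x + s) `^ g) x s0; rewrite -h.
  apply: ge0_le_integral => //.
  - by move=> y _; rewrite lee_fin powR_ge0.
  - by apply/measurable_funTS/measurable_EFinP; exact: mpow.
  move=> y xy; rewrite lee_fin; apply: ge0_ler_powR => //.
  - by rewrite nnegrE edist_ge0.
  - by rewrite nnegrE addr_ge0 ?edist_ge0// ltW.
  apply: (le_trans (edist_triangle z x y)); rewrite lerD2l.
  by move: xy; rewrite eballE => /ltW.
have Ng0 : 0 < - g by rewrite oppr_gt0.
have gn' : - g < n%:R by rewrite ltrNl.
have [C C0 hC] := mass_remove_power (ltW Ng0) (or_intror gn').
exists (C * (vol_ub R n / vol_lb R n)).
  by rewrite mulr_gt0// divr_gt0 ?vol_ub_gt0 ?vol_lb_gt0.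
move=> z x s s0.
have h y r : 0 < r -> (mass (fun y => edist z y `^ (- g) * edist z y `^ g)%R (eball y r) <=
    (vol_ub R n * r `^ n%:R)%:E)%E.
  move=> r0; apply: (@le_trans _ _ (vol y r)%:E); last first.
    by rewrite lee_fin powR_mulrn ?(ltW r0)// vol_le.
  rewrite -(mul1r (vol y r)) -integral_cst_eball//; apply: ge0_le_integral => //.
  - by move=> x' _; rewrite lee_fin mulr_ge0 ?powR_ge0.
  - by apply/measurable_funTS/measurable_EFinP; apply: measurable_funM.
  move=> x' _; rewrite lee_fin.
  have [->|d0] := eqVneq (edist z x') 0.
    by rewrite powR0 ?mul0r// gt_eqF.
  by rewrite -powRD ?addNr ?powRr0// d0 implybT.
apply: (le_trans (hC _ z _ (ltW vol_ub_gt0) (mpow g z) (fun y => powR_ge0 _ _) h x s s0)).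
rewrite lee_fin opprK powR_mulrn ?(ltW s0)//.
apply: ler_wpM2r; first exact: powR_ge0.
rewrite -!mulrA ler_pM2l// ler_pM2l ?vol_ub_gt0// mulrC.
by rewrite ler_pdivlMr ?vol_lb_gt0// mulrC vol_ge.
Qed.

(** The power [b < n] of a bump weight satisfies an [A_1] condition with a
   constant independent of its centre and scale: at small distances the weight
   is bounded by 1, at large distances by a power of the distance. *)
Lemma mass_bump_power_le (b : R) : 0 <= b -> b < n%:R -> exists2 C : R, 0 < C &
  forall z r x s, 0 < r -> 0 < s ->
  (mass (fun y => bump_weight b z r y) (eball x s) <=
   (C * vol x s * (1 + (edist z x + s) / r) `^ (- b))%:E)%E.
Proof.
move=> b0 bn; have nb : - n%:R < - b by rewrite ltrN2.
have [C C0 hC] := mass_power_le nb.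
exists ((1 + C) * 2 `^ b); first by rewrite mulr_gt0 ?powR_gt0// addr_gt0.
move=> z r x s r0 s0; have V0 := vol_gt0 x n0 s0.
have mB := measurable_eball x s.
set m := edist z x + s; have m0 : 0 < m by rewrite ltr_wpDl// edist_ge0.
have mr0 : 0 < m / r by rewrite divr_gt0.
set L := (1 + m / r) `^ (- b).
have [mr|rm] := leP m r.
  apply: (@le_trans _ _ (vol x s)%:E).
    rewrite -(mul1r (vol x s)) -integral_cst_eball//; apply: ge0_le_integral => //.
    - by move=> y _; rewrite lee_fin ltW// bump_weight_gt0.
    - by apply/measurable_funTS/measurable_EFinP; exact: measurable_bump_weight.
    move=> y _; rewrite lee_fin /bump_weight.
    apply: (@le_trans _ _ (1 `^ (- b))); last by rewrite powR1.
    by apply: powRN_anti => //; rewrite lerDl divr_ge0 ?edist_ge0// ltW.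
  have L2 : 2 `^ (- b) <= L.
    apply: powRN_anti => //; first by rewrite addr_gt0.
    by have : m / r <= 1 by [rewrite ler_pdivrMr// mul1r]; lra.
  have p2 : 0 < 2 `^ b :> R by rewrite powR_gt0.
  rewrite lee_fin mulrAC ler_peMl ?(ltW V0)//.
  apply: (@le_trans _ _ (2 `^ b * L)).
    by rewrite -ler_pdivrMl// mulr1 -powRN.
  by rewrite ler_wpM2r ?powR_ge0// ler_peMl ?(ltW p2)// lerDl ltW.
pose c := r `^ b.
have mp : measurable_fun setT (fun y => edist z y `^ (- b)).
  exact: (measurableT_comp (measurable_powR _) (measurable_edist z)).
apply: (@le_trans _ _ (c%:E * mass (fun y => edist z y `^ (- b))%R (eball x s))%E).
  rewrite /mass -ge0_integralZl_EFin ?powR_ge0//; last 2 first.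
  - by move=> y _; rewrite lee_fin powR_ge0.
  - exact/measurable_funTS/measurable_EFinP.
  apply: ae_ge0_le_integral => //.
  - by move=> y _; rewrite lee_fin ltW// bump_weight_gt0.
  - by apply/measurable_funTS/measurable_EFinP; exact: measurable_bump_weight.
  - by move=> y _; rewrite mule_ge0 ?lee_fin ?powR_ge0.
  - by apply: measurable_funeM; exact/measurable_funTS/measurable_EFinP.
  exists [set z]; split; [exact: measurable_point|exact: leb_point|].
  move=> y /=; apply: contra_notP => yz _; rewrite -EFinM lee_fin.
  have d0 : 0 < edist z y by exact: edist_gt0.
  have -> : c * edist z y `^ (- b) = (edist z y / r) `^ (- b).
    rewrite powRM ?invr_ge0 ?(ltW d0) ?(ltW r0)// (powR_invl (- b)) ?(ltW r0)//.
    by rewrite (powRN r) invrK mulrC.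
  apply: powRN_anti => //; first by rewrite divr_gt0.
  by rewrite lerDr.
apply: (le_trans (lee_wpmul2l _ (hC z x s s0))); first by rewrite lee_fin powR_ge0.
rewrite -EFinM lee_fin -/m.
have -> : c * (C * vol x s * m `^ (- b)) = C * vol x s * (m / r) `^ (- b).
  rewrite (powRM (- b)) ?invr_ge0 ?(ltW m0) ?(ltW r0)// (powR_invl (- b)) ?(ltW r0)//.
  by rewrite (powRN r) invrK /c; ring.
have h2 : (m / r) `^ (- b) <= 2 `^ b * L.
  have -> : 2 `^ b * L = ((1 + m / r) / 2) `^ (- b).
    rewrite (powRM (- b)) ?invr_ge0 ?addr_ge0 ?(ltW mr0)// (powR_invl (- b))//.
    by rewrite (powRN 2) invrK mulrC.
  apply: powRN_anti => //; first by rewrite divr_gt0// addr_gt0.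
  have : 1 < m / r by rewrite ltr_pdivlMr// mul1r.
  by lra.
apply: (@le_trans _ _ (C * vol x s * (2 `^ b * L))).
  by rewrite ler_pM2l// mulr_gt0.
have -> : (1 + C) * 2 `^ b * vol x s * L = (1 + C) * vol x s * (2 `^ b * L) by ring.
rewrite ler_wpM2r ?mulr_ge0 ?powR_ge0// ler_wpM2r ?(ltW V0)//.
by rewrite lerDr.
Qed.

End Shells.

(** * Localization of Morrey norms *)

Section Localization.
Context {R : realType} {n : nat} (n0 : (0 < n)%N).
Implicit Types (x y z : Rn R n) (r s t a N : R) (f g w u : Rn R n -> R).

(** The weighted average of [u] enters the first factor of the [A_p] product
   and its lower bound enters the second one, through a negative power, so that
   the two cancel. *)
Lemma Apos_class_mul p K C w u : 1 <= p -> 0 < C -> Apos_class p K w ->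
  measurable_fun setT u -> (forall y, 0 < u y) ->
  (forall x r, 0 < r -> exists L, [/\ 0 < L, (forall y, eball x r y -> L <= u y) &
    (mass (fun y => w y * u y)%R (eball x r) <= (C * L * bmass w x r)%:E)%E]) ->
  Apos_class p (C * K) (fun y => w y * u y).
Proof.
move=> p1 C0 Aw mu u0 h; have pw := Apos_class_pos_weight Aw.
have [mw w0 _] := pw; set W := fun y => _.
have W0 y : 0 < W y by rewrite mulr_gt0.
have pW : pos_weight W.
  split => //; first exact: measurable_funM.
  by move=> x r r0; have [L [_ _ hL]] := h x r r0; apply: le_lt_trans hL (ltry _).
move: p1 Aw; rewrite le_eqVlt => /predU1P[<-|p1].
  rewrite /Apos_class eqxx => -[_ hA]; split => // x r r0.
  have [L [L0 hL hm]] := h x r r0.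
  move: (hA x r r0); apply: filterS => y hy By.
  rewrite bmassE// lee_fin in hm; apply: (le_trans hm).
  have -> : C * K * vol x r * W y = C * u y * (K * vol x r * w y) by rewrite /W; ring.
  apply: ler_pM.
  - by rewrite mulr_ge0// ltW.
  - by rewrite ltW// bmass_gt0.
  - by rewrite ler_pM2l//; exact: hL.
  - exact: hy.
rewrite !Apos_classP// => -[_ ps hA].
set e := 1 - conj_exp p.
have e0 : e <= 0 by rewrite subr_le0 ltW// conj_exp_gt1.
have sE : dual_weight p W = fun y => u y `^ e * dual_weight p w y.
  apply/funext => y; rewrite /dual_weight /W powRM ?(ltW (w0 y)) ?(ltW (u0 y))//.
  by rewrite mulrC.
have hs x r L : 0 < r -> 0 < L -> (forall y, eball x r y -> L <= u y) ->
    (mass (dual_weight p W) (eball x r) <= (L `^ e * bmass (dual_weight p w) x r)%:E)%E.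
  move=> r0 L0 hL; rewrite sE; apply: mass_mul_le => //; rewrite ?powR_ge0//.
  - exact: (measurableT_comp (measurable_powR _)).
  - by move=> y; rewrite powR_ge0.
  apply: aeW => y By; rewrite -(opprK e); apply: powRN_anti => //; last by rewrite oppr_ge0.
  exact: hL.
have pdW : pos_weight (dual_weight p W).
  split.
  - by case: pW => mW _ _; exact: (measurableT_comp (measurable_powR _)).
  - by move=> y; rewrite powR_gt0.
  move=> x r r0; have [L [L0 hL _]] := h x r r0.
  exact: le_lt_trans (hs x r L r0 L0 hL) (ltry _).
split => // x r r0; have [L [L0 hL hm]] := h x r r0.
have := hs x r L r0 L0 hL; move: hm; rewrite !bmassE// !lee_fin.
have := bmass_gt0 x n0 ps r0; have := bmass_gt0 x n0 pw r0.
have := bmass_gt0 x n0 pdW r0; have := bmass_gt0 x n0 pW r0; move: (hA x r r0).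
move: (vol x r) (bmass W x r) (bmass (dual_weight p W) x r) (bmass w x r)
  (bmass (dual_weight p w) x r) => V m t m1 t1 hV m0 t0 m10 t10 hm ht.
have p10 : 0 < p - 1 by rewrite subr_gt0.
have ht' : t `^ (p - 1) <= L^-1 * t1 `^ (p - 1).
  move: ht => /(@ge0_ler_powR _ (p - 1) (ltW p10)); rewrite !nnegrE (ltW t0).
  rewrite mulr_ge0 ?powR_ge0 ?(ltW t10)// => /(_ isT isT).
  rewrite powRM ?powR_ge0 ?(ltW t10)// -powRrM.
  rewrite (_ : e * (p - 1) = -1) ?powR_inv1 ?(ltW L0)//.
  by rewrite /e /conj_exp; field; rewrite subr_eq0 gt_eqF.
apply: (le_trans (ler_pM (ltW m0) (powR_ge0 _ _) hm ht')).
have -> : C * L * m1 * (L^-1 * t1 `^ (p - 1)) = C * (m1 * t1 `^ (p - 1)).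
  by field; rewrite gt_eqF.
by rewrite -mulrA ler_pM2l.
Qed.

(** The reverse Hoelder inequality makes [w] and a bump weight essentially
   independent on every ball, so the mean of the product is the product of the
   means. *)
Lemma mass_mul_bump_le (sigma c a : R) w : 1 < sigma -> pos_weight w ->
  (forall x r, 0 < r ->
    (average (fun y => w y `^ sigma)%R (eball x r) `^ sigma^-1 <=
     c%:E * average w (eball x r))%E) ->
  0 <= a -> a < n%:R / conj_exp sigma -> exists2 C : R, 0 < C &
  forall z r x s, 0 < r -> 0 < s ->
  (mass (fun y => w y * bump_weight a z r y)%R (eball x s) <=
   (C * (1 + (edist z x + s) / r) `^ (- a) * bmass w x s)%:E)%E.
Proof.
move=> sg1 pw hRH a0 an; set q := conj_exp sigma in an.
have q1 : 1 < q := conj_exp_gt1 sg1.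
have q0 : 0 < q by apply: lt_trans q1.
have sg0 : 0 < sigma by apply: lt_trans sg1.
have aq : a * q < n%:R by rewrite -ltr_pdivlMr.
have [C1 C10 hC1] := mass_bump_power_le n0 (mulr_ge0 a0 (ltW q0)) aq.
exists ((`|c| + 1) * C1 `^ q^-1); first by rewrite mulr_gt0 ?powR_gt0// ltr_wpDl.
move=> z r x s r0 s0; have [mw w0 _] := pw.
have mb := measurable_bump_weight a z r; have b0 y := bump_weight_gt0 a z y r0.
have V0 := vol_gt0 x n0 s0; have W0 := bmass_gt0 x n0 pw s0.
set L := 1 + (edist z x + s) / r.
have L0 : 0 < L by rewrite addr_gt0// divr_gt0// ltr_wpDl// edist_ge0.
have hh : (mass (fun y => w y * bump_weight a z r y)%R (eball x s) <=
    mass (fun y => w y `^ sigma)%R (eball x s) `^ sigma^-1 *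
    mass (fun y => bump_weight a z r y `^ q)%R (eball x s) `^ q^-1)%E.
  exact: (hoelder_on _ (measurable_eball x s) mw mb (fun y => ltW (w0 y))
    (fun y => ltW (b0 y)) sg0 q0 (conj_expE sg1)).
apply: (le_trans hh).
have h1 : (mass (fun y => w y `^ sigma)%R (eball x s) `^ sigma^-1 <=
    (c * (bmass w x s / vol x s) * vol x s `^ sigma^-1)%:E)%E.
  have := hRH x s s0; rewrite (average_pos x pw s0) /average -/(vol x s).
  rewrite poweRM ?lee_fin ?invr_ge0 ?(ltW V0)//; last first.
    by apply: mass_ge0 => y; rewrite powR_ge0.
  rewrite poweR_EFin powR_invl ?(ltW V0)// -EFinM.
  by rewrite lee_pdivrMr ?powR_gt0// EFinM.
have h2 : (mass (fun y => bump_weight a z r y `^ q)%R (eball x s) `^ q^-1 <=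
    ((C1 * vol x s) `^ q^-1 * L `^ (- a))%:E)%E.
  have -> : (fun y => bump_weight a z r y `^ q) = bump_weight (a * q) z r.
    by apply/funext => y; rewrite /bump_weight -powRrM mulNr.
  have hb : (0 <= mass (bump_weight (a * q) z r) (eball x s))%E.
    by apply: mass_ge0 => y; rewrite ltW// bump_weight_gt0.
  apply: (@le_trans _ _ ((C1 * vol x s * L `^ (- (a * q)))%:E `^ q^-1)%E).
    apply: gt0_ler_poweR.
    - by rewrite invr_ge0 ltW.
    - by rewrite in_itv/= leey andbT.
    - by rewrite in_itv/= leey andbT lee_fin !mulr_ge0 ?powR_ge0// ltW.
    - exact: hC1.
  rewrite poweR_EFin powRM ?powR_ge0 ?mulr_ge0 ?(ltW C10) ?(ltW V0)// -powRrM.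
  by rewrite mulNr -mulrA divff ?mulr1 ?(gt_eqF q0).
apply: (le_trans (lee_pmul (poweR_ge0 _ _) (poweR_ge0 _ _) h1 h2)).
rewrite -EFinM lee_fin powRM ?(ltW C10) ?(ltW V0)//.
have VV : vol x s `^ sigma^-1 * vol x s `^ q^-1 = vol x s.
  rewrite -powRD; last by rewrite (gt_eqF V0) implybT.
  by rewrite conj_expE// powRr1// ltW.
move: VV V0 W0; move: (vol x s) (bmass w x s) => V m VV V0 m0.
have -> : c * (m / V) * V `^ sigma^-1 * (C1 `^ q^-1 * V `^ q^-1 * L `^ (- a)) =
    c * (m / V) * (V `^ sigma^-1 * V `^ q^-1) * C1 `^ q^-1 * L `^ (- a) by ring.
rewrite VV.
have -> : c * (m / V) * V * C1 `^ q^-1 * L `^ (- a) = c * (C1 `^ q^-1 * L `^ (- a) * m).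
  by field; rewrite gt_eqF.
rewrite -!mulrA ler_wpM2r//; last by rewrite (le_trans (ler_norm c))// lerDl.
by rewrite !mulr_ge0 ?powR_ge0// ltW.
Qed.

(** The weight is [(|x| + r)^alpha w] times a bump of exponent [a]: taking
   [a < n / sigma'] keeps it in the class, and taking [a > lam] makes the Morrey
   bounds at the scales [2^k r] summable. The constant factor
   [(|x| + r)^alpha] compensates the decay produced by [mass_remove_power]. *)
Lemma localizing_weight p K (sigma c lam alpha : R) w :
  1 <= p -> Apos_class p K w -> 1 < sigma ->
  (forall x r, 0 < r ->
    (average (fun y => w y `^ sigma)%R (eball x r) `^ sigma^-1 <=
     c%:E * average w (eball x r))%E) ->
  0 <= lam -> lam < n%:R / conj_exp sigma ->
  0 <= alpha -> alpha = 0 \/ alpha < lam ->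
  exists K' C, 0 < C /\ forall x r, 0 < r -> exists W : Rn R n -> R,
  [/\ Apos_class p K' W,
      (forall y, eball x r y -> abs_power alpha y * w y <= C * W y) &
      forall f N, 0 <= N -> measurable_fun setT f ->
        (forall y s, 0 < s -> (mass (fun y => `|f y| `^ p * power_weight alpha w y)%R
            (eball y s) <= (N * s `^ lam)%:E)%E) ->
        (power_mass p W f <= (C * N * r `^ lam)%:E)%E].
Proof.
move=> p1 Aw sg1 hRH lam0 lamn al0 alam; have pw := Apos_class_pos_weight Aw.
have [mw w0 _] := pw.
pose a := (lam + n%:R / conj_exp sigma) / 2.
have la : lam < a by rewrite /a; lra.
have an : a < n%:R / conj_exp sigma by rewrite /a; lra.
have a0 : 0 <= a by rewrite ltW// (le_lt_trans lam0).
have [C1 C10 hC1] := mass_mul_bump_le sg1 pw hRH a0 an.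
have [C2 C20 hC2] := mass_remove_power n0 al0 alam.
have [C3 C30 hC3] := @mass_bump_weight_le R n a lam a0 la.
exists (C1 * K), (2 `^ a + C3 * C2).
split=> [|x r r0]; first by rewrite addr_gt0 ?powR_gt0// mulr_gt0.
pose h := (edist origin x + r) `^ alpha.
have er0 : 0 < edist origin x + r by rewrite ltr_wpDl// edist_ge0.
have h0 : 0 < h by rewrite powR_gt0.
have mb := measurable_bump_weight a x r.
have b0 y := bump_weight_gt0 a x y r0.
exists (fun y => w y * (h * bump_weight a x r y)); split.
- apply: Apos_class_mul => //.
  + by apply: measurable_funM.
  + by move=> y; rewrite mulr_gt0.
  move=> y s s0; exists (h * (1 + (edist x y + s) / r) `^ (- a)); split.
  + by rewrite mulr_gt0// powR_gt0// addr_gt0// divr_gt0// ltr_wpDl// edist_ge0.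
  + move=> y' By; rewrite ler_pM2l//; apply: powRN_anti => //.
      by rewrite ltr_wpDr// divr_ge0 ?edist_ge0// ltW.
    rewrite lerD2l ler_pM2r ?invr_gt0//; apply: (le_trans (edist_triangle x y y')).
    by rewrite lerD2l ltW.
  rewrite (_ : (fun y0 => _) = (fun y' => h * (w y' * bump_weight a x r y'))); last first.
    by apply/funext => y'; ring.
  have mwb : measurable_fun setT (fun y' => (w y' * bump_weight a x r y')%:E).
    by apply/measurable_EFinP; exact: measurable_funM.
  rewrite /mass; under eq_integral do rewrite EFinM.
  rewrite ge0_integralZl_EFin ?(ltW h0)//; last 3 first.
  + exact: measurable_eball.
  + by move=> y' _; rewrite lee_fin mulr_ge0// ltW.
  + exact: measurable_funTS.
  apply: (le_trans (lee_wpmul2l _ (hC1 x r y s r0 s0))); first by rewrite lee_fin ltW.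
  by rewrite -EFinM lee_fin le_eqVlt; apply/orP; left; apply/eqP; ring.
- move=> y By.
  have hy : abs_power alpha y <= h.
    rewrite /abs_power enormE edistC; apply: ge0_ler_powR => //.
    + by rewrite nnegrE edist_ge0.
    + by rewrite nnegrE ltW.
    apply: (le_trans (edist_triangle origin x y)); rewrite lerD2l.
    by move: By; rewrite eballE => /ltW.
  have hb : 2 `^ (- a) <= bump_weight a x r y.
    apply: powRN_anti => //; first by rewrite ltr_wpDr// divr_ge0 ?edist_ge0// ltW.
    have : edist x y / r <= 1 by rewrite ler_pdivrMr// mul1r ltW.
    by lra.
  have p2 : 0 < 2 `^ a :> R by rewrite powR_gt0.
  have hb' : 1 <= (2 `^ a + C3 * C2) * bump_weight a x r y.
    apply: (@le_trans _ _ (2 `^ a * bump_weight a x r y)).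
      by rewrite -ler_pdivrMl// mulr1 -powRN.
    by rewrite ler_pM2r// lerDl ltW// mulr_gt0.
  have -> : (2 `^ a + C3 * C2) * (w y * (h * bump_weight a x r y)) =
      h * w y * ((2 `^ a + C3 * C2) * bump_weight a x r y) by ring.
  apply: (@le_trans _ _ (h * w y)); first by rewrite ler_pM2r.
  by rewrite ler_peMr// ltW// mulr_gt0.
move=> f N N0 mf hf.
pose F y := `|f y| `^ p * w y.
have F0 y : 0 <= F y by rewrite mulr_ge0 ?powR_ge0// ltW.
have mF : measurable_fun setT F.
  apply: measurable_funM => //; apply: (measurableT_comp (measurable_powR _)).
  exact: (measurableT_comp (@normr_measurable _ _)).
have hF y s : 0 < s -> (mass F (eball y s) <=
    (C2 * N * s `^ lam * (edist origin y + s) `^ (- alpha))%:E)%E.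
  move=> s0; apply: (hC2 N origin F N0 mF F0 _ y s s0) => y' s' s'0.
  rewrite (_ : (fun y0 => _) = (fun y => `|f y| `^ p * power_weight alpha w y)).
    exact: hf.
  apply/funext => y0; rewrite /F /power_weight /abs_power enormE edistC; ring.
have hC3' : (mass (fun y => F y * bump_weight a x r y)%R setT <=
    (C3 * (C2 * N * h^-1) * r `^ lam)%:E)%E.
  apply: hC3 => //.
    by rewrite !mulr_ge0 ?invr_ge0// ltW.
  move=> s rs; have s0 : 0 < s by apply: lt_le_trans rs.
  apply: (le_trans (hF x s s0)); rewrite lee_fin -!mulrA ler_pM2l//.
  apply: ler_wpM2l => //; rewrite mulrC; apply: ler_wpM2r; first exact: powR_ge0.
  rewrite /h -powRN; apply: powRN_anti => //.
  by rewrite lerD2l.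
rewrite /power_mass (_ : (fun y => _) = (fun y => h * (F y * bump_weight a x r y))); last first.
  by apply/funext => y; rewrite /F; ring.
rewrite /mass; under eq_integral do rewrite EFinM.
rewrite ge0_integralZl_EFin ?(ltW h0)//; last 2 first.
- by move=> y' _; rewrite lee_fin mulr_ge0// ltW.
- by apply/measurable_EFinP; exact: measurable_funM.
apply: (le_trans (lee_wpmul2l _ hC3')); first by rewrite lee_fin ltW.
rewrite -EFinM lee_fin.
have -> : h * (C3 * (C2 * N * h^-1) * r `^ lam) = C3 * C2 * N * r `^ lam.
  by field; rewrite gt_eqF.
by rewrite -!mulrA mulrA ler_wpM2r ?mulr_ge0 ?powR_ge0// lerDr powR_ge0.
Qed.

End Localization.

Section MorreyBounds.
Context {R : realType} {n : nat} (n0 : (0 < n)%N).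
Implicit Types (x y z : Rn R n) (r s t N : R) (f g u v w : Rn R n -> R).
Implicit Types (T : (Rn R n -> R) -> Rn R n -> R).

Lemma morrey_norm_le p lam u f (N : R) : 0 < p -> (forall y, 0 <= u y) -> 0 <= N ->
  (forall x r, 0 < r ->
    (mass (fun y => `|f y| `^ p * u y)%R (eball x r) <= (N * r `^ lam)%:E)%E) ->
  (morrey_norm p lam u f <= (N `^ p^-1)%:E)%E.
Proof.
move=> p0 u0 N0 h; apply: ge_ereal_sup => _ [x [r [r0 ->]]].
have rl : 0 < r `^ lam by rewrite powR_gt0.
rewrite -poweR_EFin; apply: gt0_ler_poweR.
- by rewrite invr_ge0 ltW.
- rewrite in_itv/= leey andbT mule_ge0 ?lee_fin ?invr_ge0 ?(ltW rl)//.
  by apply: mass_ge0 => y; rewrite mulr_ge0 ?powR_ge0.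
- by rewrite in_itv/= leey andbT lee_fin.
by rewrite lee_pdivrMl// -EFinM mulrC; exact: h.
Qed.

Lemma in_morrey_mass p lam u f : 0 < p -> (forall y, 0 <= u y) ->
  in_morrey p lam u f -> exists N : R, [/\ 0 <= N,
    morrey_norm p lam u f = (N `^ p^-1)%:E &
    forall x r, 0 < r ->
      (mass (fun y => `|f y| `^ p * u y)%R (eball x r) <= (N * r `^ lam)%:E)%E].
Proof.
move=> p0 u0 [mf hfin]; set A := morrey_norm p lam u f in hfin *.
have term x r : 0 < r -> ((((r `^ lam)^-1)%:E *
    mass (fun y => `|f y| `^ p * u y)%R (eball x r)) `^ p^-1 <= A)%E.
  by move=> r0; apply: ereal_sup_ubound; exists x, r.
have A0 : (0 <= A)%E by apply: le_trans (term origin 1 ltr01); exact: poweR_ge0.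
have [M M0 AM] : exists2 M : R, 0 <= M & A = M%:E.
  by exists (fine A); [exact: fine_ge0|rewrite fineK// ge0_fin_numE].
exists (M `^ p); split; first exact: powR_ge0.
  by rewrite AM -powRrM divff ?gt_eqF// powRr1.
move=> x r r0; have rl : 0 < r `^ lam by rewrite powR_gt0.
have m0 : (0 <= mass (fun y => `|f y| `^ p * u y)%R (eball x r))%E.
  by apply: mass_ge0 => y; rewrite mulr_ge0 ?powR_ge0.
have := term x r r0; rewrite AM.
move: (mass _ _) m0 => m m0 /(@gt0_ler_poweR _ p (ltW p0)).
rewrite !in_itv/= !leey !andbT poweR_ge0 lee_fin M0 => /(_ isT isT).
rewrite -poweRrM mulVf ?gt_eqF// poweRe1; last first.
  by rewrite mule_ge0// lee_fin invr_ge0 ltW.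
by rewrite lee_pdivrMl// -EFinM mulrC.
Qed.

Lemma mass_ae_eq g h (A : set (Rn R n)) : measurable A ->
  measurable_fun setT g -> measurable_fun setT h ->
  {ae leb n, forall y, g y = h y} -> mass g A = mass h A.
Proof.
move=> mA mg mh gh; apply: ae_eq_integral => //.
- exact/measurable_funTS/measurable_EFinP.
- exact/measurable_funTS/measurable_EFinP.
- by move: gh; apply: filterS => y ->.
Qed.

Lemma measurable_abs_powR p f : measurable_fun setT f ->
  measurable_fun setT (fun y => `|f y| `^ p).
Proof.
move=> mf; apply: (measurableT_comp (measurable_powR _)).
exact: (measurableT_comp (@normr_measurable _ _)).
Qed.

Lemma morrey_norm_ae_eq p lam u v f : measurable_fun setT f ->
  measurable_fun setT u -> measurable_fun setT v -> {ae leb n, forall y, u y = v y} ->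
  morrey_norm p lam u f = morrey_norm p lam v f.
Proof.
move=> mf mu mv uv.
have e x r : mass (fun y => `|f y| `^ p * u y) (eball x r) =
    mass (fun y => `|f y| `^ p * v y) (eball x r).
  apply: mass_ae_eq; first exact: measurable_eball.
  - by apply: measurable_funM => //; exact: measurable_abs_powR.
  - by apply: measurable_funM => //; exact: measurable_abs_powR.
  - by move: uv; apply: filterS => y ->.
congr ereal_sup; apply/seteqP; split => _ [x [r [r0 ->]]]; exists x, r; (split; first exact: r0).
  by rewrite e.
by rewrite e.
Qed.

Lemma measurable_superlevel f t : measurable_fun setT f -> measurable [set y | t < `|f y|].
Proof.
move=> mf; rewrite (_ : [set y | _] = setT `&` [set y | (t%:E < (`|f y|)%:E)%E]).
  apply: emeasurable_fun_o_infty => //; apply/measurable_EFinP.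
  exact: (measurableT_comp (@normr_measurable _ _)).
by rewrite setTI; apply/seteqP; split=> y /=; rewrite lte_fin.
Qed.

Lemma Muckenhoupt_ae_eq p w v : measurable_fun setT v -> (forall y, 0 < v y) ->
  {ae leb n, forall y, w y = v y} -> Muckenhoupt p w -> Muckenhoupt p v.
Proof.
move=> mv v0 wv [[mw wfin wpos] hA].
have avg (k : R -> R) x r : measurable_fun setT k ->
    average (fun y => k (w y)) (eball x r) = average (fun y => k (v y)) (eball x r).
  move=> mk; congr (_ * _)%E; apply: mass_ae_eq; first exact: measurable_eball.
  - exact: (measurableT_comp mk).
  - exact: (measurableT_comp mk).
  - by move: wv; apply: filterS => y ->.
have avg1 x r : average w (eball x r) = average v (eball x r).
  exact: (avg id x r (@measurable_id _ _ _)).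
split.
  split => //; last exact: aeW.
  move=> x r r0; apply: le_lt_trans (wfin x r r0).
  rewrite le_eqVlt; apply/orP; left; apply/eqP; apply: mass_ae_eq.
  - exact: measurable_eball.
  - exact: (measurableT_comp (@normr_measurable _ _)).
  - exact: (measurableT_comp (@normr_measurable _ _)).
  - by move: wv; apply: filterS => y ->.
have [p1|p1] := eqVneq p 1.
  move: hA; rewrite p1 eqxx => -[c hc].
  exists c => x r r0; have h := hc x r r0; rewrite avg1 in h.
  apply: filterS2 wv h => y wy hy By.
  by rewrite -wy; exact: hy.
move: hA; rewrite /Ap_const (negbTE p1) => h; apply: le_lt_trans h.
apply: ge_ereal_sup => _ [x [r [r0 ->]]]; apply: ereal_sup_ubound; exists x, r; split; first exact: r0.
by rewrite -avg1 -(avg (fun t => t `^ (1 - conj_exp p)) x r (measurable_powR _)).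
Qed.

(** Membership in [union_Lp p0] is part of the conclusion because [T] is only
   constrained on that set of functions. *)
Definition extends_boundedly p0 p T := forall K, exists2 C : R, 0 <= C &
  forall w f, Apos_class p K w -> measurable_fun setT f -> (power_mass p w f < +oo)%E ->
    union_Lp p0 f /\ (power_mass p w (T f) <= C%:E * power_mass p w f)%E.

Lemma extends_boundedlyP p0 p T : 1 <= p0 -> acts_on p0 T -> strong_bound p0 T ->
  1 < p \/ (p = 1 /\ p0 = 1) -> extends_boundedly p0 p T.
Proof.
move=> p01 hact hT hp K; have hcl := strong_bound_class_bound n0 p01 hT.
case: hp => [p1|[-> p0E]]; last first.
  have [C C0 hC] := hcl K; exists C => // w f Aw mf hf; split.
    by rewrite p0E; exact: (Apos_class_union n0 (lexx 1) Aw mf hf).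
  by rewrite p0E in hC; exact: hC.
have [K0|K0] := ltP 0 K.
  have [C C0 hC] := extrapolation n0 p01 hact hcl p1 K0.
  by exists C => // w f; rewrite Apos_classP//; exact: hC.
exists 0 => // w f; rewrite Apos_classP// => Aw.
by have := Ap_pos_const_ge1 n0 p1 Aw; rewrite leNgt (le_lt_trans K0).
Qed.

Section FixedWeight.
Context (p K sigma c lam alpha : R) (w : Rn R n -> R) (p1 : 1 <= p) (Aw : Apos_class p K w) (sg1 : 1 < sigma)
  (hRH : forall x r, 0 < r ->
    (average (fun y => w y `^ sigma)%R (eball x r) `^ sigma^-1 <=
     c%:E * average w (eball x r))%E)
  (lam0 : 0 <= lam) (lamn : lam < n%:R / conj_exp sigma)
  (al0 : 0 <= alpha) (alam : alpha = 0 \/ alpha < lam).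

Let p0 : 0 < p. Proof. exact: lt_le_trans p1. Qed.

Let U0 y : 0 <= power_weight alpha w y.
Proof.
have [_ w0 _] := Apos_class_pos_weight Aw.
by rewrite mulr_ge0 ?powR_ge0// ltW.
Qed.

Lemma measurable_power_weight_abs (v : Rn R n -> R) : measurable_fun setT v ->
  measurable_fun setT (power_weight alpha v).
Proof.
move=> mv; apply: measurable_funM => //; apply: (measurableT_comp (measurable_powR _)).
rewrite (_ : enorm = edist origin); first exact: measurable_edist.
by apply/funext => y; rewrite enormE edistC.
Qed.

(** On each ball the localizing weight dominates the given one, so the Morrey
   norm of [T f] is a supremum of [L^p] norms of [T f] in these weights. *)
Lemma morrey_strong_bound q0 T : acts_on q0 T -> extends_boundedly q0 p T ->
  (forall f, in_morrey p lam (power_weight alpha w) f -> union_Lp q0 f) /\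
  exists C : R, forall f, in_morrey p lam (power_weight alpha w) f ->
    (morrey_norm p lam (power_weight alpha w) (T f) <=
     C%:E * morrey_norm p lam (power_weight alpha w) f)%E.
Proof.
move=> hact hext.
have [K' [C [C0 hW]]] := localizing_weight n0 p1 Aw sg1 hRH lam0 lamn al0 alam.
have [D D0 hD] := hext K'.
have main f : in_morrey p lam (power_weight alpha w) f -> union_Lp q0 f /\
    exists2 N : R, 0 <= N & morrey_norm p lam (power_weight alpha w) f = (N `^ p^-1)%:E /\
    forall x r, 0 < r -> (mass (fun y => `|T f y| `^ p * power_weight alpha w y)%R
      (eball x r) <= (C * D * C * N * r `^ lam)%:E)%E.
  move=> hf; have [mf _] := hf; have [N [N0 NE hN]] := in_morrey_mass p0 U0 hf.
  have hb x r : 0 < r -> union_Lp q0 f /\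
      (mass (fun y => `|T f y| `^ p * power_weight alpha w y)%R
      (eball x r) <= (C * D * C * N * r `^ lam)%:E)%E.
    move=> r0; have [W [AW hdom hnorm]] := hW x r r0.
    have hfW := hnorm f N N0 mf hN.
    have [hU hTW] := hD W f AW mf (le_lt_trans hfW (ltry _)).
    split => //; have mT : measurable_fun setT (T f) by exact: hact.
    have [mW W0 _] := Apos_class_pos_weight AW.
    have [mw w0 _] := Apos_class_pos_weight Aw.
    have mB := measurable_eball x r.
    have mTW : measurable_fun setT (fun y => (`|T f y| `^ p * W y)%:E).
      by apply/measurable_EFinP; apply: measurable_funM => //; exact: measurable_abs_powR.
    apply: (@le_trans _ _ (C%:E * power_mass p W (T f))%E).
      rewrite /power_mass /mass -ge0_integralZl_EFin ?(ltW C0)//; last first.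
        by move=> y _; rewrite lee_fin mulr_ge0 ?powR_ge0// ltW.
      apply: (@le_trans _ _ (\int[leb n]_(y in eball x r)
          (C%:E * (`|T f y| `^ p * W y)%:E))%E).
        apply: ge0_le_integral => //.
        - by move=> y _; rewrite lee_fin mulr_ge0 ?powR_ge0.
        - apply/measurable_funTS/measurable_EFinP; apply: measurable_funM.
            exact: measurable_abs_powR.
          exact: measurable_power_weight_abs.
        - by apply: measurable_funTS; exact: measurable_funeM.
        move=> y By; rewrite -EFinM lee_fin [leRHS]mulrCA.
        by apply: ler_wpM2l; [exact: powR_ge0|exact: hdom].
      apply: ge0_subset_integral => //; first exact: measurable_funeM.
      by move=> y _; rewrite mule_ge0 ?lee_fin ?(ltW C0)// mulr_ge0 ?powR_ge0// ltW.
    apply: (@le_trans _ _ (C%:E * (D%:E * (C * N * r `^ lam)%:E))%E).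
      apply: lee_wpmul2l; first by rewrite lee_fin ltW.
      by apply: (le_trans hTW); apply: lee_wpmul2l; rewrite ?lee_fin.
    by rewrite -!EFinM lee_fin le_eqVlt; apply/orP; left; apply/eqP; ring.
  have [hU _] := hb origin 1 ltr01; split => //; exists N => //; split => // x r r0.
  by have [] := hb x r r0.
split=> [f /main[]//|]; exists ((C * D * C) `^ p^-1) => f /main[_ [N N0 [-> h]]].
have CDC : 0 <= C * D * C by rewrite !mulr_ge0// ltW.
rewrite -EFinM -powRM//; apply: morrey_norm_le => //.
exact: mulr_ge0.
Qed.

End FixedWeight.

End MorreyBounds.

Section WeakBound.
Context {R : realType} {n : nat} (n0 : (0 < n)%N).
Implicit Types (x y z : Rn R n) (r s t N K : R) (f g u v w : Rn R n -> R).
Implicit Types (T : (Rn R n -> R) -> Rn R n -> R).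

Lemma weak_bound_class T K : weak_bound T -> exists2 C : R, 0 <= C &
  forall w f t, Apos_class 1 K w -> measurable_fun setT f -> (power_mass 1 w f < +oo)%E ->
    0 < t -> (t%:E * mass w [set y | (t < `|T f y|)%R]%classic <= C%:E * power_mass 1 w f)%E.
Proof.
move=> [phi [phi0 phi_mono] hT]; exists `|phi K| => // w f t Aw mf hf t0.
have [Mw /andP[c1 cK]] := Apos_class_Muckenhoupt n0 (lexx 1) Aw.
have [_ w0 _] := Apos_class_pos_weight Aw.
have P0 := power_mass_ge0 1 f w0.
have := hT w f Mw (in_LpP ltr01 mf hf); rewrite /Lp_norm -/(power_mass 1 w f) invr1.
rewrite (poweRe1 P0) => h; apply: le_trans (le_trans h _).
  by apply: ereal_sup_ubound; exists t.
apply: lee_wpmul2r => //.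
by rewrite lee_fin (le_trans (phi_mono _ _ c1 cK))// ler_norm.
Qed.

Lemma morrey_weak_bound K (sigma c lam alpha : R) w T :
  Apos_class 1 K w -> 1 < sigma ->
  (forall x r, 0 < r ->
    (average (fun y => w y `^ sigma)%R (eball x r) `^ sigma^-1 <=
     c%:E * average w (eball x r))%E) ->
  0 <= lam -> lam < n%:R / conj_exp sigma ->
  0 <= alpha -> alpha = 0 \/ alpha < lam -> acts_on 1 T -> weak_bound T ->
  (forall f, in_morrey 1 lam (power_weight alpha w) f -> union_Lp 1 f) /\
  exists C : R, forall f, in_morrey 1 lam (power_weight alpha w) f ->
    (weak_morrey_norm 1 lam (power_weight alpha w) (T f) <=
     C%:E * morrey_norm 1 lam (power_weight alpha w) f)%E.
Proof.
move=> Aw sg1 hRH lam0 lamn al0 alam hact hT.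
have [K' [C [C0 hW]]] := localizing_weight n0 (lexx 1) Aw sg1 hRH lam0 lamn al0 alam.
have [D D0 hD] := weak_bound_class K' hT.
have [mw w0 _] := Apos_class_pos_weight Aw.
have U0 y : 0 <= power_weight alpha w y by rewrite mulr_ge0 ?powR_ge0// ltW.
have mU := measurable_power_weight_abs alpha mw.
have hU f : in_morrey 1 lam (power_weight alpha w) f -> union_Lp 1 f.
  move=> hf; have [mf _] := hf; have [N [N0 NE hN]] := in_morrey_mass ltr01 U0 hf.
  have [W [AW _ hnorm]] := hW origin 1 ltr01.
  exact: (Apos_class_union n0 (lexx 1) AW mf (le_lt_trans (hnorm f N N0 mf hN) (ltry _))).
split => //; exists (C * D * C) => f hf; have hUf := hU f hf.
have [mf _] := hf; have [N [N0 -> hN]] := in_morrey_mass ltr01 U0 hf.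
rewrite invr1 powRr1// -EFinM.
apply: ge_ereal_sup => _ [x [r [t [r0 t0 ->]]]].
have [W [AW hdom hnorm]] := hW x r r0.
have hfW := hnorm f N N0 mf hN.
have hTW := hD W f t AW mf (le_lt_trans hfW (ltry _)) t0.
have [mW W0 _] := Apos_class_pos_weight AW.
have mT : measurable_fun setT (T f) by exact: hact.
have mS := measurable_superlevel t mT.
set S := [set y | (t < `|T f y|)%R]%classic in hTW mS *.
have mB := measurable_eball x r.
have mBS : measurable (eball x r `&` S) by exact: measurableI.
have mEW : measurable_fun setT (EFin \o W) by exact/measurable_EFinP.
have hm : (mass (power_weight alpha w) (eball x r `&` S) <= C%:E * mass W S)%E.
  rewrite /mass -ge0_integralZl_EFin ?(ltW C0)//; last 2 first.
  - by move=> y _; rewrite lee_fin ltW.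
  - exact: measurable_funTS.
  apply: (@le_trans _ _ (\int[leb n]_(y in eball x r `&` S) (C%:E * (W y)%:E))%E).
    apply: ge0_le_integral => //.
    - by move=> y _; rewrite lee_fin.
    - exact/measurable_funTS/measurable_EFinP.
    - by apply: measurable_funTS; exact: measurable_funeM.
    by move=> y [By _]; rewrite -EFinM lee_fin; exact: hdom.
  apply: ge0_subset_integral => //.
  - by apply: measurable_funTS; exact: measurable_funeM.
  - by move=> y _; rewrite mule_ge0 ?lee_fin ?(ltW C0)// ltW.
have rl : 0 < r `^ lam by rewrite powR_gt0.
have m0 : (0 <= mass (power_weight alpha w) (eball x r `&` S))%E by exact: mass_ge0.
rewrite invr1 poweRe1; last by rewrite mule_ge0// lee_fin divr_ge0 ?powR_ge0.
have -> : ((t `^ 1 / r `^ lam)%:E = (r `^ lam)^-1%:E * t%:E)%E.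
  by rewrite powRr1 ?(ltW t0)// mulrC EFinM.
rewrite -muleA lee_pdivrMl//.
apply: (@le_trans _ _ (t%:E * (C%:E * mass W S))%E).
  by apply: lee_wpmul2l; rewrite ?lee_fin ?(ltW t0).
rewrite muleCA.
apply: (@le_trans _ _ (C%:E * (D%:E * (C * N * r `^ lam)%:E))%E).
  apply: lee_wpmul2l; first by rewrite lee_fin ltW.
  by apply: (le_trans hTW); apply: lee_wpmul2l; rewrite ?lee_fin.
by rewrite -!EFinM lee_fin le_eqVlt; apply/orP; left; apply/eqP; ring.
Qed.

Lemma weak_morrey_norm_ae_eq p lam u v f : measurable_fun setT f ->
  measurable_fun setT u -> measurable_fun setT v -> {ae leb n, forall y, u y = v y} ->
  weak_morrey_norm p lam u f = weak_morrey_norm p lam v f.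
Proof.
move=> mf mu mv uv.
have e x r t : mass u (eball x r `&` [set y | (t < `|f y|)%R])%classic =
    mass v (eball x r `&` [set y | (t < `|f y|)%R])%classic.
  apply: mass_ae_eq => //.
  by apply: measurableI; [exact: measurable_eball|exact: measurable_superlevel].
congr ereal_sup; apply/seteqP; split => _ [x [r [t [r0 t0 ->]]]]; exists x, r, t;
  (split; [exact: r0|exact: t0|]).
  by rewrite e.
by rewrite e.
Qed.

End WeakBound.

(** * Positive representatives and power weights *)

Section Representatives.
Context {R : realType} {n : nat} (n0 : (0 < n)%N).
Implicit Types (x y z : Rn R n) (r s t N K : R) (f g u v w : Rn R n -> R).

(** A weight is only positive almost everywhere, whereas negative powers and
   pointwise bounds are simpler for functions that vanish nowhere. *)
Definition positive_rep w : Rn R n -> R := fun y => if 0 < w y then w y else 1.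

Lemma positive_rep_gt0 w y : 0 < positive_rep w y.
Proof. by rewrite /positive_rep; case: ifP. Qed.

Lemma measurable_positive_rep w : measurable_fun setT w ->
  measurable_fun setT (positive_rep w).
Proof.
move=> mw; apply: measurable_fun_ifT => //.
by apply: measurable_fun_ltr => //; exact: measurable_cst.
Qed.

Lemma positive_rep_ae w : {ae leb n, forall y, 0 < w y} ->
  {ae leb n, forall y, w y = positive_rep w y}.
Proof. by apply: filterS => y wy; rewrite /positive_rep wy. Qed.

Lemma average_ae_eq g h x r : measurable_fun setT g -> measurable_fun setT h ->
  {ae leb n, forall y, g y = h y} -> average g (eball x r) = average h (eball x r).
Proof.
by move=> mg mh gh; congr (_ * _)%E; apply: mass_ae_eq => //; exact: measurable_eball.
Qed.

(** Everything that the theorem assumes on [w] passes to its positive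
   representative, and everything that it asserts can be read on it. *)
Lemma positive_representative (p sigma alpha : R) w : 1 <= p ->
  Muckenhoupt p w -> reverse_Hoelder sigma w ->
  let v := positive_rep w in
  [/\ exists K, Apos_class p K v,
      exists c : R, forall x r, 0 < r ->
        (average (fun y => v y `^ sigma)%R (eball x r) `^ sigma^-1 <=
         c%:E * average v (eball x r))%E &
      [/\ measurable_fun setT (power_weight alpha w),
        measurable_fun setT (power_weight alpha v) &
        {ae leb n, forall y, power_weight alpha w y = power_weight alpha v y}]].
Proof.
move=> p1 Mw [[mw _ wpos] [c hc]] v.
have wv : {ae leb n, forall y, w y = v y} := positive_rep_ae wpos.
have mv : measurable_fun setT v by exact: measurable_positive_rep.
have v0 y : 0 < v y by exact: positive_rep_gt0.
split.
- have Mv := Muckenhoupt_ae_eq mv v0 wv Mw.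
  by have [K _ AK] := Muckenhoupt_Apos_class n0 p1 v0 Mv; exists K.
- exists c => x r r0.
  rewrite -(average_ae_eq x r mw mv wv).
  have -> : average (fun y => v y `^ sigma) (eball x r) =
      average (fun y => w y `^ sigma) (eball x r).
    apply: average_ae_eq.
    + exact: (measurableT_comp (measurable_powR _)).
    + exact: (measurableT_comp (measurable_powR _)).
    + by move: wv; apply: filterS => y ->.
  exact: hc.
split; [exact: measurable_power_weight_abs..|].
by move: wv; apply: filterS => y wy; rewrite /power_weight wy.
Qed.

End Representatives.

Section PowerWeights.
Context {R : realType} {n : nat} (n0 : (0 < n)%N).
Implicit Types (x y z : Rn R n) (r s g e p : R).

(** The value 1 at the origin keeps the function positive and compatible with
   taking powers. *)
Definition power_rep (g : R) : Rn R n -> R :=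
  fun y => if 0 < edist origin y then edist origin y `^ g else 1.

Lemma power_rep_gt0 g y : 0 < power_rep g y.
Proof. by rewrite /power_rep; case: ifPn => // h; rewrite powR_gt0. Qed.

Lemma power_repX (g e : R) y : power_rep g y `^ e = power_rep (g * e) y.
Proof. by rewrite /power_rep; case: ifPn => _; rewrite ?powR1// -powRrM. Qed.

Lemma measurable_power_rep g : measurable_fun setT (power_rep g).
Proof.
apply: measurable_fun_ifT => //.
- by apply: measurable_fun_ltr; [exact: measurable_cst|exact: measurable_edist].
- exact: (measurableT_comp (measurable_powR _) (measurable_edist _)).
Qed.

Lemma power_rep_ae g : {ae leb n, forall y, power_rep g y = edist origin y `^ g}.
Proof.
exists [set origin]; split; [exact: measurable_point|exact: leb_point|].
move=> y /=; apply: contra_notP => /edist_gt0 d0.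
by rewrite /power_rep d0.
Qed.

Lemma mass_power_rep g : - n%:R < g -> exists2 C : R, 0 < C & forall x s, 0 < s ->
  (mass (power_rep g) (eball x s) <= (C * vol x s * (edist origin x + s) `^ g)%:E)%E.
Proof.
move=> gn; have [C C0 hC] := mass_power_le n0 gn; exists C => // x s s0.
rewrite (_ : mass (power_rep g) (eball x s) = mass (fun y => edist origin y `^ g) (eball x s)).
  exact: hC.
apply: mass_ae_eq.
- exact: measurable_eball.
- exact: measurable_power_rep.
- exact: (measurableT_comp (measurable_powR _) (measurable_edist _)).
- exact: power_rep_ae.
Qed.

Lemma pos_weight_power_rep g : - n%:R < g -> pos_weight (power_rep g).
Proof.
move=> gn; have [C C0 hC] := mass_power_rep gn; split.
- exact: measurable_power_rep.
- exact: power_rep_gt0.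
- by move=> x r r0; apply: le_lt_trans (hC x r r0) (ltry _).
Qed.

Lemma bmass_power_rep g : - n%:R < g -> exists2 C : R, 0 < C & forall x s, 0 < s ->
  bmass (power_rep g) x s <= C * vol x s * (edist origin x + s) `^ g.
Proof.
move=> gn; have [C C0 hC] := mass_power_rep gn; exists C => // x s s0.
by rewrite -lee_fin -(bmassE x (pos_weight_power_rep gn) s0); exact: hC.
Qed.

Lemma dual_power_rep p g : dual_weight p (power_rep g) = power_rep (g * (1 - conj_exp p)).
Proof. by apply/funext => y; exact: power_repX. Qed.

(** By [bmass_power_rep] the averages over a ball of [|x|^g] and of its dual
   weight, a power [-g/(p-1)], are at most the powers [g] and [-g/(p-1)] of the
   same length, which cancel in the [A_p] product. *)
Lemma Apos_class_power p g : 1 <= p -> - n%:R < g ->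
  g < n%:R * (p - 1) \/ (p = 1 /\ g <= 0) -> exists K, Apos_class p K (power_rep g).
Proof.
move=> p1 gn hg; have pg := pos_weight_power_rep gn.
have [C C0 hC] := bmass_power_rep gn.
have m0 x r : 0 < r -> 0 < edist origin (x : Rn R n) + r.
  by move=> r0; rewrite ltr_wpDl// edist_ge0.
move: p1; rewrite le_eqVlt => /predU1P[p1|p1].
  have g0 : g <= 0 by case: hg => [|[]//]; rewrite -p1 subrr mulr0 => /ltW.
  exists C; rewrite /Apos_class -p1 eqxx; split => // x r r0.
  exists [set origin]; split; [exact: measurable_point|exact: leb_point|].
  move=> y /=; apply: contra_notP => /edist_gt0 d0 By; apply: (le_trans (hC x r r0)).
  rewrite /power_rep d0 ler_pM2l; last by rewrite mulr_gt0// vol_gt0.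
  rewrite -[g]opprK; apply: powRN_anti => //; last by rewrite oppr_ge0.
  by apply: (le_trans (edist_triangle origin x y)); rewrite lerD2l ltW.
have gp : g < n%:R * (p - 1) by case: hg => [//|[pe _]]; rewrite pe ltxx in p1.
have p10 : 0 < p - 1 by rewrite subr_gt0.
have eE : 1 - conj_exp p = - (p - 1)^-1 by rewrite -conj_expB1// opprB.
have gen : - n%:R < g * (1 - conj_exp p) by rewrite eE mulrN ltrN2 ltr_pdivrMr.
have [D D0 hD] := bmass_power_rep gen.
exists (C * D `^ (p - 1)); rewrite Apos_classP//; split => //.
  by rewrite dual_power_rep; exact: pos_weight_power_rep.
move=> x r r0; rewrite dual_power_rep.
have := hC x r r0; have := hD x r r0.
have W0 := bmass_gt0 x n0 pg r0.
have S0 := bmass_gt0 x n0 (pos_weight_power_rep gen) r0.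
have V0 := vol_gt0 x n0 r0.
have m_0 := m0 x r r0.
move: (vol x r) (bmass (power_rep g) x r)
  (bmass (power_rep (g * (1 - conj_exp p))) x r) (edist origin x + r) V0 W0 S0 m_0.
move=> V W S m V0 W0 S0 m_0 hS hW.
have hS' : S `^ (p - 1) <= D `^ (p - 1) * V `^ (p - 1) * m `^ (- g).
  move: hS => /(@ge0_ler_powR _ (p - 1) (ltW p10)); rewrite !nnegrE (ltW S0).
  rewrite !mulr_ge0 ?powR_ge0 ?(ltW D0) ?(ltW V0)// => /(_ isT isT).
  rewrite powRM ?powR_ge0 ?mulr_ge0 ?(ltW D0) ?(ltW V0)//.
  rewrite powRM ?(ltW D0) ?(ltW V0)// -powRrM.
  have ge : g * (1 - conj_exp p) * (p - 1) = - g.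
    by rewrite eE; field; rewrite gt_eqF.
  by rewrite ge.
apply: (le_trans (ler_pM (ltW W0) (powR_ge0 _ _) hW hS')).
rewrite -(mulr_powRB1 (ltW V0) (lt_trans ltr01 p1)) powRN.
have mg : 0 < m `^ g by rewrite powR_gt0.
by rewrite le_eqVlt; apply/orP; left; apply/eqP; field; rewrite gt_eqF.
Qed.

(** Lower bounds for the averages of [|x|^g] come from upper bounds for those of
   its dual weight of exponent [q], through the lower bound [vol_le_Ap] for the
   [A_q] product; [q] is taken large so that the dual weight is locally
   integrable. *)
Lemma bmass_power_rep_ge g : - n%:R < g -> exists2 C : R, 0 < C & forall x s, 0 < s ->
  C * vol x s * (edist origin x + s) `^ g <= bmass (power_rep g) x s.
Proof.
move=> gn; have pg := pos_weight_power_rep gn.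
pose q : R := `|g| + 2.
have q1 : 1 < q by rewrite /q; have := normr_ge0 g; lra.
have q10 : 0 < q - 1 by rewrite subr_gt0.
have eE : 1 - conj_exp q = - (q - 1)^-1 by rewrite -conj_expB1// opprB.
have gen : - n%:R < g * (1 - conj_exp q).
  rewrite eE mulrN ltrN2 ltr_pdivrMr//.
  have n1 : 1 <= n%:R :> R by rewrite ler1n.
  apply: (@lt_le_trans _ _ (q - 1)); last by rewrite ler_peMl// ltW.
  by rewrite /q; have := ler_norm g; lra.
have [D D0 hD] := bmass_power_rep gen.
exists (D `^ (q - 1))^-1; first by rewrite invr_gt0 powR_gt0.
move=> x r r0; have := hD x r r0.
have psd : pos_weight (dual_weight q (power_rep g)).
  by rewrite dual_power_rep; exact: pos_weight_power_rep.
have := vol_le_Ap n0 x q1 pg psd r0; rewrite dual_power_rep.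
have W0 := bmass_gt0 x n0 pg r0.
have S0 := bmass_gt0 x n0 (pos_weight_power_rep gen) r0.
have V0 := vol_gt0 x n0 r0.
have m_0 : 0 < edist origin x + r by rewrite ltr_wpDl// edist_ge0.
move: (vol x r) (bmass (power_rep g) x r)
  (bmass (power_rep (g * (1 - conj_exp q))) x r) (edist origin x + r) V0 W0 S0 m_0.
move=> V W S m V0 W0 S0 m_0 hV hS.
have Dq : 0 < D `^ (q - 1) by rewrite powR_gt0.
have Vq : 0 < V `^ (q - 1) by rewrite powR_gt0.
have mg : 0 < m `^ g by rewrite powR_gt0.
have hS' : S `^ (q - 1) <= D `^ (q - 1) * V `^ (q - 1) * m `^ (- g).
  move: hS => /(@ge0_ler_powR _ (q - 1) (ltW q10)); rewrite !nnegrE (ltW S0).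
  rewrite !mulr_ge0 ?powR_ge0 ?(ltW D0) ?(ltW V0)// => /(_ isT isT).
  rewrite powRM ?powR_ge0 ?mulr_ge0 ?(ltW D0) ?(ltW V0)//.
  rewrite powRM ?(ltW D0) ?(ltW V0)// -powRrM.
  have ge : g * (1 - conj_exp q) * (q - 1) = - g.
    by rewrite eE; field; rewrite gt_eqF.
  by rewrite ge.
have := le_trans hV (ler_wpM2l (ltW W0) hS').
rewrite -(mulr_powRB1 (ltW V0) (lt_trans ltr01 q1)) powRN => h.
have h' : V * V `^ (q - 1) <= W * D `^ (q - 1) / m `^ g * V `^ (q - 1).
  by apply: (le_trans h); rewrite le_eqVlt; apply/orP; left; apply/eqP; ring.
rewrite ler_pM2r// ler_pdivlMr// in h'.
by rewrite -mulrA ler_pdivrMl// (mulrC _ W).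
Qed.

Lemma reverse_Hoelder_power g (sigma : R) : 1 < sigma -> - n%:R < g -> - n%:R < g * sigma ->
  exists c : R, forall x r, 0 < r ->
    (average (fun y => power_rep g y `^ sigma)%R (eball x r) `^ sigma^-1 <=
     c%:E * average (power_rep g) (eball x r))%E.
Proof.
move=> sg1 gn gsn; have sg0 : 0 < sigma by apply: lt_trans sg1.
have [C C0 hC] := bmass_power_rep gsn.
have [D D0 hD] := bmass_power_rep_ge gn.
exists (C `^ sigma^-1 / D) => x r r0.
have -> : (fun y => power_rep g y `^ sigma) = power_rep (g * sigma).
  by apply/funext => y; exact: power_repX.
rewrite (average_pos _ (pos_weight_power_rep gsn))// (average_pos _ (pos_weight_power_rep gn))//.
rewrite poweR_EFin -EFinM lee_fin.
have := hC x r r0; have := hD x r r0.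
have S0 := bmass_gt0 x n0 (pos_weight_power_rep gsn) r0.
have V0 := vol_gt0 x n0 r0.
have m_0 : 0 < edist origin x + r by rewrite ltr_wpDl// edist_ge0.
move: (vol x r) (bmass (power_rep g) x r)
  (bmass (power_rep (g * sigma)) x r) (edist origin x + r) V0 S0 m_0.
move=> V W S m V0 S0 m_0 hW hS.
apply: (@le_trans _ _ ((C * m `^ (g * sigma)) `^ sigma^-1)).
  apply: ge0_ler_powR; rewrite ?invr_ge0 ?(ltW sg0)//.
  - by rewrite nnegrE divr_ge0// ltW.
  - by rewrite nnegrE mulr_ge0 ?powR_ge0// ltW.
  - by rewrite ler_pdivrMr// mulrAC.
rewrite powRM ?powR_ge0 ?(ltW C0)// -powRrM -mulrA divff ?mulr1 ?(gt_eqF sg0)//.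
rewrite -mulrA ler_pM2l ?powR_gt0// ler_pdivlMl// ler_pdivlMr//.
by rewrite mulrAC.
Qed.

End PowerWeights.

(** * Choice of the exponents *)

Section Exponents.
Context {R : realType}.
Implicit Types (p lam beta g N : R).

(** With [N] the dimension, [al] is the part of [beta] absorbed by the Morrey
   scaling and [g] is the exponent of a power weight in [A_p]. For
   [p > 1] the inequality [beta - lam < N (p - 1)] leaves an interval of values
   of [g], and its midpoint is taken when it is nonnegative. *)
Lemma split_exponent p lam beta N : 1 <= p -> 0 <= lam -> lam < N -> 0 < N ->
  lam - N < beta -> beta < lam + N * (p - 1) ->
  exists al g, [/\ beta = al + g, 0 <= al, al = 0 \/ al < lam, lam - N < g &
    g < N * (p - 1) \/ (p = 1 /\ g <= 0)].
Proof.
move=> p1 lam0 lamN N0 b1 b2.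
have Np : 0 <= N * (p - 1) by rewrite mulr_ge0 ?subr_ge0// ltW.
have [bN|bN] := ltP beta (N * (p - 1)).
  by exists 0, beta; split; rewrite ?add0r//; left.
have b0 : 0 <= beta by apply: le_trans bN.
move: p1; rewrite le_eqVlt => /predU1P[pE|p1].
  exists beta, 0; rewrite -pE subrr mulr0 addr0 in b2 *; split; rewrite ?addr0//.
  - by right.
  - by rewrite subr_lt0.
  - by right.
have Np0 : 0 < N * (p - 1) by rewrite mulr_gt0// subr_gt0.
pose m := (beta - lam + N * (p - 1)) / 2.
have [m0|m0] := leP 0 m.
  exists (beta - m), m; split; first by rewrite subrK.
  - by rewrite /m; lra.
  - by right; rewrite /m; lra.
  - by lra.
  - by left; rewrite /m; lra.
exists beta, 0; rewrite addr0; split => //.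
- by right; move: m0; rewrite /m; lra.
- by lra.
- by left.
Qed.

(** The requirements say that [1/sigma] lies strictly between [- g / N] and
   [1 - lam / N]; the value chosen is the midpoint of that interval, cut at 0. *)
Lemma exists_Hoelder_exponent lam g N : 0 <= lam -> lam < N -> lam - N < g ->
  exists sigma, [/\ 1 < sigma, lam < N / conj_exp sigma & - N < g * sigma].
Proof.
move=> lam0 lamN gN; have N0 : 0 < N by apply: le_lt_trans lamN.
pose M := Num.max 0 (- g).
have M0 : 0 <= M by rewrite le_max lexx.
have Mg : - M <= g by rewrite lerNl le_max lexx orbT.
have MN : M < N - lam by rewrite gt_max; apply/andP; split; lra.
have D0 : 0 < M + N - lam by lra.
exists (2 * N / (M + N - lam)); split.
- by rewrite ltr_pdivlMr//; lra.
- have -> : N / conj_exp (2 * N / (M + N - lam)) = (N + lam - M) / 2.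
    rewrite /conj_exp; field.
    by rewrite !gt_eqF//=; lra.
  by lra.
- by rewrite mulrA ltr_pdivlMr//; nra.
Qed.

End Exponents.

Theorem corollary4p1 (R : realType) (n : nat) (p0 : R)
    (T : (Rn R n -> R) -> Rn R n -> R) :
  1 <= p0 -> acts_on p0 T ->
  (strong_bound p0 T ->
    (* (i) *)
    (forall (p sigma lam alpha : R) (w : Rn R n -> R),
      1 < p \/ (p = 1 /\ p0 = 1) ->
      1 < sigma ->
      Muckenhoupt p w -> reverse_Hoelder sigma w ->
      0 <= lam -> lam < n%:R / conj_exp sigma ->
      0 < alpha -> alpha < lam ->
      (forall f : Rn R n -> R, in_morrey p lam (power_weight alpha w) f -> union_Lp p0 f) /\
      (exists C : R, forall f : Rn R n -> R, in_morrey p lam (power_weight alpha w) f ->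
        (morrey_norm p lam (power_weight alpha w) (T f) <=
         C%:E * morrey_norm p lam (power_weight alpha w) f)%E)) /\
    (* (ii) *)
    (forall (p lam beta : R),
      1 < p \/ (p = 1 /\ p0 = 1) ->
      0 <= lam -> lam < n%:R ->
      lam - n%:R < beta -> beta < lam + n%:R * (p - 1) ->
      (forall f : Rn R n -> R, in_morrey p lam (abs_power beta) f ->
        union_Lp p0 f) /\
      (exists C : R, forall f : Rn R n -> R, in_morrey p lam (abs_power beta) f ->
        (morrey_norm p lam (abs_power beta) (T f) <=
         C%:E * morrey_norm p lam (abs_power beta) f)%E))) /\
  (* (iii) *)
  (p0 = 1 -> weak_bound T ->
    forall (sigma lam alpha : R) (w : Rn R n -> R),
      1 < sigma ->
      Muckenhoupt 1 w -> reverse_Hoelder sigma w ->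
      0 <= lam -> lam < n%:R / conj_exp sigma ->
      0 < alpha -> alpha < lam ->
      (forall f : Rn R n -> R, in_morrey 1 lam (power_weight alpha w) f -> union_Lp 1 f) /\
      (exists C : R, forall f : Rn R n -> R, in_morrey 1 lam (power_weight alpha w) f ->
        (weak_morrey_norm 1 lam (power_weight alpha w) (T f) <=
         C%:E * morrey_norm 1 lam (power_weight alpha w) f)%E)).
Proof.
move=> p01 hact.
have dim_gt0 (lam : R) (q : R) : 0 <= lam -> lam < n%:R / q -> (0 < n)%N.
  by case: (n) => // lam0; rewrite mul0r ltNge lam0.
split=> [hT|p0E hT].
  have transfer (p lam : R) (u v : Rn R n -> R) :
      measurable_fun setT u -> measurable_fun setT v ->
      {ae leb n, forall y, u y = v y} ->
      (forall f, in_morrey p lam v f -> union_Lp p0 f) /\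
      (exists C : R, forall f, in_morrey p lam v f ->
        (morrey_norm p lam v (T f) <= C%:E * morrey_norm p lam v f)%E) ->
      (forall f, in_morrey p lam u f -> union_Lp p0 f) /\
      (exists C : R, forall f, in_morrey p lam u f ->
        (morrey_norm p lam u (T f) <= C%:E * morrey_norm p lam u f)%E).
    move=> mu mv uv [hU [C hC]].
    have uvf f : in_morrey p lam u f -> in_morrey p lam v f.
      by move=> [mf]; rewrite (morrey_norm_ae_eq p lam mf mu mv uv).
    split=> [f /uvf/hU//|]; exists C => f hf; have hv := uvf f hf.
    have [mf _] := hf; have mT := hact f (hU f hv).
    by rewrite !(morrey_norm_ae_eq p lam _ mu mv uv)//; exact: hC.
  have p_ge1 (p : R) : 1 < p \/ (p = 1 /\ p0 = 1) -> 1 <= p.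
    by case=> [/ltW//|[-> _]].
  split=> [p sigma lam alpha w hp sg1 Mw RHw lam0 lamn al0 allam|p lam beta hp lam0 lamn b1 b2].
    have n0 := dim_gt0 _ _ lam0 lamn; have p1 := p_ge1 p hp.
    have [[K AK] [c hc] [mU mV UV]] := positive_representative n0 alpha p1 Mw RHw.
    apply: (transfer p lam _ _ mU mV UV).
    apply: (morrey_strong_bound n0 p1 AK sg1 hc lam0 lamn (ltW al0) (or_intror allam) hact).
    exact: extends_boundedlyP.
  have n0 : (0 < n)%N by apply: (dim_gt0 lam 1) => //; rewrite divr1.
  have p1 := p_ge1 p hp; have n0' : 0 < n%:R :> R by rewrite ltr0n.
  have [al [g [bE al0 allam gn gp]]] := split_exponent p1 lam0 lamn n0' b1 b2.
  have [sigma [sg1 lams gs]] := exists_Hoelder_exponent lam0 lamn gn.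
  have gn' : - n%:R < g by apply: le_lt_trans gn; lra.
  have [K AK] := Apos_class_power n0 p1 gn' gp.
  have [c hc] := reverse_Hoelder_power n0 sg1 gn' gs.
  have md (b : R) : measurable_fun setT (fun y : Rn R n => edist origin y `^ b).
    exact: (measurableT_comp (measurable_powR _) (measurable_edist _)).
  have absE (b : R) : abs_power b = (fun y : Rn R n => edist origin y `^ b).
    by apply/funext => y; rewrite /abs_power enormE edistC.
  have mU : measurable_fun setT (abs_power beta : Rn R n -> R) by rewrite absE.
  have mV : measurable_fun setT (power_weight al (power_rep g) : Rn R n -> R).
    by apply: measurable_power_weight_abs; exact: measurable_power_rep.
  have UV : {ae leb n, forall y, abs_power beta y = power_weight al (power_rep g) y}.
    exists [set origin]; split; [exact: measurable_point|exact: leb_point|].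
    move=> y /=; apply: contra_notP => /edist_gt0 d0.
    rewrite /power_weight !absE /power_rep d0 bE powRD//.
    by rewrite (gt_eqF d0) implybT.
  apply: (transfer p lam _ _ mU mV UV).
  apply: (morrey_strong_bound n0 p1 AK sg1 hc lam0 lams al0 allam hact).
  exact: extends_boundedlyP.
move=> sigma lam alpha w sg1 Mw RHw lam0 lamn al0 allam.
have n0 := dim_gt0 _ _ lam0 lamn; rewrite p0E in hact.
have [[K AK] [c hc] [mU mV UV]] := positive_representative n0 alpha (lexx 1) Mw RHw.
have [hU [C hC]] := morrey_weak_bound n0 AK sg1 hc lam0 lamn (ltW al0) (or_intror allam) hact hT.
have uvf f : in_morrey 1 lam (power_weight alpha w) f ->
    in_morrey 1 lam (power_weight alpha (positive_rep w)) f.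
  by move=> [mf]; rewrite (morrey_norm_ae_eq 1 lam mf mU mV UV).
split=> [f /uvf/hU//|]; exists C => f hf; have hv := uvf f hf.
have [mf _] := hf; have mT := hact f (hU f hv).
rewrite (weak_morrey_norm_ae_eq 1 lam mT mU mV UV) (morrey_norm_ae_eq 1 lam mf mU mV UV).
exact: hC.
Qed.
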